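(* Let $0\le\gamma\le1$, $k\ge8$, and let $f,g,h$ be functions on $\mathbb R^3$. Then: (1) $$\langle Q(f,g),h\langle v\rangle^{2k}\rangle\le\frac{C_1}{\sqrt k}\|g\|_{L^1_\gamma}\|f\|_{L^2_{k+\gamma/2}}\|h\|_{L^2_{k+\gamma/2}}+C_2\|f\|_{L^1_\gamma}\|g\|_{L^2_{k+\gamma/2}}\|h\|_{L^2_{k+\gamma/2}}+C_k\|f\|_{L^2_k}\|g\|_{L^2_k}\|h\|_{L^2_k},$$ (2) $$\|Q(f,g)\|_{L^2_k}\le\frac{C_1}{\sqrt k}\|g\|_{L^1_\gamma}\|f\|_{L^2_{k+\gamma}}+C_2\|f\|_{L^1_\gamma}\|g\|_{L^2_{k+\gamma}}+C_k\|f\|_{L^2_k}\|g\|_{L^2_k},$$ where $C_1,C_2$ are absolute constants and $C_k$ depends only on $k$.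
   Context: $\langle v\rangle=\sqrt{1+|v|^2}$, $\|f\|_{L^p_l}=\big(\int_{\mathbb R^3}|f|^p\langle v\rangle^{lp}dv\big)^{1/p}$, $\langle f,g\rangle=\int_{\mathbb R^3}fg\,dv$. The collision operator is $$Q(g,f)(v)=\int_{\mathbb{R}^3}\int_{\mathbb{S}^2}|v-v_*|^\gamma\big[g(v_*')f(v')-g(v_* )f(v)\big]\,d\sigma\,dv_*,$$ $v'=\frac{v+v_*}{2}+\frac{|v-v_*|}{2}\sigma$, $v_*'=\frac{v+v_*}{2}-\frac{|v-v_*|}{2}\sigma$. *)

(* Defs.v *)
From HB Require Import structures.
From mathcomp Require Import all_boot all_order all_algebra.
From mathcomp Require Import all_classical all_reals all_analysis.
Set Implicit Arguments. Unset Strict Implicit. Unset Printing Implicit Defensive.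
Import Order.TTheory GRing.Theory Num.Theory.
Import numFieldNormedType.Exports.
Local Open Scope classical_set_scope.
Local Open Scope ring_scope.

Section Defs.
Variable R : realType.
Local Notation V3 := ((R * R) * R)%type.

Local Notation leb := (@lebesgue_measure R).
Local Notation leb2 := (leb \x leb)%E.
Local Notation leb3 := (leb2 \x leb)%E.

Definition vx (v : V3) : R := v.1.1.
Definition vy (v : V3) : R := v.1.2.
Definition vz (v : V3) : R := v.2.
Definition mk3 (a b c : R) : V3 := ((a, b), c).
Definition vadd (u v : V3) : V3 := mk3 (vx u + vx v) (vy u + vy v) (vz u + vz v).
Definition vscale (a : R) (v : V3) : V3 := mk3 (a * vx v) (a * vy v) (a * vz v).
Definition vsub (u v : V3) : V3 := vadd u (vscale (-1) v).
Definition vnorm (v : V3) : R := Num.sqrt (vx v ^+ 2 + vy v ^+ 2 + vz v ^+ 2).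
Definition jb (v : V3) : R := Num.sqrt (1 + vnorm v ^+ 2).

(* Surface measure on S^2 via spherical coordinates:
   int_{S^2} F dsigma = int_{[0,pi] x [0,2pi]} F(sph (t,p)) sin t d(t,p). *)
Definition sph (tp : R * R) : V3 :=
  mk3 (sin tp.1 * cos tp.2) (sin tp.1 * sin tp.2) (cos tp.1).

Definition vpost (v vs sig : V3) : V3 :=
  vadd (vscale (2^-1) (vadd v vs)) (vscale (vnorm (vsub v vs) / 2) sig).
Definition vspost (v vs sig : V3) : V3 :=
  vsub (vscale (2^-1) (vadd v vs)) (vscale (vnorm (vsub v vs) / 2) sig).

Definition Qop (gam : R) (g f : V3 -> R) (v : V3) : R :=
  Rintegral ((leb3 \x leb) \x leb)%E
    ([set w : V3 * R * R | 0 <= w.1.2 <= pi /\ 0 <= w.2 <= 2 * pi])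
    (fun w : V3 * R * R =>
       let vs := w.1.1 in let sig := sph (w.1.2, w.2) in
       powR (vnorm (vsub v vs)) gam *
       (g (vspost v vs sig) * f (vpost v vs sig) - g vs * f v) * sin w.1.2).

Definition wnorm (p l : R) (f : V3 -> R) : \bar R :=
  poweR (\int[leb3]_v (powR `|f v| p * powR (jb v) (l * p))%:E) p^-1.

Definition pair (f g : V3 -> R) : R := Rintegral leb3 setT (fun v => f v * g v).
End Defs.

(* Main.v *)
Require Import Defs.
From HB Require Import structures.
From mathcomp Require Import all_boot all_order all_algebra.
From mathcomp Require Import all_classical all_reals all_analysis.
From mathcomp Require Import measurable_realfun ring lra.
Import Order.TTheory GRing.Theory Num.Theory.
Import numFieldNormedType.Exports.
Local Open Scope classical_set_scope.
Local Open Scope ring_scope.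

Set Implicit Arguments.
Unset Strict Implicit.
Unset Printing Implicit Defensive.

(** Only absolute values matter. For a fixed center c = (v + vs) / 2, swapping the relative
    velocity y = v - vs with |y| sigma turns the gain term into a trilinear form in the
    pre-collisional velocities w = c + y / 2, w' = c - y / 2 and the post-collisional
    v = c + |y| sigma / 2. With s = sin (theta / 2), theta the deviation angle, one has
    <v> <= 2 <w> + s <w'>. Either s <w'> >= 2 k <w>, and <v>^k <= e s^k <w'>^k, or <v> is at
    most (2 + 2 k) <w>; the same holds with w and w' exchanged and cos for sin, and s^2 or
    cos^2 is at least 1/2. The second case costs a factor depending on k but puts only a
    weight 2 on one factor, an L^1 norm controlled by L^2_k. In the first case, for fixed w,
    Cauchy-Schwarz splits the form in two: sigma |-> s^(2m), with 2m about k, has integral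
    4 pi / (m + 1) over the sphere, which makes the half with w' small like 1 / k, while
    y |-> w + (|y| sigma - y) / 2 has Jacobian of order s^2, which keeps the half with v
    bounded; their geometric mean gives 1 / sqrt k. The second estimate follows by duality. *)

(** Lebesgue measure on R^3 is an iterated product here, so every change of variables (rotations,
    spherical coordinates, the collision map) is assembled from one-variable substitutions and
    Tonelli's theorem. [Qop] and [pair] are real values extracted by [fine], which is 0 on an
    infinite integral, and the measurability of [Qop] is never established. The estimates are
    therefore made on an extended-real majorant in which gain and loss are added, so that nothing
    has to converge in advance. Cauchy-Schwarz always appears as Young's inequality with a free
    parameter, integrated first and optimised afterwards. Both estimates are instances of one bound
    with a parameter [b] between 0 and [gam], which leaves the weight [k + b] on the test function
    and [k + gam - b] on one of the other two factors. The loss term has no deviation angle to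
    integrate, hence no decay in k; together with the half of the gain in which [f] takes the L^1
    norm it makes up the second term. *)

(** * Integration against the pushforward of a density *)

Section WeightedPushforward.
Local Open Scope ereal_scope.
Context d1 d2 (T1 : measurableType d1) (T2 : measurableType d2) (R : realType).
Variable mu : {measure set T1 -> \bar R}.

(* The proof arguments are only there for the measure structure to be inferred. *)
Definition wpushforward (phi : T1 -> T2) (w : T1 -> R)
    of measurable_fun setT phi & measurable_fun setT w
    & (forall x, (0 <= w x)%R) :=
  fun A : set T2 => \int[mu]_(x in phi @^-1` A) (w x)%:E.

Variables (phi : T1 -> T2) (w : T1 -> R).
Hypothesis mphi : measurable_fun setT phi.
Hypothesis mw : measurable_fun setT w.
Hypothesis w0 : forall x, (0 <= w x)%R.
Local Notation nu := (wpushforward mphi mw w0).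

Let mpre A : measurable A -> measurable (phi @^-1` A).
Proof. by move=> mA; rewrite -[X in measurable X]setTI; exact: mphi. Qed.

Let wpushforward0 : nu set0 = 0.
Proof. by rewrite /wpushforward preimage_set0 integral_set0. Qed.

Let wpushforward_ge0 A : 0 <= nu A.
Proof. by apply: integral_ge0 => x _; rewrite lee_fin. Qed.

Let wpushforward_sigma_additive : semi_sigma_additive nu.
Proof.
move=> F mF tF mUF; rewrite /wpushforward preimage_bigcup.
rewrite ge0_integral_bigcup//.
- by apply: is_cvg_ereal_nneg_natsum_cond => n _ _; exact: wpushforward_ge0.
- by move=> k; exact: mpre.
- exact/measurable_EFinP/measurable_funTS.
- by move=> x _; rewrite lee_fin.
- apply/trivIsetP => /= i j _ _ ij; rewrite -preimage_setI.
  by move/trivIsetP : tF => /(_ i j Logic.I Logic.I ij) ->; rewrite preimage_set0.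
Qed.

HB.instance Definition _ := isMeasure.Build _ _ _ nu
  wpushforward0 wpushforward_ge0 wpushforward_sigma_additive.

Import HBNNSimple.

(** Both sides are limits along the simple functions [g_ n] increasing to [G], and on the indicator
    of a level set the identity is the definition of the pushed-forward measure. *)
Lemma ge0_integral_wpushforward (G : T2 -> \bar R) :
  measurable_fun setT G -> (forall y, 0 <= G y) ->
  \int[nu]_y G y = \int[mu]_x (G (phi x) * (w x)%:E).
Proof.
move=> mG G0.
pose g_ := nnsfun_approx measurableT mG.
have cg y : EFin \o g_^~ y @ \oo --> G y.
  by apply: cvg_nnsfun_approx => // *; exact: G0.
have ndg y : {homo (fun n => g_ n y) : m n / (m <= n)%N >-> (m <= n)%R}.
  by move=> m n mn; exact/lefP/nd_nnsfun_approx.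
transitivity (limn (fun n => \int[nu]_y (g_ n y)%:E)).
  rewrite -monotone_convergence//.
  - by apply: eq_integral => y _; apply/esym/cvg_lim => //; exact: cg.
  - by move=> n; exact/measurable_EFinP/measurable_funP.
  - by move=> n y _; rewrite lee_fin.
  - by move=> y _ m n mn; rewrite lee_fin; exact: ndg.
transitivity (limn (fun n => \int[mu]_x ((g_ n (phi x))%:E * (w x)%:E))); last first.
  rewrite -monotone_convergence//.
  - apply: eq_integral => x _; apply/cvg_lim => //.
    apply: cvgeZr => //; exact: cg.
  - move=> n; apply: emeasurable_funM; apply/measurable_EFinP => //.
    by apply: measurableT_comp => //; exact: measurable_funP.
  - by move=> n x _; rewrite mule_ge0// lee_fin.
  - by move=> x _ m n mn; rewrite lee_wpmul2r// ?lee_fin//; exact: ndg.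
congr (limn _); apply/funext => n.
under [LHS]eq_integral do rewrite fimfunE -fsumEFin//.
rewrite ge0_integral_fsum//; last 2 first.
- by move=> r; exact/measurable_EFinP/measurable_funM.
- by move=> r y _; rewrite nnfun_muleindic_ge0.
transitivity (\sum_(r \in range (g_ n)) \int[mu]_x
   ((r * \1_(g_ n @^-1` [set r]) (phi x))%:E * (w x)%:E)).
  apply: eq_fsbigr => r /set_mem[y _ <-{r}].
  have r0 : (0 <= g_ n y)%R by [].
  set r := g_ n y; set A := g_ n @^-1` [set r].
  have mA : measurable A by exact: measurable_sfunP.
  under [LHS]eq_integral do rewrite EFinM.
  rewrite ge0_integralZl_EFin//; last exact/measurable_EFinP/measurable_indic.
  rewrite integral_indic// setIT /= /wpushforward.
  under [RHS]eq_integral do rewrite EFinM -muleA.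
  rewrite ge0_integralZl_EFin//; last 2 first.
  - by move=> x _; rewrite mule_ge0// lee_fin.
  - apply: emeasurable_funM; apply/measurable_EFinP => //.
    by apply: measurableT_comp => //; exact: measurable_indic.
  congr (_ * _).
  rewrite integral_mkcond; apply: eq_integral => x _.
  rewrite epatch_indic muleC; congr (_ * _).
rewrite -ge0_integral_fsum//.
- apply: eq_integral => x _; rewrite [in RHS]fimfunE -[in RHS]fsumEFin//.
  rewrite ge0_mule_fsuml// => r.
  exact: nnfun_muleindic_ge0.
- move=> r; apply: emeasurable_funM; apply/measurable_EFinP => //.
  by apply: measurable_funM => //; apply: measurableT_comp => //; exact: measurable_indic.
- by move=> r x _; rewrite mule_ge0 ?lee_fin// -lee_fin EFinM nnfun_muleindic_ge0.
Qed.

End WeightedPushforward.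

(** * Substitution by an increasing C^1 function on the line *)

Section ChangeOfVariable.
Context (R : realType).
Local Notation mu := (@lebesgue_measure R).
Variables (phi dphi : R -> R).
Hypothesis phi' : forall x : R, is_derive x 1 phi (dphi x).
Hypothesis cdphi : continuous dphi.
Hypothesis dphi0 : forall x, 0 < dphi x.

Let cphi : continuous phi.
Proof.
move=> x; apply/differentiable_continuous/derivable1_diffP.
by have [] := phi' x.
Qed.

Let wphi a b : {within `[a, b], continuous phi}.
Proof. exact/continuous_subspaceT. Qed.

Let ltphi x y : x < y -> phi x < phi y.
Proof.
move=> xy; rewrite -subr_gt0.
have [c _ ->] := @MVT R phi dphi x y xy (fun z _ => phi' z) (@wphi x y).
by rewrite mulr_gt0// subr_gt0.
Qed.

Let lephi x y : (phi x <= phi y) = (x <= y).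
Proof. exact: (le_mono ltphi). Qed.

Let ltphiE x y : (phi x < phi y) = (x < y).
Proof. exact: (leW_mono lephi). Qed.

Let ivt a b v : phi a <= v -> v <= phi b -> exists2 c, a <= c <= b & phi c = v.
Proof.
move=> av vb; have ab : a <= b by rewrite -lephi (le_trans av).
have [|c + <-] := @IVT R phi a b v ab (@wphi a b).
  by rewrite (min_idPl _) ?lephi// (max_idPr _) ?lephi// av.
by rewrite in_itv/= => h; exists c.
Qed.

Let mphi : measurable_fun [set: measurableTypeR R] (phi : _ -> measurableTypeR R).
Proof. exact: continuous_measurable_fun. Qed.

Let mdphi : measurable_fun setT dphi.
Proof. exact: continuous_measurable_fun. Qed.

Let int_dphi x y : x <= y ->
  (\int[mu]_(z in `]x, y]) (dphi z)%:E = (phi y - phi x)%:E)%E.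
Proof.
rewrite le_eqVlt => /orP[/eqP ->|xy].
  by rewrite set_itvoc0 integral_set0 subrr.
rewrite integral_itv_obnd_cbnd; last exact/measurable_EFinP/measurable_funTS.
rewrite (@continuous_FTC2 R dphi phi x y xy) ?EFinB//.
- exact/continuous_subspaceT.
- split.
  + by move=> z _; have [] := phi' z.
  + exact/cvg_at_right_filter/cphi.
  + exact/cvg_at_left_filter/cphi.
- by move=> z _; rewrite derive1E derive_val.
Qed.

(** The density is cut off outside []a, b]] so that the measures to be compared are finite, as their
    uniqueness argument requires. *)
Let wgt a b (x : R) : R := dphi x * \1_`]a, b]%classic x.

Let mwgt a b : measurable_fun [set: measurableTypeR R] (wgt a b).
Proof. by apply: measurable_funM => //; exact: measurable_indic. Qed.

Let wgt0 a b x : 0 <= wgt a b x.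
Proof. by rewrite mulr_ge0 ?indicE// ltW. Qed.

(** The fundamental theorem of calculus: once []c, d]] is clipped to []phi a, phi b]], its endpoints
    are values of [phi], its preimage is an interval []x, y]], and [dphi] integrates over that to
    [phi y - phi x]. *)
Let wpushforward_oc a b c d : a <= b ->
  wpushforward mu mphi (mwgt a b) (wgt0 a b) `]c, d]%classic =
  mrestr mu (measurable_itv `]phi a, phi b]) `]c, d]%classic.
Proof.
move=> ab; rewrite /wpushforward /mrestr.
have -> : (\int[mu]_(x in phi @^-1` `]c, d]) (wgt a b x)%:E =
    \int[mu]_(x in (phi @^-1` `]c, d]) `&` `]a, b]) (dphi x)%:E)%E.
  rewrite [RHS]integral_mkcondr; apply: eq_integral => x _.
  by rewrite /wgt epatch_indic EFinM.
set c' := Order.max c (phi a); set d' := Order.min d (phi b).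
have -> : `]c, d]%classic `&` `]phi a, phi b]%classic = `]c', d']%classic.
  apply/seteqP; split => x /=; rewrite !in_itv/= gt_max le_min.
    by move=> [/andP[-> ->] /andP[-> ->]].
  by move=> /andP[/andP[-> ->] /andP[-> ->]].
have [cd|dc] := ltP c' d'; last first.
  rewrite [in RHS]set_itv_ge ?measure0 ?bnd_simp -?leNgt//.
  rewrite (_ : _ `&` _ = set0) ?integral_set0//.
  apply/seteqP; split => x //=; rewrite !in_itv/= => -[/andP[cx xd] /andP[ax xb]].
  suff : c' < d' by rewrite ltNge dc.
  rewrite /c' /d' gt_max !lt_min (lt_le_trans cx xd) (lt_le_trans cx) ?lephi//=.
  by rewrite ltphiE (lt_le_trans ax xb) andbT (lt_le_trans _ xd)// ltphiE.
have [x xab xc] : exists2 x, a <= x <= b & phi x = c'.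
  apply: ivt; first by rewrite /c' le_max lexx orbT.
  by rewrite (le_trans (ltW cd))// /d' ge_min lexx orbT.
have [y yab yd] : exists2 x, a <= x <= b & phi x = d'.
  apply: ivt; last by rewrite /d' ge_min lexx orbT.
  by rewrite (le_trans _ (ltW cd))// /c' le_max lexx orbT.
have -> : (phi @^-1` `]c, d]%classic) `&` `]a, b]%classic = `]x, y]%classic.
  apply/seteqP; split => z /=; rewrite !in_itv/=.
  - move=> [/andP[cz zd] /andP[az zb]].
    rewrite -(ltphiE x) -(lephi z) xc yd /c' /d' gt_max le_min.
    by rewrite cz zd ltphiE az lephi.
  - rewrite -(ltphiE x) -(lephi z) xc yd /c' /d' gt_max le_min.
    by rewrite ltphiE lephi => /andP[/andP[-> ->] /andP[-> ->]].
have xy : x <= y by rewrite -lephi xc yd ltW.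
by rewrite int_dphi// xc yd lebesgue_measure_itv/= lte_fin cd EFinB.
Qed.

Let wpushforwardE a b A : a <= b -> measurable A ->
  wpushforward mu mphi (mwgt a b) (wgt0 a b) A =
  mrestr mu (measurable_itv `]phi a, phi b]) A.
Proof.
move=> ab mA.
apply: (@measure_unique _ R (measurableTypeR R) (@ocitv R)
  (fun n => `]-n%:R, n%:R]%classic) _ _ _ _
  (wpushforward mu mphi (mwgt a b) (wgt0 a b))
  (mrestr mu (measurable_itv `]phi a, phi b])) _ _ A mA) => //.
- exact: ocitvI.
- by move=> n; exact: is_ocitv.
- by rewrite bigcup_itvT.
- by move=> _ [[c d] _ <-]; exact: wpushforward_oc.
- move=> n; apply: (@le_lt_trans _ _ (mu `]phi a, phi b]%classic)).
    apply: (@le_trans _ _ (mrestr mu (measurable_itv `]phi a, phi b])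
      `]-n%:R, n%:R]%classic)).
      by rewrite le_eqVlt; apply/orP; left; apply/eqP; exact: wpushforward_oc.
    by apply: le_measure; rewrite ?inE//=; apply: measurableI.
  by rewrite lebesgue_measure_itv/=; case: ifPn => // _; rewrite ltry.
Qed.

Let change_of_variable_oc a b (G : R -> \bar R) : a <= b ->
  measurable_fun setT G -> (forall x, 0 <= G x)%E ->
  (\int[mu]_(x in `]a, b]) (G (phi x) * (dphi x)%:E) =
   \int[mu]_(y in `]phi a, phi b]) G y)%E.
Proof.
move=> ab mG G0.
transitivity (\int[wpushforward mu mphi (mwgt a b) (wgt0 a b)]_y G y)%E.
  rewrite ge0_integral_wpushforward// [LHS]integral_mkcond; apply: eq_integral => x _.
  by rewrite epatch_indic /wgt EFinM muleA.
(* Integration over []phi a, phi b]] is written as a pushforward by the identity with an indicator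
   density, so that the claim becomes an equality of two measures. *)
have m1 : measurable_fun [set: measurableTypeR R]
    (\1_(`]phi a, phi b]%classic : set (measurableTypeR R)) : _ -> R).
  exact: measurable_indic.
transitivity (\int[wpushforward mu (@measurable_id _ (measurableTypeR R) setT)
    m1 (fun x => ler0n _ _)]_y G y)%E; last first.
  rewrite ge0_integral_wpushforward// [RHS]integral_mkcond; apply: eq_integral => x _.
  by rewrite epatch_indic.
apply: eq_measure_integral => A mA _.
have := wpushforwardE ab mA; move=> /= ->.
rewrite /wpushforward integral_indic//.
by rewrite setIC.
Qed.

Let range_phi : range phi = \bigcup_n `]phi (- n%:R), phi n%:R]%classic.
Proof.
apply/seteqP; split => [_ [x _ <-]|y [n _]/=].
- have : (\bigcup_n `](- n%:R), n%:R]%classic) x by rewrite bigcup_itvT.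
  move=> [n _ /=]; rewrite in_itv/= => /andP[nx xn]; exists n => //=.
  by rewrite in_itv/= ltphiE lephi nx.
- rewrite in_itv/= => /andP[/ltW ny yn].
  by have [c _ <-] := ivt ny yn; exists c.
Qed.

(** The substitution on []-n, n]] passes to the limit. The images exhaust the range of [phi], which
    may be a proper interval; the angle and the hyperbola substitutions below are of this kind. *)
Lemma ge0_change_of_variable (G : R -> \bar R) :
  measurable_fun setT G -> (forall x, 0 <= G x)%E ->
  (\int[mu]_x (G (phi x) * (dphi x)%:E) = \int[mu]_(y in range phi) G y)%E.
Proof.
move=> mG G0.
have mGphi : measurable_fun [set: measurableTypeR R] (fun x => G (phi x) * (dphi x)%:E)%E.
  apply: emeasurable_funM; last exact/measurable_EFinP.
  by apply: (@measurableT_comp _ _ _ _ _ _ G _ phi).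
have cvgl : (\int[mu]_(x in `](- n%:R)%R, n%:R%R]) (G (phi x) * (dphi x)%:E) @[n --> \oo]
    --> \int[mu]_x (G (phi x) * (dphi x)%:E))%E.
  rewrite -(bigcup_itvT false false).
  apply: ge0_nondecreasing_set_cvg_integral => //.
  - move=> m n mn; apply/subsetPset => x /=; rewrite !in_itv/= => /andP[mx xm].
    by rewrite (le_lt_trans _ mx) ?lerN2 ?ler_nat// (le_trans xm)// ler_nat.
  - by move=> n; exact: measurable_funTS.
  - by move=> n x _; rewrite mule_ge0// lee_fin ltW.
have cvgr : (\int[mu]_(y in `]phi (- n%:R)%R, phi n%:R%R]) G y @[n --> \oo]
    --> \int[mu]_(y in range phi) G y)%E.
  rewrite range_phi.
  apply: ge0_nondecreasing_set_cvg_integral => //.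
  - move=> m n mn; apply/subsetPset => x /=; rewrite !in_itv/= => /andP[mx xm].
    by rewrite (le_lt_trans _ mx) ?lephi ?lerN2 ?ler_nat// (le_trans xm)// lephi ler_nat.
  - by move=> n; exact: measurable_funTS.
rewrite -(cvg_lim _ cvgl)// -(cvg_lim _ cvgr)//.
congr (limn _); apply/funext => n.
by apply: change_of_variable_oc => //; rewrite lerNl opprK ler0n || exact: le_trans (ler0n _ _).
Qed.

End ChangeOfVariable.

(** * Measurability of arithmetic, in the eta-expanded shapes that [mfun] matches *)

Section MeasurableArith.
Context (R : realType) d (T : measurableType d).
Implicit Types f g : T -> R.

Lemma measurable_funV f : measurable_fun setT f -> measurable_fun setT (fun x => (f x)^-1).
Proof.
move=> mf.
(* The reciprocal is expressed by real powers, which are measurable; at a zero of [f] both sides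
   vanish, since [0^-1] is 0. *)
have -> : (fun x => (f x)^-1) = (fun x => powR `|f x| (-1) * (f x * powR `|f x| (-1))).
  apply/funext => x; rewrite mulrCA -expr2.
  have [->|fx0] := eqVneq (f x) 0; first by rewrite invr0 mul0r.
  rewrite powRN powRr1// exprVn real_normK ?num_real// expr2 invfM mulrA divff//.
  by rewrite mul1r.
have mp : measurable_fun setT (fun x => powR `|f x| (-1)).
  by apply: (measurableT_comp (measurable_powR (-1))); exact: (measurableT_comp _ mf).
by apply: measurable_funM => //; exact: measurable_funM.
Qed.

Lemma measurable_fun_comp d' (T' : measurableType d') (G : R -> T') f :
  measurable_fun setT G -> measurable_fun setT f -> measurable_fun setT (fun x => G (f x)).
Proof. by move=> mG mf; exact: (measurableT_comp mG mf). Qed.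

Lemma measurable_fun_Add f g : measurable_fun setT f -> measurable_fun setT g ->
  measurable_fun setT (fun x => f x + g x).
Proof. exact: measurable_funD. Qed.

Lemma measurable_fun_Mul f g : measurable_fun setT f -> measurable_fun setT g ->
  measurable_fun setT (fun x => f x * g x).
Proof. exact: measurable_funM. Qed.

Lemma measurable_fun_Opp f : measurable_fun setT f -> measurable_fun setT (fun x => - f x).
Proof. exact: measurable_funN. Qed.

Lemma measurable_fun_EFin f : measurable_fun setT f -> measurable_fun setT (fun x => (f x)%:E).
Proof. by move=> mf; exact/measurable_EFinP. Qed.

Lemma measurable_fun_Norm f : measurable_fun setT f -> measurable_fun setT (fun x => `|f x|).
Proof. by move=> mf; exact: (measurableT_comp _ mf). Qed.

Lemma measurable_fun_powR f p :
  measurable_fun setT f -> measurable_fun setT (fun x => powR (f x) p).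
Proof. by move=> mf; exact: (measurableT_comp (measurable_powR p) mf). Qed.

Lemma measurable_fun_sqrt f :
  measurable_fun setT f -> measurable_fun setT (fun x => Num.sqrt (f x)).
Proof.
move=> mf; apply: (@measurable_fun_comp _ _ (@Num.sqrt R)) => //.
by apply: continuous_measurable_fun; exact: sqrt_continuous.
Qed.

Lemma measurable_fun_sin f : measurable_fun setT f -> measurable_fun setT (fun x => sin (f x)).
Proof.
move=> mf; apply: (@measurable_fun_comp _ _ (@sin R)) => //.
by apply: continuous_measurable_fun; exact: continuous_sin.
Qed.

Lemma measurable_fun_cos f : measurable_fun setT f -> measurable_fun setT (fun x => cos (f x)).
Proof.
move=> mf; apply: (@measurable_fun_comp _ _ (@cos R)) => //.
by apply: continuous_measurable_fun; exact: continuous_cos.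
Qed.

Lemma measurable_fun_Exp f n : measurable_fun setT f -> measurable_fun setT (fun x => f x ^+ n).
Proof. exact: measurable_funX. Qed.

Lemma measurable_fun_Fst d1 d2 (T1 : measurableType d1) (T2 : measurableType d2)
   (h : T -> T1 * T2) : measurable_fun setT h -> measurable_fun setT (fun x => (h x).1).
Proof. by move=> mh; exact: (measurableT_comp measurable_fst mh). Qed.

Lemma measurable_fun_Snd d1 d2 (T1 : measurableType d1) (T2 : measurableType d2)
   (h : T -> T1 * T2) : measurable_fun setT h -> measurable_fun setT (fun x => (h x).2).
Proof. by move=> mh; exact: (measurableT_comp measurable_snd mh). Qed.

Lemma measurable_fun_Pair d1 d2 (T1 : measurableType d1) (T2 : measurableType d2)
   (h1 : T -> T1) (h2 : T -> T2) : measurable_fun setT h1 -> measurable_fun setT h2 ->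
   measurable_fun setT (fun x => (h1 x, h2 x)).
Proof. exact: measurable_fun_pair. Qed.

Lemma measurable_fun_Mule (f g : T -> \bar R) : measurable_fun setT f -> measurable_fun setT g ->
  measurable_fun setT (fun x => f x * g x)%E.
Proof. exact: emeasurable_funM. Qed.

Lemma measurable_fun_Adde (f g : T -> \bar R) : measurable_fun setT f -> measurable_fun setT g ->
  measurable_fun setT (fun x => f x + g x)%E.
Proof. exact: emeasurable_funD. Qed.

Lemma measurable_fun_Cst d' (T' : measurableType d') (c : T') :
  measurable_fun setT (fun _ : T => c).
Proof. exact: measurable_cst. Qed.

Lemma measurable_fun_Id : measurable_fun setT (fun x : T => x).
Proof. exact: measurable_id. Qed.

Lemma measurable_fun_ltr0 f :
  measurable_fun setT f -> measurable_fun setT (fun x => (0 < f x)%R%:R : R).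
Proof.
move=> mf; have -> : (fun x => (0 < f x)%R%:R : R) = (fun x => \1_`]0, +oo[%classic (f x)).
  by apply/funext => x; rewrite indicE mem_setE in_itv/= andbT.
apply: (measurable_fun_comp _ mf).
by apply: measurable_indic.
Qed.

Lemma measurable_fun_itvcc f (a b : R) :
  measurable_fun setT f -> measurable_fun setT (fun x => (a <= f x <= b)%R%:R : R).
Proof.
move=> mf; have -> : (fun x => (a <= f x <= b)%R%:R : R) = (fun x => \1_`[a, b]%classic (f x)).
  by apply/funext => x; rewrite indicE mem_setE in_itv/=.
apply: (measurable_fun_comp _ mf).
by apply: measurable_indic.
Qed.

End MeasurableArith.

Definition dot (R : realType) (u v : R * R * R) : R :=
  vx u * vx v + vy u * vy v + vz u * vz v.

(* The surface measure of [Qop] is [omega tau dtau], pushed forward by [sph]. *)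
Definition omega (R : realType) (tau : R * R) : R :=
  (0 <= tau.1 <= pi)%R%:R * (0 <= tau.2 <= 2 * pi)%R%:R * sin tau.1.

(** * Measurability of vector operations *)

Section MeasurableVec.
Context (R : realType) d (T : measurableType d).
Local Notation V3 := (R * R * R)%type.
Implicit Types (u v : T -> V3) (a : T -> R).

Lemma measurable_fun_vx v : measurable_fun setT v -> measurable_fun setT (fun x => vx (v x)).
Proof. by move=> mv; do 2 apply: measurable_fun_Fst. Qed.

Lemma measurable_fun_vy v : measurable_fun setT v -> measurable_fun setT (fun x => vy (v x)).
Proof. by move=> mv; apply: measurable_fun_Snd; apply: measurable_fun_Fst. Qed.

Lemma measurable_fun_vz v : measurable_fun setT v -> measurable_fun setT (fun x => vz (v x)).
Proof. by move=> mv; apply: measurable_fun_Snd. Qed.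

Lemma measurable_fun_mk3 (a b c : T -> R) : measurable_fun setT a ->
  measurable_fun setT b -> measurable_fun setT c ->
  measurable_fun setT (fun x => mk3 (a x) (b x) (c x)).
Proof. by move=> ma mb mc; do 2 apply: measurable_fun_Pair => //. Qed.

Lemma measurable_fun_vadd u v : measurable_fun setT u -> measurable_fun setT v ->
  measurable_fun setT (fun x => vadd (u x) (v x)).
Proof.
by move=> mu mv; apply: measurable_fun_mk3; apply: measurable_fun_Add;
  first [apply: measurable_fun_vx | apply: measurable_fun_vy | apply: measurable_fun_vz].
Qed.

Lemma measurable_fun_vscale a v : measurable_fun setT a -> measurable_fun setT v ->
  measurable_fun setT (fun x => vscale (a x) (v x)).
Proof.
by move=> ma mv; apply: measurable_fun_mk3; apply: measurable_fun_Mul => //;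
  first [apply: measurable_fun_vx | apply: measurable_fun_vy | apply: measurable_fun_vz].
Qed.

Lemma measurable_fun_vsub u v : measurable_fun setT u -> measurable_fun setT v ->
  measurable_fun setT (fun x => vsub (u x) (v x)).
Proof.
by move=> mu mv; apply: measurable_fun_vadd => //; apply: measurable_fun_vscale.
Qed.

Lemma measurable_fun_dot u v : measurable_fun setT u -> measurable_fun setT v ->
  measurable_fun setT (fun x => dot (u x) (v x)).
Proof.
by move=> mu mv; do 2 ?apply: measurable_fun_Add; apply: measurable_fun_Mul;
  first [apply: measurable_fun_vx | apply: measurable_fun_vy | apply: measurable_fun_vz].
Qed.

Lemma measurable_fun_vnorm v : measurable_fun setT v ->
  measurable_fun setT (fun x => vnorm (v x)).
Proof.
by move=> mv; apply: measurable_fun_sqrt; do 2 ?apply: measurable_fun_Add;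
  apply: measurable_fun_Exp;
  first [apply: measurable_fun_vx | apply: measurable_fun_vy | apply: measurable_fun_vz].
Qed.

Lemma measurable_fun_jb v : measurable_fun setT v ->
  measurable_fun setT (fun x => jb (v x)).
Proof.
move=> mv; apply: measurable_fun_sqrt; apply: measurable_fun_Add; first exact: measurable_fun_Cst.
by apply: measurable_fun_Exp; apply: measurable_fun_vnorm.
Qed.

Lemma measurable_fun_sph (tau : T -> R * R) : measurable_fun setT tau ->
  measurable_fun setT (fun x => sph (tau x)).
Proof.
move=> mt; have mt1 := measurable_fun_Fst mt; have mt2 := measurable_fun_Snd mt.
apply: measurable_fun_mk3; last exact: measurable_fun_cos.
  by apply: measurable_fun_Mul; [apply: measurable_fun_sin|apply: measurable_fun_cos].
by apply: measurable_fun_Mul; apply: measurable_fun_sin.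
Qed.

Lemma measurable_fun_omega (tau : T -> R * R) : measurable_fun setT tau ->
  measurable_fun setT (fun x => omega (tau x)).
Proof.
move=> mt; have mt1 := measurable_fun_Fst mt; have mt2 := measurable_fun_Snd mt.
apply: measurable_fun_Mul; last exact: measurable_fun_sin.
by apply: measurable_fun_Mul; apply: measurable_fun_itvcc.
Qed.

End MeasurableVec.

Lemma omega_ge0 (R : realType) (tau : R * R) : 0 <= omega tau.
Proof.
rewrite /omega; have [t|_] := boolP (0 <= tau.1 <= pi); last by rewrite !mul0r.
by rewrite mul1r mulr_ge0//; exact: sin_ge0_pi.
Qed.

(* An alias of [m1 \x m2]: the library declares the product of two sigma-finite
   measures sigma-finite only through subprobabilities. *)
Definition sigma_prod d1 d2 (T1 : measurableType d1) (T2 : measurableType d2)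
    (R : realType) (m1 : {sigma_finite_measure set T1 -> \bar R})
    (m2 : {sigma_finite_measure set T2 -> \bar R}) : set (T1 * T2) -> \bar R :=
  (m1 \x m2)%E.

(** * Tonelli's theorem for products that can be iterated *)

Section SigmaProd.
Local Open Scope ereal_scope.
Context d1 d2 (T1 : measurableType d1) (T2 : measurableType d2) (R : realType).
Variables (m1 : {sigma_finite_measure set T1 -> \bar R}).
Variables (m2 : {sigma_finite_measure set T2 -> \bar R}).
Local Notation m12 := (sigma_prod m1 m2).

HB.instance Definition _ := Measure.copy m12 (m1 \x m2).

Let sigma_finite_sigma_prod : sigma_finite setT m12.
Proof.
have /sigma_finiteP[F [TF ndF Foo]] := sigma_finiteT m1.
have /sigma_finiteP[G [TG ndG Goo]] := sigma_finiteT m2.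
exists (fun n => F n `*` G n).
  rewrite -setXTT TF TG predeqE => -[x y]; split.
    move=> [/= [n _ Fnx] [k _ Gky]]; exists (maxn n k) => //; split.
    - by move: x Fnx; exact/subsetPset/ndF/leq_maxl.
    - by move: y Gky; exact/subsetPset/ndG/leq_maxr.
  by move=> [n _ []/= ? ?]; split; exists n.
move=> k; have [? ?] := Foo k; have [? ?] := Goo k.
split; first exact: measurableX.
by rewrite /sigma_prod product_measure1E// lte_mul_pinfty// ge0_fin_numE.
Qed.

HB.instance Definition _ := Measure_isSigmaFinite.Build _ _ _ m12
  sigma_finite_sigma_prod.

Variable f : T1 -> T2 -> \bar R.
Hypothesis mf : measurable_fun setT (fun z : T1 * T2 => f z.1 z.2).
Hypothesis f0 : forall x y, 0 <= f x y.

Lemma ge0_integral_swap :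
  \int[m1]_x \int[m2]_y f x y = \int[m2]_y \int[m1]_x f x y.
Proof. exact: (@fubini_tonelli _ _ _ _ _ m1 m2 _ mf (fun z => f0 z.1 z.2)). Qed.

Lemma ge0_integral_prod :
  \int[m12]_z f z.1 z.2 = \int[m1]_x \int[m2]_y f x y.
Proof. exact: (@fubini_tonelli1 _ _ _ _ _ m1 m2 _ mf (fun z => f0 z.1 z.2)). Qed.

Lemma measurable_integral_l : measurable_fun setT (fun x => \int[m2]_y f x y).
Proof. exact: (@measurable_fun_fubini_tonelli_F _ _ _ _ _ m2 _ mf (fun z => f0 z.1 z.2)). Qed.

Lemma measurable_integral_r : measurable_fun setT (fun y => \int[m1]_x f x y).
Proof. exact: (@measurable_fun_fubini_tonelli_G _ _ _ _ _ m1 _ mf (fun z => f0 z.1 z.2)). Qed.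

End SigmaProd.

Notation leb := (@lebesgue_measure _).
Notation leb2 := (sigma_prod leb leb).
Notation leb3 := (sigma_prod leb2 leb).

Lemma mulr_ltr0_ge0 (R : realType) (r : R) : 0 <= r * (0 < r)%R%:R.
Proof. by have [r0|_] := ltP 0 r; rewrite ?mulr1 ?mulr0// ltW. Qed.

(** * Automation for nonnegativity and measurability *)

Ltac nneg :=
  intros; cbv beta; rewrite ?lee_fin;
  repeat first [ assumption
  | match goal with H : forall _, _ |- _ => solve [apply: H] end
  | lazymatch goal with
    | |- is_true (0 <= omega _)%R => apply: omega_ge0
    | |- is_true (0 <= `|_|)%R => apply: normr_ge0
    | |- is_true (0 <= powR _ _)%R => apply: powR_ge0
    | |- is_true (0 <= Num.sqrt _)%R => apply: sqrtr_ge0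
    | |- is_true (0 <= vnorm _)%R => apply: sqrtr_ge0
    | |- is_true (0 <= jb _)%R => apply: sqrtr_ge0
    | |- is_true (0 <= _ *+ _)%R => apply: ler0n
    | |- is_true (0 <= _ ^+ 2)%R => apply: sqr_ge0
    | |- is_true (0 <= _ ^+ _)%R => apply: exprn_ge0
    | |- is_true (0 <= _ ^-1)%R => rewrite invr_ge0
    | |- is_true (0 <= _ * GRing.natmul _ (nat_of_bool _))%R =>
      first [apply: mulr_ltr0_ge0 | apply: mulr_ge0]
    | |- is_true (0 <= _ * _)%R => apply: mulr_ge0
    | |- is_true (0 <= _ + _)%R => apply: addr_ge0
    end
  | apply: integral_ge0; intros; rewrite ?lee_fin
  | apply: mule_ge0; rewrite ?lee_fin
  | apply: adde_ge0; rewrite ?lee_fin ].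

(** Recursion on the body of the function. An inner integral is measurable by Tonelli's theorem as
    soon as its integrand is nonnegative, which [nneg] has to settle on the spot. *)
Ltac mfun_step :=
  first [ assumption
  | lazymatch goal with
    | |- measurable_fun _ fst => exact: measurable_fst
    | |- measurable_fun _ snd => exact: measurable_snd
    | |- measurable_fun _ id => exact: measurable_id
    | |- measurable_fun _ (fun x => x) => apply: measurable_fun_Id
    | |- measurable_fun _ (fun x => fst _) => apply: measurable_fun_Fst
    | |- measurable_fun _ (fun x => snd _) => apply: measurable_fun_Snd
    | |- measurable_fun _ (fun x => (_, _)) => apply: measurable_fun_Pair
    | |- measurable_fun _ (fun x => EFin _) => apply: measurable_fun_EFin
    | |- measurable_fun _ (fun x => (_ + _)%R) =>
      first [apply: measurable_fun_Add | apply: measurable_fun_Adde]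
    | |- measurable_fun _ (fun x => (_ * _)%R) => apply: measurable_fun_Mul
    | |- measurable_fun _ (fun x => (- _)%R) => apply: measurable_fun_Opp
    | |- measurable_fun _ (fun x => (_ ^+ _)%R) => apply: measurable_fun_Exp
    | |- measurable_fun _ (fun x => (_ ^-1)%R) => apply: measurable_funV
    | |- measurable_fun _ (fun x => `|_|%R) => apply: measurable_fun_Norm
    | |- measurable_fun _ (fun x => powR _ _) => apply: measurable_fun_powR
    | |- measurable_fun _ (fun x => Num.sqrt _) => apply: measurable_fun_sqrt
    | |- measurable_fun _ (fun x => GRing.natmul _ (nat_of_bool _)) =>
      first [apply: measurable_fun_ltr0 | apply: measurable_fun_itvcc]
    | |- measurable_fun _ (fun x => mk3 _ _ _) => apply: measurable_fun_mk3
    | |- measurable_fun _ (fun x => vx _) => apply: measurable_fun_vx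
    | |- measurable_fun _ (fun x => vy _) => apply: measurable_fun_vy
    | |- measurable_fun _ (fun x => vz _) => apply: measurable_fun_vz
    | |- measurable_fun _ (fun x => vadd _ _) => apply: measurable_fun_vadd
    | |- measurable_fun _ (fun x => vsub _ _) => apply: measurable_fun_vsub
    | |- measurable_fun _ (fun x => vscale _ _) => apply: measurable_fun_vscale
    | |- measurable_fun _ (fun x => dot _ _) => apply: measurable_fun_dot
    | |- measurable_fun _ (fun x => vnorm _) => apply: measurable_fun_vnorm
    | |- measurable_fun _ (fun x => jb _) => apply: measurable_fun_jb
    | |- measurable_fun _ (fun x => sph _) => apply: measurable_fun_sph
    | |- measurable_fun _ (fun x => omega _) => apply: measurable_fun_omega
    | |- measurable_fun _ (fun x => integral _ _ (@?F x)) =>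
      apply: (@measurable_integral_l _ _ _ _ _ _ F); [cbv beta|nneg; fail]
    | |- measurable_fun _ (fun x => sin _) => apply: measurable_fun_sin
    | |- measurable_fun _ (fun x => cos _) => apply: measurable_fun_cos
    | |- measurable_fun _ (fun x => (_ * _)%E) => apply: measurable_fun_Mule
    | |- measurable_fun _ (fun x => (_ + _)%E) => apply: measurable_fun_Adde
    end
  | apply: measurable_fun_Cst
  | match goal with
    | mG : measurable_fun _ ?G |- measurable_fun _ (fun x => ?G _) => apply: (measurableT_comp mG)
    | mG : measurable_fun _ (fun z => ?G (fst z) (snd z))
      |- measurable_fun _ (fun x => ?G (@?a x) (@?b x)) =>
      refine (measurableT_comp mG (measurable_fun_Pair (h1 := a) (h2 := b) _ _))
    | mG : measurable_fun _ (fun z => ?G (fst z) (snd z))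
      |- measurable_fun _ (?G ?a) =>
      refine (measurableT_comp mG (measurable_fun_Pair (h1 := fun=> a) (h2 := id) _ _))
    end
  | lazymatch goal with
    | |- measurable_fun _ (fun x => _) => fail
    | |- measurable_fun ?D ?f => change (measurable_fun D (fun x => f x))
    end ].
Ltac mfun := cbv beta; repeat (mfun_step; cbv beta).

(** * Affine substitutions on the line *)

Section Affine.
Context (R : realType).
Local Notation mu := (@lebesgue_measure R).
Implicit Types (G : R -> \bar R) (a b : R).

Lemma ge0_integral_opp G : measurable_fun setT G -> (forall x, 0 <= G x)%E ->
  (\int[mu]_x G (- x)%R = \int[mu]_x G x)%E.
Proof.
move=> mG G0.
transitivity (\int[pushforward mu (-%R : measurableTypeR R -> measurableTypeR R)]_x G x)%E.
  by rewrite ge0_integral_pushforward.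
apply: eq_measure_integral => A mA _; exact: lebesgue_measureN.
Qed.

Let ge0_integral_affine_pos G a b : 0 < a ->
  measurable_fun setT G -> (forall x, 0 <= G x)%E ->
  (a%:E * \int[mu]_x G (a * x + b)%R = \int[mu]_x G x)%E.
Proof.
move=> a0 mG G0.
have rg : range (fun x : R => a * x + b) = setT.
  apply/seteqP; split => // y _; exists ((y - b) / a) => //=.
  by field; rewrite gt_eqF.
have da (x : R) : is_derive x 1 (fun x : R => a * x + b) a.
  by apply: is_derive_eq; rewrite addr0 /GRing.scale/= mulr1.
have ca : continuous (fun _ : R => a) by move=> x; exact: cvg_cst.
have := ge0_change_of_variable da ca (fun _ => a0) mG G0.
rewrite rg => <-.
rewrite muleC -ge0_integralZr//; last by rewrite lee_fin ltW.
by mfun.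
Qed.

Lemma ge0_integral_affine G a b : a != 0 ->
  measurable_fun setT G -> (forall x, 0 <= G x)%E ->
  (`|a|%:E * \int[mu]_x G (a * x + b)%R = \int[mu]_x G x)%E.
Proof.
move=> a0 mG G0; have [a_gt0|a_lt0|a_eq0] := ltgtP a 0; last by rewrite a_eq0 eqxx in a0.
  have -> : (\int[mu]_x G (a * x + b)%R = \int[mu]_x G (- a * (- x) + b)%R)%E.
    by apply: eq_integral => x _; rewrite mulrNN.
  rewrite (@ge0_integral_opp (fun x => G (- a * x + b)))//.
    by rewrite ltr0_norm// ge0_integral_affine_pos// oppr_gt0.
  by mfun.
by rewrite gtr0_norm// ge0_integral_affine_pos.
Qed.

Lemma ge0_integral_translate G b :
  measurable_fun setT G -> (forall x, 0 <= G x)%E ->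
  (\int[mu]_x G (x + b)%R = \int[mu]_x G x)%E.
Proof.
move=> mG G0; rewrite -(@ge0_integral_affine G 1 b) ?oner_neq0// normr1 mul1e.
by apply: eq_integral => x _; rewrite mul1r.
Qed.

End Affine.

Lemma ge0_integral_scale d (T : measurableType d) (R : realType)
    (m : {measure set T -> \bar R}) (c : R) (f : T -> R) :
  0 <= c -> measurable_fun setT f -> (forall x, 0 <= f x) ->
  (\int[m]_x (c * f x)%:E = c%:E * \int[m]_x (f x)%:E)%E.
Proof.
move=> c0 mf f0; under eq_integral do rewrite EFinM.
rewrite ge0_integralZl ?lee_fin//; last by move=> x _; rewrite lee_fin.
exact/measurable_EFinP.
Qed.

(** * Rotations of the plane *)

Section Plane.
Context (R : realType).
Local Notation mu := (@lebesgue_measure R).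

Lemma ge0_integral_affineV (G : R -> \bar R) (a b : R) : a != 0 ->
  measurable_fun setT G -> (forall x, 0 <= G x)%E ->
  (\int[mu]_x G (a * x + b)%R = `|a|^-1%:E * \int[mu]_x G x)%E.
Proof.
move=> a0 mG G0; rewrite -(ge0_integral_affine b a0 mG G0) muleA -EFinM.
by rewrite mulVf ?normr_eq0// mul1e.
Qed.

Variable G : R -> R -> R.
Hypothesis mG : measurable_fun setT (fun z : R * R => G z.1 z.2).
Hypothesis G0 : forall x y, 0 <= G x y.

(** One variable at a time: for [a != 0], taking [a x - b y] as the new x makes the second argument
    affine in y with slope [1 / a], because [a^2 + b^2 = 1], and the Jacobian factors [1 / |a|] and
    [|a|] cancel. A right angle, [a = 0], only exchanges the variables up to sign. *)
Lemma ge0_integral_rotation (a b : R) : a ^+ 2 + b ^+ 2 = 1 ->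
  (\int[mu]_x \int[mu]_y (G (a * x - b * y) (b * x + a * y))%:E =
   \int[mu]_x \int[mu]_y (G x y)%:E)%E.
Proof.
move=> ab1; have [a0|a0] := eqVneq a 0.
  have b1 : `|b| = 1.
    apply/eqP; rewrite -(@eqrXn2 _ 2)// ?expr1n ?normr_ge0 ?ler01//.
    by rewrite real_normK ?num_real// -ab1 a0 expr0n/= add0r.
  have b0 : b != 0 by rewrite -normr_eq0 b1 oner_eq0.
  transitivity (\int[mu]_x \int[mu]_y (G y (b * x))%:E)%E.
    apply: eq_integral => x _.
    rewrite -[RHS]mul1e -invr1 -b1 -normrN.
    rewrite -(@ge0_integral_affineV (fun y => (G y (b * x))%:E) (- b) 0) ?oppr_eq0//.
    - apply: eq_integral => y _.
      by rewrite a0 !mul0r add0r !addr0 mulNr.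
    - by mfun.
    - by move=> y; rewrite lee_fin.
  rewrite (@ge0_integral_swap _ _ _ _ _ mu mu (fun x y => (G y (b * x))%:E)); first last.
  - by move=> *; rewrite lee_fin.
  - by mfun.
  apply: eq_integral => x _.
  under eq_integral => y _ do rewrite -[(b * y)]addr0.
  rewrite (@ge0_integral_affineV (fun y => (G x y)%:E))/= ?oppr_eq0//.
  - by rewrite b1 invr1 mul1e.
  - by mfun.
  - by move=> y; rewrite lee_fin.
rewrite (@ge0_integral_swap _ _ _ _ _ mu mu
  (fun x y => (G (a * x - b * y) (b * x + a * y))%:E)); first last.
- by move=> *; rewrite lee_fin.
- by mfun.
transitivity (\int[mu]_y (`|a|^-1%:E * \int[mu]_x (G x (a^-1 * y + b / a * x))%:E))%E.
  apply: eq_integral => y _.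
  rewrite -(@ge0_integral_affineV (fun x => (G x (a^-1 * y + b / a * x))%:E) a (- (b * y)))//.
  - apply: eq_integral => x _; congr (G _ _)%:E.
    transitivity ((a ^+ 2 + b ^+ 2) * (y / a) + b * (a * x - b * y) / a).
      by field.
    by rewrite ab1; field.
  - by mfun.
  - by move=> x; rewrite lee_fin.
rewrite ge0_integralZl//; first last.
- by move=> y _; apply: integral_ge0 => x _; rewrite lee_fin.
- apply: (@measurable_integral_l _ _ _ _ _ mu
    (fun y x => (G x (a^-1 * y + b / a * x))%:E)).
  + by mfun.
  + by move=> *; rewrite lee_fin.
rewrite (@ge0_integral_swap _ _ _ _ _ mu mu
  (fun y x => (G x (a^-1 * y + b / a * x))%:E)); first last.
- by move=> *; rewrite lee_fin.
- by mfun.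
rewrite -ge0_integralZl//; first last.
- by move=> y _; apply: integral_ge0 => x _; rewrite lee_fin.
- apply: (@measurable_integral_r _ _ _ _ _ mu
    (fun y x => (G x (a^-1 * y + b / a * x))%:E)).
  + by mfun.
  + by move=> *; rewrite lee_fin.
apply: eq_integral => x _.
rewrite (@ge0_integral_affineV (fun y => (G x y)%:E))/= ?invr_eq0//.
- by rewrite normfV invrK muleA -EFinM mulVf ?normr_eq0// mul1e.
- by mfun.
- by move=> y; rewrite lee_fin.
Qed.

End Plane.

(** * Polar coordinates in the plane *)

Section HalfPlanePolar.
Context (R : realType).
Local Notation mu := (@lebesgue_measure R).

Lemma eq_integral_off_finite (s : seq R) (F G : R -> \bar R) :
  measurable_fun setT F -> measurable_fun setT G ->
  (forall x, x \notin s -> F x = G x) ->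
  (\int[mu]_x F x = \int[mu]_x G x)%E.
Proof.
move=> mF mG FG; apply: ae_eq_integral => //.
have cs : countable ([set` s] : set R) by exact/finite_set_countable/finite_seq.
exists ([set` s] : set R); split => /=.
- exact: countable_measurable.
- exact: countable_lebesgue_measure0.
move=> x /= xs; apply/negPn/negP => ns; apply: xs => _; exact: FG.
Qed.

Lemma sin_atan (s : R) : sin (atan s) = s * cos (atan s).
Proof.
have c0 : cos (atan s) != 0.
  by rewrite gt_eqF// cos_gt0_pihalf// atan_gtNpi2 atan_ltpi2.
by rewrite -{2}(atanK s) /tan mulfVK.
Qed.

Lemma cos_atan2 (s : R) : cos (atan s) ^+ 2 = (1 + s ^+ 2)^-1.
Proof. by rewrite cos_atan exprVn sqr_sqrtr// addr_ge0// sqr_ge0. Qed.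

(** The polar angle of a point (x, y) with [y > 0], as a function of [s = - x / y]. *)
Let phi (s : R) : R := pi / 2 + atan s.
Let dphi (s : R) : R := (1 + s ^+ 2)^-1.

Let is_derive_phi (s : R) : is_derive s 1 phi (dphi s).
Proof. by apply: is_derive_eq; rewrite add0r mul1r. Qed.

Let continuous_dphi : continuous dphi.
Proof.
move=> s; apply: cvgV; first by rewrite gt_eqF// ltr_pwDl// sqr_ge0.
by apply: cvgD; [exact: cvg_cst|apply: exprn_continuous].
Qed.

Let dphi_gt0 s : 0 < dphi s.
Proof. by rewrite invr_gt0 ltr_pwDl// sqr_ge0. Qed.

Let range_phi : range phi = `]0, pi[%classic.
Proof.
apply/seteqP; split => [_ [s _ <-]|t] /=; rewrite in_itv/=.
  have := atan_gtNpi2 s; have := atan_ltpi2 s; rewrite /phi; lra.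
move=> /andP[t0 tp]; exists (tan (t - pi / 2)) => //; rewrite /phi tanK ?in_itv/=.
  by rewrite addrC subrK.
lra.
Qed.

Lemma integral_cauchy : (\int[mu]_s ((1 + s ^+ 2)^-1)%:E = pi%:E)%E.
Proof.
have m1 : measurable_fun setT (fun _ : R => 1%E : \bar R) by exact: measurable_cst.
transitivity (\int[mu]_(y in `]0%R, pi[) (fun _ : R => 1) y)%E.
  rewrite -range_phi -(ge0_change_of_variable is_derive_phi continuous_dphi dphi_gt0 m1)//.
  by apply: eq_integral => s _; rewrite mul1e.
rewrite integral_cst// mul1e; have := @lebesgue_measure_itv R `]0, pi[.
by rewrite /= lte_fin pi_gt0 oppr0 adde0.
Qed.

Variable G : R -> R -> R.
Hypothesis mG : measurable_fun setT (fun z : R * R => G z.1 z.2).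
Hypothesis G0 : forall x y, 0 <= G x y.

(** The substitutions [x = - y s] and [y = r cos (atan s)] turn the area element into
    [r dr ds / (1 + s^2)], and [ds / (1 + s^2)] is the differential of the polar angle. *)
Lemma ge0_integral_half_plane :
  (\int[mu]_y \int[mu]_x ((0 < y)%R%:R * G x y)%:E =
   \int[mu]_(t in `]0%R, pi[) \int[mu]_r (r * (0 < r)%R%:R * G (r * cos t) (r * sin t))%:E)%E.
Proof.
transitivity (\int[mu]_y \int[mu]_s ((0 < y)%R%:R * (y * G (- y * s) y))%:E)%E.
  apply: eq_integral => y _.
  have [y0|y0] := ltP 0 y; last first.
    by under eq_integral do rewrite mul0r; under [RHS]eq_integral do rewrite mul0r.
  rewrite -(@ge0_integral_affine _ (fun x => (1%R * G x y)%:E) (- y) 0) ?oppr_eq0 ?gt_eqF//.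
  - rewrite normrN gtr0_norm// -ge0_integralZl//.
    + by apply: eq_integral => s _; rewrite addr0 -EFinM !mul1r.
    + by mfun.
    + by move=> s _; rewrite lee_fin mul1r.
    + by rewrite lee_fin ltW.
  - by mfun.
  - by move=> s; rewrite lee_fin mul1r.
rewrite (@ge0_integral_swap _ _ _ _ _ mu mu
  (fun y s => ((0 < y)%R%:R * (y * G (- y * s) y))%:E)); first last.
- move=> y s; rewrite lee_fin; have [y0|_] := ltP 0 y; last by rewrite mul0r.
  by rewrite mul1r mulr_ge0// ltW.
- by mfun.
set K := fun t => (\int[mu]_r (r * (0 < r)%R%:R * G (r * cos t) (r * sin t))%:E)%E.
have K0 t : (0 <= K t)%E.
  apply: integral_ge0 => r _; rewrite lee_fin; have [r0|_] := ltP 0 r.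
    by rewrite mulr1 mulr_ge0// ltW.
  by rewrite mulr0 mul0r.
have mK : measurable_fun setT K.
  apply: (@measurable_integral_l _ _ _ _ _ mu
    (fun t r => (r * (0 < r)%R%:R * G (r * cos t) (r * sin t))%:E)).
    by mfun.
  move=> t r; rewrite lee_fin; have [r0|_] := ltP 0 r.
    by rewrite mulr1 mulr_ge0// ltW.
  by rewrite mulr0 mul0r.
rewrite -range_phi -(ge0_change_of_variable is_derive_phi continuous_dphi dphi_gt0 mK K0).
apply: eq_integral => s _.
have c0 : 0 < cos (atan s) by rewrite cos_gt0_pihalf// atan_gtNpi2 atan_ltpi2.
rewrite -(@ge0_integral_affine _
  (fun y => ((0 < y)%R%:R * (y * G (- y * s) y))%:E) (cos (atan s)) 0) ?gt_eqF//; first last.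
- by move=> y; rewrite lee_fin; have [y0|_] := ltP 0 y;
    [rewrite mul1r mulr_ge0// ltW|rewrite mul0r].
- by mfun.
rewrite muleC gtr0_norm// /K -!ge0_integralZr//=; first last.
all: rewrite ?lee_fin; try exact: ltW.
all: try by mfun.
- by move=> y _; rewrite lee_fin addr0; have [y0|_] := ltP 0 (cos (atan s) * y);
    [rewrite mul1r mulr_ge0// ltW|rewrite mul0r].
- by move=> r _; rewrite lee_fin; have [r0|_] := ltP 0 r;
    [rewrite mulr1 mulr_ge0// ltW|rewrite mulr0 mul0r].
apply: eq_integral => r _; rewrite -!EFinM; congr _%:E.
rewrite addr0 pmulr_rgt0// /phi addrC cosDpihalf sinDpihalf sin_atan /dphi -cos_atan2.
have -> : - (cos (atan s) * r) * s = r * - (s * cos (atan s)) by ring.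
have -> : cos (atan s) * r = r * cos (atan s) by ring.
ring.
Qed.

End HalfPlanePolar.

Section PlanePolar.
Context (R : realType).
Local Notation mu := (@lebesgue_measure R).
Variable G : R -> R -> R.
Hypothesis mG : measurable_fun setT (fun z : R * R => G z.1 z.2).
Hypothesis G0 : forall x y, 0 <= G x y.

Let K t := (\int[mu]_r (r * (0 < r)%R%:R * G (r * cos t) (r * sin t))%:E)%E.

Let K0 t : (0 <= K t)%E.
Proof.
apply: integral_ge0 => r _; rewrite lee_fin; have [r0|_] := ltP 0 r.
  by rewrite mulr1 mulr_ge0// ltW.
by rewrite mulr0 mul0r.
Qed.

Let mK : measurable_fun setT K.
Proof.
apply: (@measurable_integral_l _ _ _ _ _ mu
    (fun t r => (r * (0 < r)%R%:R * G (r * cos t) (r * sin t))%:E)); first by mfun.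
move=> t r; rewrite lee_fin; have [r0|_] := ltP 0 r.
  by rewrite mulr1 mulr_ge0// ltW.
by rewrite mulr0 mul0r.
Qed.

(** The lower half plane is the image of the upper one under the central symmetry, which adds [pi]
    to the angle. The axis [y = 0] and the angles 0, [pi] and [2 pi] are negligible. *)
Lemma ge0_integral_plane :
  (\int[mu]_y \int[mu]_x (G x y)%:E =
   \int[mu]_p \int[mu]_r ((0 <= p <= 2 * pi)%R%:R *
      (r * (0 < r)%R%:R * G (r * cos p) (r * sin p)))%:E)%E.
Proof.
pose H y := (\int[mu]_x (G x y)%:E)%E.
have H0 y : (0 <= H y)%E by apply: integral_ge0 => x _; rewrite lee_fin.
have mH : measurable_fun setT H.
  apply: (@measurable_integral_l _ _ _ _ _ mu (fun y x => (G x y)%:E)); first by mfun.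
  by move=> *; rewrite lee_fin.
have mind : measurable_fun setT (\1_`]0, pi[%classic : R -> R).
  exact: measurable_indic.
transitivity (\int[mu]_y (((0 < y)%R%:R)%:E * H y + ((0 < - y)%R%:R)%:E * H y))%E.
  apply: (@eq_integral_off_finite _ [:: 0]) => //.
    by mfun.
  move=> y; rewrite inE => y0.
  by case: (ltgtP 0 y) y0; rewrite ?eqxx//= => y0 _;
    rewrite oppr_gt0 ?y0 ?(lt_gtF y0) ?mul1e ?mul0e ?adde0 ?add0e.
rewrite ge0_integralD//; last 4 first.
- by move=> y _; rewrite mule_ge0// lee_fin.
- by mfun.
- by move=> y _; rewrite mule_ge0// lee_fin.
- by mfun.
have -> : (\int[mu]_y (((0 < y)%R%:R)%:E * H y) =
    \int[mu]_t ((\1_`]0%R, pi[%classic t)%:E * K t))%E.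
  transitivity (\int[mu]_y \int[mu]_x ((0 < y)%R%:R * G x y)%:E)%E.
    by apply: eq_integral => y _; rewrite ge0_integral_scale//; mfun.
  rewrite ge0_integral_half_plane// integral_mkcond; apply: eq_integral => t _.
  by rewrite epatch_indic muleC.
have -> : (\int[mu]_y (((0 < - y)%R%:R)%:E * H y) =
    \int[mu]_t ((\1_`]0%R, pi[%classic (t - pi)%R)%:E * K t))%E.
  rewrite -(@ge0_integral_opp _ (fun y => ((0 < - y)%R%:R)%:E * H y)%E); last 2 first.
  - by mfun.
  - by move=> y; rewrite mule_ge0// lee_fin.
  rewrite -[RHS](@ge0_integral_translate _ _ pi); last 2 first.
  - by mfun.
  - by move=> y; rewrite mule_ge0// lee_fin.
  transitivity (\int[mu]_y \int[mu]_x ((0 < y)%R%:R * G (- x) (- y))%:E)%E.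
    apply: eq_integral => y _; rewrite ge0_integral_scale//; last by mfun.
    rewrite opprK; congr (_ * _)%E.
    apply/esym/(@ge0_integral_opp _ (fun x => (G x (- y))%:E)); first by mfun.
    by move=> x; rewrite lee_fin.
  rewrite (@ge0_integral_half_plane _ (fun x y => G (- x) (- y)))//; last by mfun.
  rewrite integral_mkcond; apply: eq_integral => t _.
  rewrite epatch_indic muleC addrK; congr (_ * _)%E.
  by apply: eq_integral => r _; rewrite cosDpi sinDpi !mulrN.
rewrite -ge0_integralD//; last 4 first.
- by move=> y _; rewrite mule_ge0// lee_fin.
- by mfun.
- by move=> y _; rewrite mule_ge0// lee_fin.
- by mfun.
transitivity (\int[mu]_p (((0 <= p <= 2 * pi)%R%:R)%:E * K p))%E.
  apply: (@eq_integral_off_finite _ [:: 0; pi; 2 * pi]).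
  - by mfun.
  - by mfun.
  move=> p; rewrite !inE !negb_or => /and3P[p0 ppi p2pi].
  rewrite -ge0_muleDl ?lee_fin// -EFinD; congr (_%:E * _)%E.
  rewrite !indicE !mem_setE !in_itv/= subr_gt0 ltrBlDr.
  have -> : pi + pi = 2 * pi :> R by ring.
  rewrite [0 <= p]le_eqVlt [p <= 2 * pi]le_eqVlt.
  rewrite eq_sym (negbTE p0) (negbTE p2pi)/=.
  have := @pi_gt0 R.
  case: (ltP 0 p); case: (ltgtP p pi) ppi; case: (ltP p (2 * pi)); rewrite //= ?addr0 ?add0r//; lra.
apply: eq_integral => p _; rewrite ge0_integral_scale//; first by mfun.
move=> r; have [r0|_] := ltP 0 r; last by rewrite mulr0 mul0r.
by rewrite mulr1 mulr_ge0// ltW.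
Qed.

End PlanePolar.

(** * Spherical coordinates *)

Section Space.
Context (R : realType).
Local Notation mu := (@lebesgue_measure R).
Local Notation mu2 := (sigma_prod mu mu).
Local Notation mu3 := (sigma_prod mu2 mu).
Local Notation V3 := (R * R * R)%type.

Lemma ge0_integral3 (G : V3 -> \bar R) :
  measurable_fun setT G -> (forall v, 0 <= G v)%E ->
  (\int[mu3]_v G v = \int[mu]_z \int[mu]_y \int[mu]_x G (mk3 x y z))%E.
Proof.
move=> mG G0.
transitivity (\int[mu2]_xy \int[mu]_z G (xy, z))%E.
  rewrite -(@ge0_integral_prod _ _ _ _ _ mu2 mu (fun xy z => G (xy, z)))//.
    by apply: eq_integral => -[].
  by mfun.
rewrite ge0_integral_swap//; last by mfun.
apply: eq_integral => z _.
transitivity (\int[mu]_x \int[mu]_y G (x, y, z))%E.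
  rewrite -(@ge0_integral_prod _ _ _ _ _ mu mu (fun x y => G (x, y, z)))//.
    by apply: eq_integral => -[].
  by mfun.
by rewrite ge0_integral_swap//; mfun.
Qed.

(** Plane polar coordinates are used twice: on (x, y), and then on z together with the distance to
    the z-axis, a half plane in which the angle is the colatitude t. The two Jacobians are [r sin t]
    and [r]. *)
Lemma ge0_integral_polar (G : V3 -> R) :
  measurable_fun setT G -> (forall v, 0 <= G v) ->
  (\int[mu3]_v (G v)%:E =
   \int[mu]_r \int[mu2]_tau
     ((0 < r)%R%:R * r ^+ 2 * (omega tau * G (vscale r (sph tau))))%:E)%E.
Proof.
move=> mG G0.
rewrite ge0_integral3; [|by mfun|by nneg].
pose c (p : R) : R := (0 <= p <= 2 * pi)%R%:R.
transitivity (\int[mu]_z \int[mu]_p \int[mu]_r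
   (c p * (r * (0 < r)%R%:R * G (mk3 (r * cos p) (r * sin p) z)))%:E)%E.
  apply: eq_integral => z _.
  by rewrite (@ge0_integral_plane _ (fun x y => G (mk3 x y z)))//; mfun.
have mc : measurable_fun setT c by rewrite /c; mfun.
have c0 p : 0 <= c p by exact: ler0n.
rewrite ge0_integral_swap; [|by mfun|by nneg].
transitivity (\int[mu]_p \int[mu]_t \int[mu]_r
   ((0 < r)%R%:R * r ^+ 2 * (omega (t, p) *
     G (mk3 (r * sin t * cos p) (r * sin t * sin p) (r * cos t))))%:E)%E.
  apply: eq_integral => p _.
  rewrite ge0_integral_swap; [|by mfun|by nneg].
  (* The half-plane formula wants an integrand that is nonnegative on the whole plane, hence [|r|];
     the cutoff [0 < r] makes it equal to r. *)
  transitivity (\int[mu]_r \int[mu]_z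
     ((0 < r)%R%:R * (c p * (`|r| * G (mk3 (r * cos p) (r * sin p) z))))%:E)%E.
    apply: eq_integral => r _; apply: eq_integral => z _; congr _%:E.
    by have [r0|_] := ltP 0 r; rewrite ?mulr0 ?mul0r ?mulr0// mulr1 mul1r gtr0_norm.
  rewrite (@ge0_integral_half_plane _ (fun z r => c p * (`|r| *
    G (mk3 (r * cos p) (r * sin p) z)))); [|by mfun|by nneg].
  rewrite integral_mkcond; apply: eq_integral => t _.
  rewrite patchE; case: ifPn => [|tN].
    rewrite inE/= in_itv/= => /andP[t0 tpi]; apply: eq_integral => r _.
    congr _%:E; rewrite /omega/= (ltW t0) (ltW tpi)/= mul1r -/(c p).
    have [r0|_] := ltP 0 r; last by rewrite !(mulr0, mul0r).
    rewrite normrM (gtr0_norm r0) ger0_norm ?sin_ge0_pi ?(ltW t0) ?(ltW tpi)//.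
    by ring.
  rewrite integral0_eq// => r _; congr _%:E; rewrite /omega/=.
  (* The half-plane formula integrates over the open interval, [omega] over the closed one; at the
     two endpoints [sin t] is 0. *)
  suff -> : (0 <= t <= pi)%R%:R * c p * sin t = 0 :> R by rewrite mul0r mulr0.
  case: (ltgtP 0 t) => [t0|t0|<-]; rewrite ?mul0r ?sin0 ?mulr0//.
  case: (ltgtP t pi) => [tpi|tpi|->]; rewrite ?mul0r ?sinpi ?mulr0//.
  by move: tN; rewrite notin_setE/= in_itv/= t0 tpi.
rewrite ge0_integral_swap; [|by mfun|by nneg].
transitivity (\int[mu2]_tau \int[mu]_r ((0 < r)%R%:R * r ^+ 2 *
  (omega tau * G (vscale r (sph tau))))%:E)%E.
  rewrite -(@ge0_integral_prod _ _ _ _ _ mu mu (fun t p => \int[mu]_r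
   ((0 < r)%R%:R * r ^+ 2 * (omega (t, p) *
     G (mk3 (r * sin t * cos p) (r * sin t * sin p) (r * cos t))))%:E)%E);
    [|by mfun|by nneg].
  apply: eq_integral => -[t p] _; apply: eq_integral => r _.
  by rewrite /vscale /sph /vx /vy /vz /mk3/= !mulrA.
by rewrite ge0_integral_swap; [|by mfun|by nneg].
Qed.

End Space.

(** * Scalar product and norm *)

Section VectorAlgebra.
Context (R : realType).
Local Notation V3 := (R * R * R)%type.
Implicit Types u v w : V3.

Lemma dot_ge0 u : 0 <= dot u u.
Proof. by rewrite /dot !addr_ge0// -expr2 sqr_ge0. Qed.

Lemma vnormE u : vnorm u = Num.sqrt (dot u u).
Proof. by rewrite /vnorm /dot !expr2. Qed.

Lemma sqr_vnorm u : vnorm u ^+ 2 = dot u u.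
Proof. by rewrite vnormE sqr_sqrtr// dot_ge0. Qed.

Lemma vnorm_ge0 u : 0 <= vnorm u.
Proof. exact: sqrtr_ge0. Qed.

Lemma dot_sph (tau : R * R) : dot (sph tau) (sph tau) = 1.
Proof.
rewrite /dot /sph /mk3 /vx /vy /vz/=.
transitivity (sin tau.1 ^+ 2 * (cos tau.2 ^+ 2 + sin tau.2 ^+ 2) + cos tau.1 ^+ 2).
  by ring.
by rewrite cos2Dsin2 mulr1 addrC cos2Dsin2.
Qed.

Lemma dot_scalel a u v : dot (vscale a u) v = a * dot u v.
Proof. by rewrite /dot /vscale /mk3 /vx /vy /vz/=; ring. Qed.

Lemma dotC u v : dot u v = dot v u.
Proof. by rewrite /dot; ring. Qed.

Lemma dot_addl u v w : dot (vadd u v) w = dot u w + dot v w.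
Proof. by rewrite /dot /vadd /mk3 /vx /vy /vz/=; ring. Qed.

Lemma dot_scaler a u v : dot u (vscale a v) = a * dot u v.
Proof. by rewrite dotC dot_scalel dotC. Qed.

Lemma dot_addr u v w : dot w (vadd u v) = dot w u + dot w v.
Proof. by rewrite dotC dot_addl !(dotC w). Qed.

Lemma vnorm_scale a u : vnorm (vscale a u) = `|a| * vnorm u.
Proof.
by rewrite !vnormE dot_scalel dot_scaler mulrA -expr2 sqrtrM ?sqr_ge0// sqrtr_sqr.
Qed.

Lemma vnorm_scale_sph r (tau : R * R) : 0 <= r -> vnorm (vscale r (sph tau)) = r.
Proof. by move=> r0; rewrite vnorm_scale vnormE dot_sph sqrtr1 mulr1 ger0_norm. Qed.

Lemma V3_ext u v : vx u = vx v -> vy u = vy v -> vz u = vz v -> u = v.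
Proof. by case: u => [[? ?] ?]; case: v => [[? ?] ?]; rewrite /vx /vy /vz/= => -> -> ->. Qed.

End VectorAlgebra.

(** * Rotations of space *)

Section Rotation.
Context (R : realType).
Local Notation mu := (@lebesgue_measure R).
Local Notation V3 := (R * R * R)%type.

(* A rotation of the (x, z)-plane followed by one of the (x, y)-plane. *)
Definition rotation (a b c s : R) (v : V3) : V3 :=
  mk3 (a * (c * vx v + s * vz v) - b * vy v)
      (b * (c * vx v + s * vz v) + a * vy v) (c * vz v - s * vx v).

Lemma measurable_rotation a b c s : measurable_fun setT (rotation a b c s).
Proof. by rewrite /rotation; mfun. Qed.

Section Integral.
Variables (a b c s : R).
Hypotheses (ab1 : a ^+ 2 + b ^+ 2 = 1) (cs1 : c ^+ 2 + s ^+ 2 = 1).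

Lemma dot_rotation u v : dot (rotation a b c s u) (rotation a b c s v) = dot u v.
Proof.
rewrite /dot /rotation /mk3 /vx /vy /vz/=.
transitivity ((a ^+ 2 + b ^+ 2) * ((c * u.1.1 + s * u.2) * (c * v.1.1 + s * v.2)
   + u.1.2 * v.1.2) + (c * u.2 - s * u.1.1) * (c * v.2 - s * v.1.1)); first by ring.
rewrite ab1.
transitivity ((c ^+ 2 + s ^+ 2) * (u.1.1 * v.1.1 + u.2 * v.2) + u.1.2 * v.1.2); first by ring.
by rewrite cs1; ring.
Qed.

Lemma ge0_integral_rotation3 (G : V3 -> R) :
  measurable_fun setT G -> (forall v, 0 <= G v) ->
  (\int[leb3]_v (G (rotation a b c s v))%:E = \int[leb3]_v (G v)%:E)%E.
Proof.
move=> mG G0.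
have mr := measurable_rotation a b c s.
rewrite ge0_integral3; [|by mfun|by nneg].
rewrite [RHS]ge0_integral3; [|by mfun|by nneg].
pose H x y z := G (mk3 (a * x - b * y) (b * x + a * y) z).
rewrite ge0_integral_swap; [|by mfun|by nneg].
transitivity (\int[mu]_y \int[mu]_z \int[mu]_x (H x y z)%:E)%E.
  apply: eq_integral => y _.
  rewrite ge0_integral_swap; [|by mfun|by nneg].
  rewrite [RHS]ge0_integral_swap; [|by rewrite /H; mfun|by rewrite /H; nneg].
  rewrite -(@ge0_integral_rotation _ (fun x z => H x y z) _ _ c (- s));
    [|by rewrite /H; mfun|by rewrite /H; nneg|by rewrite sqrrN].
  apply: eq_integral => x _; apply: eq_integral => z _; congr (G _)%:E.
  by apply: V3_ext; rewrite /rotation /mk3 /vx /vy /vz/=; ring.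
rewrite ge0_integral_swap; [|by rewrite /H; mfun|by rewrite /H; nneg].
apply: eq_integral => z _.
rewrite ge0_integral_swap; [|by rewrite /H; mfun|by rewrite /H; nneg].
rewrite [RHS]ge0_integral_swap; [|by mfun|by nneg].
by rewrite -(@ge0_integral_rotation _ (fun x y => G (mk3 x y z)) _ _ a b);
  [|by mfun|by nneg|].
Qed.

End Integral.

Definition e3 : V3 := mk3 0 0 1.

(** [c] and [s] are the cosine and sine of the colatitude of [n], [a] and [b] those of its
    longitude; on the z-axis the longitude is taken to be 0. *)
Lemma rotation_to (n : V3) : dot n n = 1 ->
  exists a b c s, [/\ a ^+ 2 + b ^+ 2 = 1, c ^+ 2 + s ^+ 2 = 1 & rotation a b c s e3 = n].
Proof.
rewrite /dot -!expr2 => n1.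
pose p := Num.sqrt (vx n ^+ 2 + vy n ^+ 2).
have p2 : p ^+ 2 = vx n ^+ 2 + vy n ^+ 2 by rewrite sqr_sqrtr// addr_ge0// sqr_ge0.
have [p0|p0] := eqVneq p 0.
  exists 1, 0, (vz n), 0; rewrite expr1n expr0n/= !addr0.
  have xy0 : vx n ^+ 2 + vy n ^+ 2 = 0 by rewrite -p2 p0 expr0n.
  have x0 : vx n = 0.
    by apply/eqP; rewrite -sqrf_eq0; move: xy0 => /eqP; rewrite paddr_eq0 ?sqr_ge0// => /andP[].
  have y0 : vy n = 0.
    by apply/eqP; rewrite -sqrf_eq0; move: xy0 => /eqP; rewrite paddr_eq0 ?sqr_ge0// => /andP[].
  split => //; first by rewrite -n1 xy0 add0r.
  by apply: V3_ext; rewrite /rotation/= ?x0 ?y0 /mk3 /vx /vy /vz/=; ring.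
exists (vx n / p), (vy n / p), (vz n), p; split.
- by rewrite !expr_div_n -mulrDl -p2 divff// sqrf_eq0.
- by rewrite p2 addrC.
- by apply: V3_ext; rewrite /rotation /e3 /mk3 /vx /vy /vz/=; field.
Qed.

End Rotation.

(** * Symmetries of the surface measure *)

Section Sphere.
Context (R : realType).
Local Notation mu := (@lebesgue_measure R).
Local Notation V3 := (R * R * R)%type.
Local Notation e3 := (e3 R).

(* In polar coordinates both sides are the integral of [Phi (r s) (r s')] over
   radii r and pairs of directions s, s'. *)
Lemma ge0_integral_direction_swap (Phi : V3 -> V3 -> R) :
  measurable_fun setT (fun z : V3 * V3 => Phi z.1 z.2) -> (forall u v, 0 <= Phi u v) ->
  (\int[leb3]_y \int[leb2]_tau (omega tau * Phi (vscale (vnorm y) (sph tau)) y)%:E =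
   \int[leb3]_y \int[leb2]_tau (omega tau * Phi y (vscale (vnorm y) (sph tau)))%:E)%E.
Proof.
move=> mPhi Phi0.
rewrite ge0_integral_swap; [|by mfun|by nneg].
rewrite [RHS]ge0_integral_swap; [|by mfun|by nneg].
transitivity (\int[leb2]_tau \int[mu]_r \int[leb2]_tau' ((0 < r)%R%:R * r ^+ 2 *
    (omega tau' * (omega tau * Phi (vscale r (sph tau)) (vscale r (sph tau')))))%:E)%E.
  apply: eq_integral => tau _.
  rewrite (@ge0_integral_polar _ (fun y => omega tau * Phi (vscale (vnorm y) (sph tau)) y));
    [|by mfun|by nneg].
  apply: eq_integral => r _; apply: eq_integral => tau' _; congr _%:E.
  by have [r0|_] := ltP 0 r; rewrite ?mul0r// vnorm_scale_sph// ltW.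
rewrite [LHS]ge0_integral_swap; [|by mfun|by nneg].
transitivity (\int[mu]_r \int[leb2]_tau' \int[leb2]_tau ((0 < r)%R%:R * r ^+ 2 *
    (omega tau' * (omega tau * Phi (vscale r (sph tau)) (vscale r (sph tau')))))%:E)%E.
  by apply: eq_integral => r _; rewrite [LHS]ge0_integral_swap; [|by mfun|by nneg].
rewrite [LHS]ge0_integral_swap; [|by mfun|by nneg].
apply: eq_integral => tau _.
rewrite (@ge0_integral_polar _ (fun y => omega tau * Phi y (vscale (vnorm y) (sph tau))));
  [|by mfun|by nneg].
apply: eq_integral => r _; apply: eq_integral => tau' _; congr _%:E.
have [r0|_] := ltP 0 r; rewrite ?mul0r// vnorm_scale_sph ?ltW//.
by congr (_ * _); rewrite mulrCA.
Qed.

(** An integral over the sphere is spread over the unit ball, [|v|^-2] cancelling the radial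
    density, so that the rotation invariance of Lebesgue measure passes to the surface measure. *)
Let zonal_radial (n : V3) (psi : R -> R) :
  measurable_fun setT psi -> (forall x, 0 <= psi x) ->
  (\int[leb3]_v ((0 <= vnorm v <= 1)%R%:R * (vnorm v ^+ 2)^-1 *
      psi (dot n v / vnorm v))%:E =
   \int[leb2]_tau (omega tau * psi (dot n (sph tau)))%:E)%E.
Proof.
move=> mpsi psi0.
rewrite ge0_integral_polar; [|by mfun|by nneg; exact: vnorm_ge0].
transitivity (\int[mu]_r ((\1_`]0%R, 1%R]%classic r)%:E *
   \int[leb2]_tau (omega tau * psi (dot n (sph tau)))%:E))%E.
  apply: eq_integral => r _.
  rewrite -ge0_integral_scale ?indicE//; [|by mfun|by nneg].
  apply: eq_integral => tau _; congr _%:E.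
  rewrite mem_setE in_itv/=; have [r0|_] := ltP 0 r; last by rewrite !mul0r.
  rewrite vnorm_scale_sph ?(ltW r0)//= dot_scaler.
  have -> : r * dot n (sph tau) / r = dot n (sph tau) by field; rewrite gt_eqF.
  have r_neq0 : r != 0 by rewrite gt_eqF.
  case: (r <= 1); rewrite /= ?(mul0r, mulr0)// !mul1r.
  by field.
rewrite ge0_integralZr//; [|by apply/measurable_EFinP; exact: measurable_indic|by nneg].
rewrite integral_indic// setIT/= lebesgue_measure_itv/= lte_fin ltr01.
by rewrite oppr0 adde0 mul1e.
Qed.

Lemma ge0_integral_zonal (n : V3) (psi : R -> R) : dot n n = 1 ->
  measurable_fun setT psi -> (forall x, 0 <= psi x) ->
  (\int[leb2]_tau (omega tau * psi (dot n (sph tau)))%:E =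
   \int[leb2]_tau (omega tau * psi (cos tau.1))%:E)%E.
Proof.
move=> n1 mpsi psi0.
have [a [b [c [s [ab1 cs1 rn]]]]] := rotation_to n1.
have norm_rot v : vnorm (rotation a b c s v) = vnorm v.
  by rewrite !vnormE dot_rotation.
rewrite -zonal_radial//.
rewrite -(@ge0_integral_rotation3 _ a b c s ab1 cs1); [|by mfun|by nneg; exact: vnorm_ge0].
transitivity (\int[leb2]_tau (omega tau * psi (dot e3 (sph tau)))%:E)%E; last first.
  apply: eq_integral => tau _; congr (_ * psi _)%:E.
  by rewrite /dot /e3 /sph /mk3 /vx /vy /vz/= !mul0r !add0r mul1r.
rewrite -zonal_radial//; apply: eq_integral => v _; congr _%:E.
by rewrite norm_rot -rn dot_rotation.
Qed.

End Sphere.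

(** * Powers of sin^2 (theta / 2) on the sphere *)

Section Angle.
Context (R : realType).
Local Notation mu := (@lebesgue_measure R).
Local Notation V3 := (R * R * R)%type.

(* [half_sin2 y s] is [sin^2 (theta / 2)], theta being the angle between y and the
   unit vector s; it is 1/2 at y = 0. *)
Definition half_sin2 (y s : V3) : R := `|(1 - dot y s / vnorm y) / 2|.

Lemma integral_omega_polar (q : R -> R) : measurable_fun setT q -> (forall t, 0 <= q t) ->
  (\int[leb2]_tau (omega tau * q tau.1)%:E =
   (2 * pi)%:E * \int[mu]_(t in `[0%R, pi]) (sin t * q t)%:E)%E.
Proof.
move=> mq q0.
rewrite (@ge0_integral_prod _ _ _ _ _ mu mu (fun t p => (omega (t, p) * q t)%:E)%E);
  [|by mfun|by nneg].
rewrite [in RHS]integral_mkcond -ge0_integralZl//; last 3 first.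
- apply/(measurable_restrictT _ _).1 => //; apply: measurable_funTS; by mfun.
- move=> t _; rewrite erestrict_ge0// => {}t /=; rewrite in_itv/= => t0pi.
  by rewrite lee_fin mulr_ge0// sin_ge0_pi.
- by rewrite lee_fin mulr_ge0// pi_ge0.
apply: eq_integral => t _; rewrite patchE mem_setE in_itv/=.
case: ifPn => [t0pi|tN]; last first.
  rewrite mule0 integral0_eq// => p _.
  by rewrite /omega/= (negbTE tN) !mul0r.
have st : 0 <= sin t * q t by rewrite mulr_ge0// sin_ge0_pi.
transitivity (\int[mu]_p ((\1_`[0%R, (2 * pi)%R]%classic p)%:E * (sin t * q t)%:E))%E.
  apply: eq_integral => p _; rewrite -EFinM indicE mem_setE in_itv/= /omega/= t0pi mul1r.
  by rewrite mulrA.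
rewrite ge0_integralZr//; [|by apply/measurable_EFinP; exact: measurable_indic].
congr (_ * _)%E; rewrite integral_indic// setIT/= lebesgue_measure_itv/= lte_fin.
by rewrite mulr_gt0// ?pi_gt0// oppr0 adde0.
Qed.

(** With [u = sin^2 (t / 2)] one has [sin t dt = 2 du], so this is [4 pi] times the integral of
    [u^m] over [0, 1]. *)
Lemma integral_omega_cos m :
  (\int[leb2]_tau (omega tau * `|(1 - cos tau.1) / 2| ^+ m)%:E = (4 * pi / m.+1%:R)%:E :> \bar R)%E.
Proof.
rewrite (@integral_omega_polar (fun t => `|(1 - cos t) / 2| ^+ m)); [|by mfun|by nneg].
pose F (t : R) : R := 2 / m.+1%:R * ((1 - cos t) / 2) ^+ m.+1.
pose f (t : R) : R := sin t * ((1 - cos t) / 2) ^+ m.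
have dF (t : R) : is_derive t 1 F (f t).
  have dg : is_derive t 1 (fun t : R => (1 - cos t) / 2) (sin t / 2).
    by apply: is_derive_eq; rewrite /GRing.scale/=; ring.
  have dX := is_deriveX m.+1 dg; rewrite exprfctE in dX.
  have := is_deriveZ (2 / m.+1%:R) dX.
  have -> : (2 / m.+1%:R) *: (m.+1%:R * ((1 - cos t) / 2) ^+ m *: (sin t / 2)) = f t.
    have c0 : m.+1%:R != 0 :> R by rewrite pnatr_eq0.
    by rewrite /f /GRing.scale/=; move: (m.+1%:R : R) c0 => C c0; field.
  by [].
have cf : continuous f.
  move=> t; apply: (@cvgM _ _ _ _ (@sin R) (fun t => ((1 - cos t) / 2) ^+ m)).
    exact: continuous_sin.
  apply: (@continuous_comp _ _ _ (fun t : R => (1 - cos t) / 2) (fun x : R => x ^+ m)).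
    apply: (@cvgM _ _ _ _ (fun t : R => 1 - cos t) (fun=> 2^-1)); last exact: cvg_cst.
    by apply: cvgB; [exact: cvg_cst|exact: continuous_cos].
  exact: exprn_continuous.
have cF : continuous F.
  by move=> t; apply/differentiable_continuous/derivable1_diffP; have [] := dF t.
transitivity ((2 * pi)%:E * \int[mu]_(t in `[0%R, pi]) (f t)%:E)%E.
  congr (_ * _)%E; apply: eq_integral => t _; congr (_ * _ ^+ m)%:E.
  by rewrite ger0_norm// divr_ge0// subr_ge0 cos_le1.
rewrite (@continuous_FTC2 R f F 0 pi (pi_gt0 R)).
- rewrite /F cospi cos0 subrr mul0r expr0n/= mulr0 sube0 -EFinM; congr _%:E.
  by rewrite opprK divff// expr1n; field.
- exact/continuous_subspaceT.
- split.
  + by move=> z _; have [] := dF z.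
  + exact/cvg_at_right_filter/cF.
  + exact/cvg_at_left_filter/cF.
- by move=> z _; rewrite derive1E; have [_ ->] := dF z.
Qed.

End Angle.

(** * The angular integral and the one-variable collision map *)

Section Jacobian.
Context (R : realType).
Local Notation mu := (@lebesgue_measure R).
Local Notation V3 := (R * R * R)%type.

Lemma integral_omega : (\int[leb2]_tau (omega tau)%:E = (4 * pi)%:E :> \bar R)%E.
Proof.
rewrite -[4 * pi]divr1 -(integral_omega_cos R 0).
by apply: eq_integral => tau _; rewrite expr0 mulr1.
Qed.

(** For [u] nonzero this is an equality, by rotation invariance. At [u = 0] division by zero makes
    the power equal to [2^-m], and [m + 1 <= 2^m]. *)
Lemma integral_half_sin2_le (u : V3) m :
  (\int[leb2]_tau (omega tau * half_sin2 u (sph tau) ^+ m)%:E <= (4 * pi / m.+1%:R)%:E)%E.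
Proof.
have [u0|u0] := eqVneq (vnorm u) 0.
  have E tau : (omega tau * half_sin2 u (sph tau) ^+ m)%:E = ((2^-1 ^+ m) * omega tau)%:E.
    rewrite /half_sin2 u0 invr0 mulr0 subr0 mul1r ger0_norm ?invr_ge0//.
    by rewrite mulrC.
  under eq_integral do rewrite E.
  rewrite ge0_integral_scale; [|by nneg|by mfun|by move=> x; exact: omega_ge0].
  rewrite integral_omega -EFinM lee_fin mulrC ler_pM2l ?mulr_gt0// ?pi_gt0//.
  by rewrite exprVn lef_pV2 ?posrE ?exprn_gt0// ?ltr0n// -natrX ler_nat ltn_expl.
have n1 : dot (vscale (vnorm u)^-1 u) (vscale (vnorm u)^-1 u) = 1.
  by rewrite dot_scalel dot_scaler -sqr_vnorm; field.
rewrite -(integral_omega_cos R m).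
rewrite -(ge0_integral_zonal (psi := fun x => `|(1 - x) / 2| ^+ m) n1);
  [|by mfun|by nneg].
rewrite le_eqVlt; apply/orP; left; apply/eqP; apply: eq_integral => tau _.
by rewrite /half_sin2 dot_scalel [_^-1 * _]mulrC.
Qed.

Lemma le_integral_off_finite (s : seq R) (F G : R -> \bar R) :
  measurable_fun setT F -> measurable_fun setT G ->
  (forall x, 0 <= F x)%E -> (forall x, 0 <= G x)%E ->
  (forall x, x \notin s -> F x <= G x)%E ->
  (\int[mu]_x F x <= \int[mu]_x G x)%E.
Proof.
move=> mF mG F0 G0 FG; apply: ae_ge0_le_integral => //.
have cs : countable ([set` s] : set R) by exact/finite_set_countable/finite_seq.
exists ([set` s] : set R); split => /=.
- exact: countable_measurable.
- exact: countable_lebesgue_measure0.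
- move=> x /= xs; apply/negPn/negP => ns; apply: xs => _; exact: FG.
Qed.

Section Hyperbola.
Variable rho2 : R.
Hypothesis rho2_gt0 : 0 < rho2.
(** On the line parallel to [e3] at squared distance [rho2] from the axis, [phi (- z)] is the third
    coordinate of [(|y| e3 - y) / 2]. *)
Let phi (z : R) : R := (Num.sqrt (rho2 + z ^+ 2) + z) / 2.
Let dphi (z : R) : R := (z / Num.sqrt (rho2 + z ^+ 2) + 1) / 2.

Let pos z : 0 < rho2 + z ^+ 2.
Proof. by rewrite ltr_pwDl// sqr_ge0. Qed.

Let lt_sqrt z : `|z| < Num.sqrt (rho2 + z ^+ 2).
Proof. by rewrite -sqrtr_sqr ltr_sqrt// ltrDr. Qed.

Let is_derive_phi (z : R) : is_derive z 1 phi (dphi z).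
Proof.
have d1 : is_derive z 1 (fun z : R => rho2 + z ^+ 2) (2 * z).
  have := is_deriveX 2 (is_derive_id z 1); rewrite exprfctE => h.
  by apply: is_derive_eq; rewrite /GRing.scale/=; ring.
have d2 := @is_derive1_comp R Num.sqrt (fun z : R => rho2 + z ^+ 2) z _ _
  (is_derive1_sqrt (pos z)) d1.
have s0 : Num.sqrt (rho2 + z ^+ 2) != 0 by rewrite gt_eqF// sqrtr_gt0.
have d3 : is_derive z 1 (fun z : R => Num.sqrt (rho2 + z ^+ 2))
    ((2 * Num.sqrt (rho2 + z ^+ 2))^-1 * (2 * z)) := d2.
rewrite /phi; apply: is_derive_eq.
by rewrite /dphi /GRing.scale/=; field.
Qed.

Let dphi_gt0 z : 0 < dphi z.
Proof.
have s0 : 0 < Num.sqrt (rho2 + z ^+ 2) by rewrite sqrtr_gt0.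
rewrite divr_gt0// -ltrBlDr sub0r ltr_pdivlMr// mulN1r ltrNl.
by rewrite (le_lt_trans _ (lt_sqrt z))// -normrN ler_norm.
Qed.

Let continuous_dphi : continuous dphi.
Proof.
move=> z; apply: (@cvgM _ _ _ _ (fun z : R => z / Num.sqrt (rho2 + z ^+ 2) + 1) (fun=> 2^-1));
  last exact: cvg_cst.
apply: cvgD; last exact: cvg_cst.
apply: (@cvgM _ _ _ _ (fun z : R => z) (fun z => (Num.sqrt (rho2 + z ^+ 2))^-1)).
  exact: cvg_id.
apply: cvgV; first by rewrite gt_eqF// sqrtr_gt0.
apply: (@continuous_comp _ _ _ (fun z : R => rho2 + z ^+ 2) (@Num.sqrt R)).
  by apply: cvgD; [exact: cvg_cst|exact: exprn_continuous].
exact: sqrt_continuous.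
Qed.

(** After the reflection [z -> - z] the weight is exactly the derivative of [phi]. Only an
    inequality results, since [phi] covers just the positive half line. *)
Lemma ge0_integral_hyperbola_le (K : R -> R) :
  measurable_fun setT K -> (forall x, 0 <= K x) ->
  (\int[mu]_z (`|(1 - z / Num.sqrt (rho2 + z ^+ 2)) / 2| *
      K ((Num.sqrt (rho2 + z ^+ 2) - z) / 2))%:E <= \int[mu]_x (K x)%:E)%E.
Proof.
move=> mK K0.
rewrite -(@ge0_integral_opp _ (fun z => (`|(1 - z / Num.sqrt (rho2 + z ^+ 2)) / 2| *
      K ((Num.sqrt (rho2 + z ^+ 2) - z) / 2))%:E)); [|by mfun|by nneg].
have -> : (\int[mu]_z (`|(1 - - z / Num.sqrt (rho2 + (- z) ^+ 2)) / 2| *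
      K ((Num.sqrt (rho2 + (- z) ^+ 2) - - z) / 2))%:E =
   \int[mu]_z ((K (phi z))%:E * (dphi z)%:E))%E.
  apply: eq_integral => z _; rewrite -EFinM mulrC sqrrN opprK mulNr opprK.
  by rewrite [1 + _]addrC ger0_norm// ltW// dphi_gt0.
have mK' : measurable_fun setT (EFin \o K) by exact/measurable_EFinP.
rewrite (ge0_change_of_variable is_derive_phi continuous_dphi dphi_gt0 mK');
  last by nneg.
have rg : range phi = `]0, +oo[%classic.
  apply/seteqP; split => [_ [z _ <-]|x] /=; rewrite in_itv/= andbT.
    rewrite /phi divr_gt0// -ltrBlDr sub0r.
    by rewrite (le_lt_trans _ (lt_sqrt z))// -normrN ler_norm.
  (* The solution of [sqrt (rho2 + z^2) = 2 x - z]. *)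
  move=> x0; exists (x - rho2 / (4 * x)) => //; rewrite /phi.
  have -> : rho2 + (x - rho2 / (4 * x)) ^+ 2 = (x + rho2 / (4 * x)) ^+ 2.
    by field; rewrite gt_eqF.
  rewrite sqrtr_sqr ger0_norm; first by field; rewrite gt_eqF.
  by rewrite addr_ge0 ?divr_ge0 ?mulr_ge0// ltW.
rewrite rg; apply: ge0_subset_integral => //.
by move=> x _; rewrite lee_fin K0.
Qed.

End Hyperbola.
End Jacobian.

(** * The Jacobian of the collision map *)

Section PostCollision.
Context (R : realType).
Local Notation mu := (@lebesgue_measure R).
Local Notation V3 := (R * R * R)%type.
Local Notation e3 := (e3 R).

Lemma ge0_integral3_affine (a : R) (w : V3) (G : V3 -> \bar R) : `|a| = 1 ->
  measurable_fun setT G -> (forall v, 0 <= G v)%E ->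
  (\int[leb3]_v G (vadd (vscale a v) w) = \int[leb3]_v G v)%E.
Proof.
move=> a1 mG G0; have a0 : a != 0 by rewrite -normr_eq0 a1 oner_eq0.
have affine1 (F : R -> \bar R) b : measurable_fun setT F -> (forall x, 0 <= F x)%E ->
    (\int[mu]_x F (a * x + b)%R = \int[mu]_x F x)%E.
  by move=> mF F0; rewrite ge0_integral_affineV// a1 invr1 mul1e.
rewrite !ge0_integral3; [|by mfun|by nneg|by mfun|by nneg].
rewrite -(@affine1 (fun z => \int[mu]_y \int[mu]_x G (mk3 x y z))%E (vz w));
  [|by mfun|by nneg].
apply: eq_integral => z _.
rewrite -(@affine1 (fun y => \int[mu]_x G (mk3 x y _))%E (vy w)); [|by mfun|by nneg].
apply: eq_integral => y _.
by rewrite -(@affine1 (fun x => G (mk3 x _ _)) (vx w)); [|by mfun|by nneg].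
Qed.

(** The map multiplies the first two coordinates by [- 1 / 2], whence the factor 4, and moves the
    third one by the hyperbola substitution, whose Jacobian is the weight [half_sin2]. The hyperbola
    degenerates on the axis, so [y = 0] is left out. *)
Let post_e3_le (K : V3 -> R) : measurable_fun setT K -> (forall v, 0 <= K v) ->
  (\int[leb3]_y (half_sin2 y e3 *
      K (vscale 2^-1 (vsub (vscale (vnorm y) e3) y)))%:E <= (4 : R)%:E * \int[leb3]_v (K v)%:E)%E.
Proof.
move=> mK K0.
have mF : measurable_fun setT (fun y => half_sin2 y e3 *
    K (vscale 2^-1 (vsub (vscale (vnorm y) e3) y))).
  by rewrite /half_sin2; mfun.
have F0 y : 0 <= half_sin2 y e3 * K (vscale 2^-1 (vsub (vscale (vnorm y) e3) y)).
  by rewrite mulr_ge0// normr_ge0.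
rewrite (@ge0_integral3 _ (fun v => (K v)%:E)); [|by mfun|by nneg].
rewrite ge0_integral3; [|by mfun|by nneg].
have swap3 (G : V3 -> R) : measurable_fun setT G -> (forall v, 0 <= G v) ->
    (\int[mu]_z \int[mu]_y \int[mu]_x (G (mk3 x y z))%:E =
     \int[mu]_y \int[mu]_x \int[mu]_z (G (mk3 x y z))%:E)%E.
  move=> mG G0; rewrite ge0_integral_swap; [|by mfun|by nneg].
  by apply: eq_integral => y _; rewrite ge0_integral_swap; [|by mfun|by nneg].
rewrite (swap3 _ mF F0) (swap3 K mK K0).
have -> : ((4 : R)%:E * \int[mu]_y \int[mu]_x \int[mu]_z (K (mk3 x y z))%:E =
    \int[mu]_y \int[mu]_x \int[mu]_z (K (mk3 (- 2^-1 * x + 0) (- 2^-1 * y + 0) z))%:E)%E.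
  have h0 : - 2^-1 != 0 :> R by rewrite oppr_eq0 invr_eq0.
  have h2 : `|- 2^-1|^-1 = 2 :> R by rewrite normrN normfV invrK ger0_norm.
  rewrite (@ge0_integral_affineV _ (fun y => \int[mu]_x \int[mu]_z
    (K (mk3 (- 2^-1 * x + 0) y z))%:E)%E (- 2^-1) 0 h0); [|by mfun|by nneg].
  rewrite h2.
  have -> : (4 : R)%:E = ((2 : R)%:E * (2 : R)%:E)%E by rewrite -EFinM -natrM.
  rewrite -muleA; congr (_ * _)%E; rewrite -ge0_integralZl//; [|by mfun|by nneg].
  apply: eq_integral => y _.
  rewrite (@ge0_integral_affineV _ (fun x => \int[mu]_z
    (K (mk3 x y z))%:E)%E (- 2^-1) 0 h0); [|by mfun|by nneg].
  by rewrite h2.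
apply: (@le_integral_off_finite _ [:: 0]).
- rewrite /half_sin2; mfun.
- by mfun.
- by move=> y; nneg; exact: F0.
- by nneg.
move=> y; rewrite inE => y0.
apply: ge0_le_integral => //.
- by nneg; exact: F0.
- by rewrite /half_sin2; mfun.
- by mfun.
move=> x _.
have rho_gt0 : 0 < x ^+ 2 + y ^+ 2 by rewrite ltr_wpDl ?sqr_ge0// exprn_even_gt0.
have mK' : measurable_fun setT (fun z => K (mk3 (- 2^-1 * x + 0) (- 2^-1 * y + 0) z)).
  by mfun.
apply: le_trans (ge0_integral_hyperbola_le rho_gt0 mK' _); last by nneg.
rewrite le_eqVlt; apply/orP; left; apply/eqP; apply: eq_integral => z _.
congr (_ * K _)%:E.
  by rewrite /half_sin2 /vnorm /dot /e3 /mk3 /vx /vy /vz/= !mulr0 !add0r mulr1.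
by apply: V3_ext; rewrite /vsub /vadd /vscale /vnorm /e3 /mk3 /vx /vy /vz/=; field.
Qed.

(** A rotation taking [e3] to [n] reduces this to [n = e3]: it preserves norms, angles and the
    measure, and the translation by [x] is absorbed into [H]. *)
Lemma ge0_integral_post_le (n x : V3) (H : V3 -> R) : dot n n = 1 ->
  measurable_fun setT H -> (forall v, 0 <= H v) ->
  (\int[leb3]_y (half_sin2 y n *
      H (vadd x (vscale 2^-1 (vsub (vscale (vnorm y) n) y))))%:E <=
   (4 : R)%:E * \int[leb3]_v (H v)%:E)%E.
Proof.
move=> n1 mH H0; have [a [b [c [s [ab1 cs1 rn]]]]] := rotation_to n1.
have mr := measurable_rotation a b c s.
set r := rotation a b c s.
have norm_rot v : vnorm (r v) = vnorm v by rewrite !vnormE dot_rotation.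
rewrite -[X in (X <= _)%E](@ge0_integral_rotation3 _ a b c s ab1 cs1); first last.
- by rewrite /half_sin2; nneg.
- by rewrite /half_sin2; mfun.
rewrite -/r.
have -> : (\int[leb3]_v (H v)%:E = \int[leb3]_v (H (vadd x (r v)))%:E)%E.
  rewrite (@ge0_integral_rotation3 _ a b c s ab1 cs1 (fun v => H (vadd x v)));
    [|by mfun|by nneg].
  rewrite -(@ge0_integral3_affine 1 x (fun v => (H v)%:E));
    [|by rewrite normr1|by mfun|by nneg].
  apply: eq_integral => v _.
  congr (H _)%:E; apply: V3_ext; rewrite /vadd /vscale /mk3 /vx /vy /vz/=; ring.
apply: le_trans (@post_e3_le (fun v => H (vadd x (r v))) _ _); [|by mfun|by nneg].
rewrite le_eqVlt; apply/orP; left; apply/eqP; apply: eq_integral => y _.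
congr (_ * H _)%:E.
  by rewrite /half_sin2 norm_rot -rn dot_rotation.
rewrite norm_rot -rn.
by apply: V3_ext; rewrite /r /rotation /vsub /vadd /vscale /e3 /mk3 /vx /vy /vz/=; ring.
Qed.

End PostCollision.

(** * Weight inequalities for real numbers *)

Section Weights.
Context (R : realType).
Implicit Types k gam b W Z V Y S x y r s : R.

Lemma ge0_powRD x r s : 0 <= r -> 0 <= s -> powR x (r + s) = powR x r * powR x s.
Proof.
move=> r0 s0; have [rs|rs] := eqVneq (r + s) 0; last by apply: powRD; rewrite (negbTE rs).
move: rs => /eqP; rewrite paddr_eq0// => /andP[/eqP -> /eqP ->].
by rewrite addr0 !powRr0 mulr1.
Qed.

Lemma powR_le2 x y r : 0 <= r -> 0 <= x -> x <= y -> powR x r <= powR y r.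
Proof.
move=> r0 x0 xy; apply: ge0_ler_powR => //; rewrite nnegrE//.
exact: le_trans xy.
Qed.

Lemma powR_2_le2 r : 0 <= r <= 1 -> powR 2 r <= 2 :> R.
Proof. by move=> /andP[r0 r1]; apply: ler1_powR => //; rewrite ler1n. Qed.

(** [W] and [Z] are the weights before the collision, [V] the weight after it, [Y] the relative
    speed, [S] the squared sine. Of the factor [s^k] gained on [V^k], [s^b] is spent on [Y^b], since
    [s Y <= 2 V W] shifts the exponent b from [Z] to [V]; what remains, [s^(k - b)], is at most
    [S^m]. The constant 2 bounds [2^gam]. *)
Lemma weight_far k gam b (m : nat) W Z V Y S :
  0 <= b <= gam -> gam <= 1 -> 0 < k -> m.*2%:R <= k - b ->
  1 <= W -> 1 <= Z -> 0 <= V -> 0 <= Y -> 0 <= S <= 1 ->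
  Y <= 2 * (W * Z) -> Num.sqrt S * Y <= 2 * (V * W) ->
  V <= 2 * W + Num.sqrt S * Z -> 2 * W * k <= Num.sqrt S * Z ->
  powR Y gam * powR V k <=
  2 * expR 1 * (S ^+ m * (powR W gam * (powR Z (k + gam - b) * powR V b))).
Proof.
move=> /andP[b0 bg] g1 k0 mk W1 Z1 V0 Y0 /andP[S0 S1] hY hsY hV hfar.
set s := Num.sqrt S in hsY hV hfar *.
have W0 : 0 < W by apply: lt_le_trans W1.
have Z0 : 0 < Z by apply: lt_le_trans Z1.
have s0 : 0 < s.
  rewrite lt_neqAle sqrtr_ge0 andbT eq_sym; apply/negP => /eqP s0.
  by move: hfar; rewrite s0 mul0r leNgt mulr_gt0// mulr_gt0.
have s1 : s <= 1 by rewrite -sqrtr1 ler_wsqrtr.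
have g0 : 0 <= gam by apply: le_trans bg.
have gb0 : 0 <= gam - b by rewrite subr_ge0.
have Vle : V <= expR k^-1 * (s * Z).
  apply: (le_trans hV); apply: (@le_trans _ _ ((1 + k^-1) * (s * Z))).
    by rewrite [leRHS]mulrDl mul1r addrC lerD2l [leRHS]mulrC ler_pdivlMr.
  by rewrite ler_wpM2r// ?expR_ge1Dx// mulr_ge0// ltW.
have Vk : powR V k <= expR 1 * (powR s k * powR Z k).
  apply: (le_trans (powR_le2 (ltW k0) V0 Vle)).
  rewrite powRM ?expR_ge0//; last by rewrite mulr_ge0// ltW.
  by rewrite -expRM mulVf ?gt_eqF// powRM// ltW.
have sk : powR s k = powR s b * powR s (k - b).
  rewrite -ge0_powRD// ?(addrC b) ?subrK//.
  by apply: le_trans mk; exact: ler0n.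
have skb : powR s (k - b) <= S ^+ m.
  apply: (@le_trans _ _ (powR s m.*2%:R)); first by apply: ger_powR => //; rewrite s0.
  by rewrite powR_mulrn ?(ltW s0)// -muln2 mulnC exprM sqr_sqrtr.
have Yg : powR s b * powR Y gam <=
    2 * (powR W gam * (powR Z (gam - b) * powR V b)).
  have -> : powR Y gam = powR Y (gam - b) * powR Y b by rewrite -ge0_powRD// subrK.
  rewrite mulrCA -powRM// ?(ltW s0)//.
  have h1 : powR Y (gam - b) <= powR 2 (gam - b) * (powR W (gam - b) * powR Z (gam - b)).
    apply: (le_trans (powR_le2 gb0 Y0 hY)).
    by rewrite !powRM// ?mulr_ge0// ltW.
  have h2 : powR (s * Y) b <= powR 2 b * (powR V b * powR W b).
    apply: le_trans (powR_le2 b0 _ hsY) _; first by rewrite mulr_ge0// ltW.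
    by rewrite !powRM// ?mulr_ge0// ltW.
  apply: (le_trans (ler_pM (powR_ge0 _ _) (powR_ge0 _ _) h1 h2)).
  have -> : powR W gam = powR W (gam - b) * powR W b by rewrite -ge0_powRD// subrK.
  have -> : powR 2 (gam - b) * (powR W (gam - b) * powR Z (gam - b)) *
    (powR 2 b * (powR V b * powR W b)) = (powR 2 (gam - b) * powR 2 b) *
    (powR W (gam - b) * powR W b * (powR Z (gam - b) * powR V b)) by ring.
  rewrite -ge0_powRD// subrK ler_wpM2r//; last by apply: powR_2_le2; rewrite g0.
  by rewrite !mulr_ge0// powR_ge0.
apply: (@le_trans _ _ (powR Y gam * (expR 1 * (powR s k * powR Z k)))).
  by rewrite ler_wpM2l// powR_ge0.
have -> : powR Y gam * (expR 1 * (powR s k * powR Z k)) =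
  expR 1 * (powR Z k * ((powR s b * powR Y gam) * powR s (k - b))) by rewrite sk; ring.
have -> : powR Z (k + gam - b) = powR Z k * powR Z (gam - b).
  by rewrite -ge0_powRD ?addrA// ltW.
have -> : 2 * expR 1 * (S ^+ m * (powR W gam * (powR Z k * powR Z (gam - b) * powR V b))) =
  expR 1 * (powR Z k * ((2 * (powR W gam * (powR Z (gam - b) * powR V b))) * S ^+ m)).
  by ring.
rewrite ler_wpM2l ?expR_ge0// ler_wpM2l ?powR_ge0//.
by apply: ler_pM => //; rewrite ?mulr_ge0// powR_ge0.
Qed.

(** Of [V^k], the part [V^gam] is charged to [W] and the rest to [Z]; with [Y^gam] this makes
    [W^(2 gam) Z^k], and [2 gam <= 2]. The factor [S], inserted at the price of 2, will pay for a
    Jacobian. *)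
Lemma weight_near k gam B W Z V Y S :
  0 <= gam <= 1 -> 1 <= k -> 0 <= B -> 1 <= W -> 1 <= Z -> 0 <= V -> 0 <= Y ->
  2^-1 <= S -> Y <= 2 * (W * Z) -> V <= B * W -> V <= B * Z ->
  powR Y gam * powR V k <= 4 * powR B k * (S * (W ^+ 2 * powR Z k)).
Proof.
move=> /andP[g0 g1] k1 B0 W1 Z1 V0 Y0 S2 hY hW hZ.
have W0 : 0 <= W by apply: le_trans W1.
have Z0 : 0 <= Z by apply: le_trans Z1.
have kg0 : 0 <= k - gam by rewrite subr_ge0 (le_trans g1).
have gkE x : powR x k = powR x gam * powR x (k - gam) by rewrite -ge0_powRD// addrC subrK.
have h1 : powR Y gam <= 2 * (powR W gam * powR Z gam).
  apply: (le_trans (powR_le2 g0 Y0 hY)).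
  rewrite powRM ?mulr_ge0// powRM// ler_wpM2r ?mulr_ge0 ?powR_ge0//.
  by apply: powR_2_le2; rewrite g0.
have h2 : powR V k <= powR B k * (powR W gam * powR Z (k - gam)).
  rewrite (gkE V) (gkE B).
  have -> : powR B gam * powR B (k - gam) * (powR W gam * powR Z (k - gam)) =
    (powR B gam * powR W gam) * (powR B (k - gam) * powR Z (k - gam)) by ring.
  rewrite -!powRM//.
  by apply: ler_pM; rewrite ?powR_ge0//; apply: powR_le2.
apply: (le_trans (ler_pM (powR_ge0 _ _) (powR_ge0 _ _) h1 h2)).
have -> : 2 * (powR W gam * powR Z gam) * (powR B k * (powR W gam * powR Z (k - gam))) =
  2 * powR B k * (powR W gam * powR W gam * (powR Z gam * powR Z (k - gam))) by ring.
rewrite -gkE.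
apply: (@le_trans _ _ (2 * powR B k * (W ^+ 2 * powR Z k))).
  rewrite ler_wpM2l ?mulr_ge0 ?powR_ge0// ler_wpM2r ?powR_ge0// expr2.
  by apply: ler_pM; rewrite ?powR_ge0//; apply: ler1_powR.
have -> : 4 * powR B k * (S * (W ^+ 2 * powR Z k)) =
  (2 * S) * (2 * powR B k * (W ^+ 2 * powR Z k)) by ring.
rewrite -[leLHS]mul1r ler_wpM2r ?mulr_ge0 ?powR_ge0//.
by rewrite -ler_pdivrMl// mulr1.
Qed.

End Weights.

(** * Geometry of a collision *)

Section Geometry.
Context (R : realType).
Local Notation V3 := (R * R * R)%type.
Implicit Types u v w y n c : V3.

Lemma dot_le_vnorm u v : `|dot u v| <= vnorm u * vnorm v.
Proof.
rewrite -(@ler_pXn2r _ 2) ?nnegrE ?mulr_ge0 ?vnorm_ge0//.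
rewrite real_normK ?num_real// exprMn !sqr_vnorm -subr_ge0.
(* Lagrange's identity: the difference is the squared norm of the cross product. *)
have -> : dot u u * dot v v - dot u v ^+ 2 = (vx u * vy v - vy u * vx v) ^+ 2 +
  (vx u * vz v - vz u * vx v) ^+ 2 + (vy u * vz v - vz u * vy v) ^+ 2.
  by rewrite /dot; ring.
by rewrite !addr_ge0// sqr_ge0.
Qed.

Lemma sqr_jb v : jb v ^+ 2 = 1 + dot v v.
Proof. by rewrite /jb sqr_sqrtr ?sqr_vnorm// addr_ge0// dot_ge0. Qed.

Lemma jb_ge1 v : 1 <= jb v.
Proof. by rewrite -[leLHS]sqrtr1 ler_wsqrtr// lerDl sqr_ge0. Qed.

Lemma jb_ge0 v : 0 <= jb v.
Proof. exact: sqrtr_ge0. Qed.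

Lemma vnorm_le_jb v : vnorm v <= jb v.
Proof. by rewrite vnormE /jb sqr_vnorm ler_wsqrtr// lerDr. Qed.

Lemma jb_add_le u v : jb (vadd u v) <= jb u + vnorm v.
Proof.
rewrite -(@ler_pXn2r _ 2) ?nnegrE ?addr_ge0 ?jb_ge0 ?vnorm_ge0//.
rewrite sqrrD !sqr_jb sqr_vnorm dot_addl !dot_addr (dotC v u).
have : dot u v <= jb u * vnorm v.
  rewrite (le_trans (ler_norm _))// (le_trans (dot_le_vnorm _ _))//.
  by rewrite ler_wpM2r ?vnorm_ge0// vnorm_le_jb.
by rewrite -mulr_natr; lra.
Qed.

Lemma vnorm_add_le u v : vnorm (vadd u v) <= vnorm u + vnorm v.
Proof.
rewrite -(@ler_pXn2r _ 2) ?nnegrE ?addr_ge0 ?vnorm_ge0//.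
rewrite sqrrD !sqr_vnorm dot_addl !dot_addr (dotC v u).
have := le_trans (ler_norm _) (dot_le_vnorm u v).
by rewrite -mulr_natr; lra.
Qed.

Lemma vnorm_sub_le u v : vnorm (vsub u v) <= vnorm u + vnorm v.
Proof.
by rewrite (le_trans (vnorm_add_le _ _))// vnorm_scale normrN1 mul1r.
Qed.

Lemma vnorm_sub_le_jb u v : vnorm (vsub u v) <= 2 * (jb u * jb v).
Proof.
apply: (le_trans (vnorm_sub_le u v)).
have := vnorm_le_jb u; have := vnorm_le_jb v; have := jb_ge1 u; have := jb_ge1 v.
by move: (jb u) (jb v) => a b; nra.
Qed.

Section UnitVector.
Variables (y n : V3).
Hypothesis n1 : dot n n = 1.

Let cos_bound : `|dot y n / vnorm y| <= 1.
Proof.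
have [y0|y0] := eqVneq (vnorm y) 0; first by rewrite y0 invr0 mulr0 normr0.
rewrite normf_div (ger0_norm (vnorm_ge0 y)) ler_pdivrMr ?mul1r; last first.
  by rewrite lt_neqAle eq_sym y0 vnorm_ge0.
by have := dot_le_vnorm y n; rewrite (vnormE n) n1 sqrtr1 mulr1.
Qed.

Lemma half_sin2E : half_sin2 y n = (1 - dot y n / vnorm y) / 2.
Proof. by rewrite /half_sin2 ger0_norm//; move: cos_bound; rewrite ler_norml; lra. Qed.

Lemma half_sin2_le1 : half_sin2 y n <= 1.
Proof. by rewrite half_sin2E; move: cos_bound; rewrite ler_norml; lra. Qed.

(** The jump from the velocity [c + y / 2] before the collision to [c + |y| n / 2] after it; it does
    not depend on c. *)
Definition post : V3 := vscale 2^-1 (vsub (vscale (vnorm y) n) y).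

(** A chord that subtends the angle theta in a sphere of radius [|y| / 2]. *)
Lemma vnorm_post : vnorm post = Num.sqrt (half_sin2 y n) * vnorm y.
Proof.
rewrite -[vnorm y]ger0_norm ?vnorm_ge0// -sqrtr_sqr -sqrtrM ?normr_ge0//.
rewrite vnormE half_sin2E; congr Num.sqrt.
rewrite /post dot_scalel dot_scaler /vsub !(dot_addl, dot_addr, dot_scalel, dot_scaler).
rewrite n1 -sqr_vnorm (dotC n y).
have [y0|y0] := eqVneq (vnorm y) 0; last by field.
by have := dot_le_vnorm y n; rewrite y0 mul0r normr_le0 => /eqP ->; ring.
Qed.

End UnitVector.

Lemma half_sin2_opp y n : dot n n = 1 ->
  half_sin2 y n + half_sin2 (vscale (-1) y) n = 1.
Proof.
move=> n1; rewrite !half_sin2E// dot_scalel vnorm_scale normrN1 mul1r mulN1r mulNr.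
by move: (dot y n / vnorm y) => x; field.
Qed.

Lemma half_sin2_ge0 y n : 0 <= half_sin2 y n.
Proof. exact: normr_ge0. Qed.

Let le_add4 (x a1 a2 a3 a4 : R) : 0 <= a1 -> 0 <= a2 -> 0 <= a3 -> 0 <= a4 ->
  [\/ x <= a1, x <= a2, x <= a3 | x <= a4] -> x <= a1 + a2 + a3 + a4.
Proof. by move=> ? ? ? ? []; lra. Qed.

(* The collision sphere: w and w' are the velocities before, v one of those after. *)
Lemma collision_weight (k gam b : R) (m : nat) c y n :
  let w := vadd c (vscale 2^-1 y) in let w' := vadd c (vscale (- 2^-1) y) in
  let v := vadd c (vscale (vnorm y / 2) n) in
  let S := half_sin2 y n in let C := half_sin2 (vscale (-1) y) n in
  dot n n = 1 -> 0 <= b <= gam -> gam <= 1 -> 1 <= k -> m.*2%:R <= k - b ->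
  powR (vnorm y) gam * powR (jb v) k <=
    2 * expR 1 * (S ^+ m * (powR (jb w) gam * (powR (jb w') (k + gam - b) * powR (jb v) b))) +
    2 * expR 1 * (C ^+ m * (powR (jb w') gam * (powR (jb w) (k + gam - b) * powR (jb v) b))) +
    4 * powR (2 + 2 * k) k * (S * (jb w ^+ 2 * powR (jb w') k)) +
    4 * powR (2 + 2 * k) k * (C * (jb w' ^+ 2 * powR (jb w) k)).
Proof.
move=> w w' v S C n1 bg g1 k1 mk.
have k0 : 0 < k by apply: lt_le_trans k1.
have g0 : 0 <= gam by case/andP: bg => b0; exact: le_trans.
have ny : vnorm (vscale (-1) y) = vnorm y by rewrite vnorm_scale normrN1 mul1r.
have vw : v = vadd w (post y n).
  by apply: V3_ext; rewrite /v /w /post /vsub /vadd /vscale /mk3 /vx /vy /vz/=; field.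
have vw' : v = vadd w' (post (vscale (-1) y) n).
  rewrite /post ny.
  by apply: V3_ext; rewrite /v /w' /vsub /vadd /vscale /mk3 /vx /vy /vz/=; field.
have ww' : y = vsub w w'.
  by apply: V3_ext; rewrite /w /w' /vsub /vadd /vscale /mk3 /vx /vy /vz/=; field.
have pE : post y n = vsub v w.
  by rewrite vw; apply: V3_ext; rewrite /vsub /vadd /vscale /mk3 /vx /vy /vz/=; ring.
have pE' : post (vscale (-1) y) n = vsub v w'.
  by rewrite vw'; apply: V3_ext; rewrite /vsub /vadd /vscale /mk3 /vx /vy /vz/=; ring.
have S0 : 0 <= S := half_sin2_ge0 y n.
have C0 : 0 <= C := half_sin2_ge0 _ n.
have S1 : S <= 1 := half_sin2_le1 y n1.
have C1 : C <= 1 := half_sin2_le1 _ n1.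
have SC : S + C = 1 := half_sin2_opp y n1.
have hs : Num.sqrt S * vnorm y = vnorm (post y n) by rewrite vnorm_post.
have hc : Num.sqrt C * vnorm y = vnorm (post (vscale (-1) y) n) by rewrite vnorm_post// ny.
have s1 : Num.sqrt S <= 1 by rewrite -sqrtr1 ler_wsqrtr.
have c1 : Num.sqrt C <= 1 by rewrite -sqrtr1 ler_wsqrtr.
have y_le : vnorm y <= 2 * (jb w * jb w') by rewrite {1}ww' vnorm_sub_le_jb.
have y_le' : vnorm y <= 2 * (jb w' * jb w) by rewrite [jb w' * _]mulrC.
have hs_le : Num.sqrt S * vnorm y <= 2 * (jb v * jb w) by rewrite hs pE vnorm_sub_le_jb.
have hc_le : Num.sqrt C * vnorm y <= 2 * (jb v * jb w') by rewrite hc pE' vnorm_sub_le_jb.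
have y_le2 : vnorm y <= jb w + jb w'.
  rewrite {1}ww' (le_trans (vnorm_sub_le _ _))//.
  by rewrite lerD// vnorm_le_jb.
(* The jump [v - w] has length [sqrt S |y|], with [|y| <= jb w + jb w'] and [sqrt S <= 1]. *)
have v_le : jb v <= 2 * jb w + Num.sqrt S * jb w'.
  rewrite [in leLHS]vw (le_trans (jb_add_le _ _))// -hs.
  have := ler_wpM2l (sqrtr_ge0 S) y_le2; have := ler_wpM2r (jb_ge0 w) s1.
  by rewrite mulrDr; lra.
have v_le' : jb v <= 2 * jb w' + Num.sqrt C * jb w.
  rewrite [in leLHS]vw' (le_trans (jb_add_le _ _))// -hc.
  have := ler_wpM2l (sqrtr_ge0 C) y_le2; have := ler_wpM2r (jb_ge0 w') c1.
  by rewrite mulrDr; lra.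
have J0 u : 0 <= jb u := jb_ge0 u.
have y0 := vnorm_ge0 y.
have far0 (x x1 x2 x3 : R) : 0 <= x -> 0 <= x1 -> 0 <= x2 -> 0 <= x3 ->
    0 <= 2 * expR 1 * (x ^+ m * (x1 * (x2 * x3))).
  by move=> *; rewrite !mulr_ge0 ?exprn_ge0 ?expR_ge0.
have near0 (x x1 x2 x3 : R) : 0 <= x -> 0 <= x2 -> 0 <= x3 ->
    0 <= 4 * powR x1 k * (x * (x2 ^+ 2 * x3)).
  by move=> *; rewrite !mulr_ge0 ?powR_ge0 ?sqr_ge0.
apply: le_add4.
- by apply: far0 => //; exact: powR_ge0.
- by apply: far0 => //; exact: powR_ge0.
- by apply: near0 => //; exact: powR_ge0.
- by apply: near0 => //; exact: powR_ge0.
have [far|near] := leP (2 * jb w * k) (Num.sqrt S * jb w').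
  by constructor 1; apply: weight_far => //; rewrite ?jb_ge1 ?S0.
have [far'|near'] := leP (2 * jb w' * k) (Num.sqrt C * jb w).
  by constructor 2; apply: weight_far => //; rewrite ?jb_ge1 ?C0.
have vB : jb v <= (2 + 2 * k) * jb w by lra.
have vB' : jb v <= (2 + 2 * k) * jb w' by lra.
have k2 : 0 <= 2 + 2 * k by lra.
have g01 : 0 <= gam <= 1 by rewrite g0.
(* Here either velocity may keep the weight k. The choice goes by which of [S] and [C] is at least
   1/2, because the inserted factor must not be small. *)
have [S2|S2] := leP 2^-1 S.
  by constructor 3; apply: weight_near => //; rewrite ?jb_ge1.
have C2 : 2^-1 <= C by lra.
by constructor 4; apply: weight_near => //; rewrite ?jb_ge1.
Qed.

End Geometry.

(** * Cauchy-Schwarz for one fixed incoming velocity *)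

Section CollisionForm.
Context (R : realType).
Local Notation V3 := (R * R * R)%type.

(** The integral of a nonnegative function is a supremum over the simple functions below it, hence
    monotone on all nonnegative functions. This covers integrands that contain [Qop]. *)
Lemma ge0_le_integralT d (T : measurableType d) (nu : {measure set T -> \bar R})
    (f1 f2 : T -> \bar R) : (forall x, 0 <= f1 x)%E -> (forall x, f1 x <= f2 x)%E ->
  (\int[nu]_x f1 x <= \int[nu]_x f2 x)%E.
Proof.
move=> f10 f12; have f20 x : (0 <= f2 x)%E by rewrite (le_trans (f10 x)).
rewrite !ge0_integralTE//; apply: le_ereal_sup => _ [h hf1 <-].
by exists h => // x; rewrite (le_trans (hf1 x)).
Qed.

(** The choice [l = r / Q] turns a family of Young bounds into a Cauchy-Schwarz bound. If [Q] is 0,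
    [l] goes to infinity instead, and if [r] is 0, to 0. *)
Lemma le_optimal (X : \bar R) (Q r : R) : 0 <= Q -> 0 <= r ->
  (forall l : R, (0 < l)%R -> X <= (l * Q ^+ 2 + l^-1 * r ^+ 2)%R%:E)%E ->
  (X <= (2 * (Q * r))%R%:E)%E.
Proof.
move=> Q0 r0 h.
have [Qe|Qn] := eqVneq Q 0.
  rewrite Qe mul0r mulr0; apply/lee_addgt0Pr => e e0; rewrite add0e.
  have l0 : 0 < (r ^+ 2 + 1) / e by rewrite divr_gt0// ltr_wpDl// sqr_ge0.
  apply: le_trans (h _ l0) _; rewrite lee_fin Qe expr0n mulr0 add0r invf_div.
  rewrite -mulrA -[leRHS]mulr1 ler_pM2l// mulrC ler_pdivrMr ?mul1r ?lerDl//.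
  by rewrite ltr_wpDl// sqr_ge0.
have [re|rn] := eqVneq r 0.
  rewrite re 2!mulr0; apply/lee_addgt0Pr => e e0; rewrite add0e.
  have l0 : 0 < e / (Q ^+ 2 + 1) by rewrite divr_gt0// ltr_wpDl// sqr_ge0.
  apply: le_trans (h _ l0) _; rewrite lee_fin re expr0n mulr0 addr0.
  rewrite -mulrA -[leRHS]mulr1 ler_pM2l// mulrC ler_pdivrMr ?mul1r ?lerDl//.
  by rewrite ltr_wpDl// sqr_ge0.
have Qp : 0 < Q by rewrite lt_neqAle eq_sym Qn.
have rp : 0 < r by rewrite lt_neqAle eq_sym rn.
apply: le_trans (h _ (divr_gt0 rp Qp)) _; rewrite lee_fin le_eqVlt; apply/orP; left.
by apply/eqP; field; rewrite Qn rn.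
Qed.

Section Fixed.
Variables (m : nat) (q r : V3 -> R) (Q N : R) (w : V3).
Hypotheses (m0 : (0 < m)%N) (mq : measurable_fun setT q) (mr : measurable_fun setT r).
Hypotheses (q0 : forall v, 0 <= q v) (r0 : forall v, 0 <= r v).
Hypotheses (Q0 : 0 <= Q) (N0 : 0 <= N).
Hypothesis qQ : (\int[leb3]_v (q v ^+ 2)%:E = (Q ^+ 2)%:E)%E.
Hypothesis rN : (\int[leb3]_v (r v ^+ 2)%:E = (N ^+ 2)%:E)%E.

Let first_term : (\int[leb3]_y \int[leb2]_tau
  (omega tau * (half_sin2 y (sph tau) ^+ m * q (vadd w (vscale (-1) y)) ^+ 2))%:E <=
  (4 * pi / m.+1%:R * Q ^+ 2)%:E)%E.
Proof.
rewrite EFinM -qQ -(@ge0_integral3_affine _ (-1) w (fun v => (q v ^+ 2)%:E));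
  [|by rewrite normrN1|by mfun|by nneg].
have cm : 0 <= 4 * pi / m.+1%:R :> R by rewrite !mulr_ge0// ?pi_ge0.
rewrite -ge0_integral_scale; [|by []|by mfun|by nneg].
apply: ge0_le_integralT => y; first by rewrite /half_sin2; nneg.
have -> : (\int[leb2]_tau (omega tau * (half_sin2 y (sph tau) ^+ m *
      q (vadd w (vscale (-1) y)) ^+ 2))%:E =
    \int[leb2]_tau (q (vadd w (vscale (-1) y)) ^+ 2 *
      (omega tau * half_sin2 y (sph tau) ^+ m))%:E)%E.
  by apply: eq_integral => tau _; congr _%:E; ring.
rewrite ge0_integral_scale; [|by nneg|by rewrite /half_sin2; mfun|by rewrite /half_sin2; nneg].
rewrite [X in (_ <= X%:E)%E]mulrC [X in (_ <= X)%E](EFinM (q _ ^+ 2)).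
apply: lee_pmul => //.
- by nneg.
- by rewrite /half_sin2; nneg.
- rewrite lee_fin le_eqVlt; apply/orP; left; apply/eqP; congr (q _ ^+ 2).
  by apply: V3_ext; rewrite /vadd /vscale /mk3 /vx /vy /vz/=; ring.
- exact: integral_half_sin2_le.
Qed.

(** Since [m >= 1] and [half_sin2 <= 1], the power m is at most the first power, which pays for the
    Jacobian. Each direction then gives at most [4 N^2], and the sphere has area [4 pi]. *)
Let second_term : (\int[leb3]_y \int[leb2]_tau
  (omega tau * (half_sin2 y (sph tau) ^+ m * r (vadd w (post y (sph tau))) ^+ 2))%:E <=
  (16 * pi * N ^+ 2)%:E)%E.
Proof.
have mF : measurable_fun setT (fun z : V3 * (R * R) => (omega z.2 *
    (half_sin2 z.1 (sph z.2) * r (vadd w (post z.1 (sph z.2))) ^+ 2))%:E).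
  by rewrite /half_sin2 /post; mfun.
apply: (@le_trans _ _ (\int[leb3]_y \int[leb2]_tau
  (omega tau * (half_sin2 y (sph tau) * r (vadd w (post y (sph tau))) ^+ 2))%:E)%E).
  apply: ge0_le_integralT => y; first by rewrite /half_sin2; nneg.
  apply: ge0_le_integralT => tau; first by rewrite /half_sin2; nneg.
  rewrite lee_fin ler_wpM2l ?omega_ge0// ler_wpM2r ?sqr_ge0//.
  rewrite -[leRHS]expr1 ler_wiXn2l// ?half_sin2_ge0// half_sin2_le1//.
  exact: dot_sph.
rewrite ge0_integral_swap; [|exact: mF|by rewrite /half_sin2; nneg].
have -> : 16 * pi * N ^+ 2 = (4 * N ^+ 2) * (4 * pi) :> R by ring.
rewrite EFinM -integral_omega -ge0_integral_scale;
  [|by nneg|by mfun|by move=> x; exact: omega_ge0].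
apply: ge0_le_integralT => tau; first by rewrite /half_sin2; nneg.
rewrite ge0_integral_scale; [|exact: omega_ge0|by rewrite /half_sin2 /post; mfun|
  by rewrite /half_sin2; nneg].
rewrite [X in (_ <= X%:E)%E]mulrC [X in (_ <= X)%E](EFinM (omega _)).
apply: lee_wpmul2l; first by rewrite lee_fin omega_ge0.
rewrite [X in (_ <= X)%E](EFinM 4) -rN.
by apply: (@ge0_integral_post_le _ (sph tau) w (fun v => r v ^+ 2));
  [exact: dot_sph|mfun|nneg].
Qed.

Lemma collision_form_fixed_le : (\int[leb3]_y \int[leb2]_tau
  (omega tau * (half_sin2 y (sph tau) ^+ m *
    (q (vadd w (vscale (-1) y)) * r (vadd w (post y (sph tau))))))%:E <=
  (8 * pi / Num.sqrt m.+1%:R * (Q * N))%:E)%E.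
Proof.
have s0 : 0 < Num.sqrt m.+1%:R :> R by rewrite sqrtr_gt0.
(* [a^2] and [b^2] are half the constants [4 pi / (m + 1)] and [16 pi] of the two terms, the halves
   coming from Young's inequality; [2 a b] is [8 pi / sqrt (m + 1)]. *)
pose a : R := Num.sqrt (2 * pi / m.+1%:R); pose b : R := Num.sqrt (8 * pi).
have pi0 := @pi_ge0 R.
have a2 : a ^+ 2 = 2 * pi / m.+1%:R by rewrite sqr_sqrtr// !mulr_ge0.
have b2 : b ^+ 2 = 8 * pi by rewrite sqr_sqrtr// !mulr_ge0.
have -> : 8 * pi / Num.sqrt m.+1%:R * (Q * N) = 2 * ((a * Q) * (b * N)).
  have -> : 2 * (a * Q * (b * N)) = 2 * (a * b) * (Q * N) by ring.
  congr (_ * _); rewrite /a /b -sqrtrM ?mulr_ge0//.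
  have -> : 2 * pi / m.+1%:R * (8 * pi) = (4 * pi) ^+ 2 * m.+1%:R^-1 :> R by ring.
  rewrite sqrtrM ?sqr_ge0// sqrtr_sqr ger0_norm ?mulr_ge0// sqrtrV//.
  by field; rewrite gt_eqF.
apply: le_optimal; rewrite ?mulr_ge0 ?sqrtr_ge0// => l l0.
have mF1 : measurable_fun setT (fun z : V3 * (R * R) => (omega z.2 *
    (half_sin2 z.1 (sph z.2) ^+ m * q (vadd w (vscale (-1) z.1)) ^+ 2))).
  by rewrite /half_sin2; mfun.
have mF2 : measurable_fun setT (fun z : V3 * (R * R) => (omega z.2 *
    (half_sin2 z.1 (sph z.2) ^+ m * r (vadd w (post z.1 (sph z.2))) ^+ 2))).
  by rewrite /half_sin2 /post; mfun.
pose F1 y tau := omega tau * (half_sin2 y (sph tau) ^+ m * q (vadd w (vscale (-1) y)) ^+ 2).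
pose F2 y tau := omega tau * (half_sin2 y (sph tau) ^+ m * r (vadd w (post y (sph tau))) ^+ 2).
have F10 y tau : 0 <= F1 y tau by rewrite /F1 /half_sin2; nneg.
have F20 y tau : 0 <= F2 y tau by rewrite /F2 /half_sin2; nneg.
have mF1' : measurable_fun setT (fun z : V3 * (R * R) => F1 z.1 z.2) by exact: mF1.
have mF2' : measurable_fun setT (fun z : V3 * (R * R) => F2 z.1 z.2) by exact: mF2.
apply: (@le_trans _ _ (\int[leb3]_y \int[leb2]_tau
   ((l / 2 * F1 y tau)%:E + ((2 * l)^-1 * F2 y tau)%:E))%E).
  apply: ge0_le_integralT => y; first by rewrite /half_sin2; nneg.
  apply: ge0_le_integralT => tau; first by rewrite /half_sin2; nneg.
  rewrite -EFinD lee_fin /F1 /F2.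
  move: (q _) (r _) => x z.
  have -> : l / 2 * (omega tau * (half_sin2 y (sph tau) ^+ m * x ^+ 2)) +
    (2 * l)^-1 * (omega tau * (half_sin2 y (sph tau) ^+ m * z ^+ 2)) =
    omega tau * (half_sin2 y (sph tau) ^+ m * (l / 2 * x ^+ 2 + (2 * l)^-1 * z ^+ 2)) by ring.
  rewrite ler_wpM2l ?omega_ge0// ler_wpM2l ?exprn_ge0 ?half_sin2_ge0//.
  rewrite -subr_ge0.
  have -> : l / 2 * x ^+ 2 + (2 * l)^-1 * z ^+ 2 - x * z = (l * x - z) ^+ 2 / (2 * l).
    by field; rewrite gt_eqF.
  by rewrite divr_ge0 ?sqr_ge0// mulr_ge0// ltW.
have l2 : 0 <= l / 2 by rewrite divr_ge0// ltW.
have l2' : 0 <= (2 * l)^-1 by rewrite invr_ge0 mulr_ge0// ltW.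
have -> : (\int[leb3]_y \int[leb2]_tau
   ((l / 2 * F1 y tau)%:E + ((2 * l)^-1 * F2 y tau)%:E) =
   (l / 2)%:E * (\int[leb3]_y \int[leb2]_tau (F1 y tau)%:E) +
   ((2 * l)^-1)%:E * (\int[leb3]_y \int[leb2]_tau (F2 y tau)%:E))%E.
  rewrite -!ge0_integralZl ?lee_fin//; [|by mfun|by nneg|by mfun|by nneg].
  rewrite -ge0_integralD//; [|by nneg|by mfun|by nneg|by mfun].
  apply: eq_integral => y _.
  by rewrite ge0_integralD//; [rewrite !ge0_integral_scale//; mfun|by nneg|by mfun|by nneg|by mfun].
apply: (@le_trans _ _ ((l / 2)%:E * (4 * pi / m.+1%:R * Q ^+ 2)%:E +
    ((2 * l)^-1)%:E * (16 * pi * N ^+ 2)%:E)%E).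
  by apply: leeD; apply: lee_wpmul2l; rewrite ?lee_fin.
rewrite -!EFinM -EFinD lee_fin !exprMn a2 b2 le_eqVlt; apply/orP; left; apply/eqP.
by field; rewrite gt_eqF//= pnatr_eq0.
Qed.

End Fixed.
End CollisionForm.

(** * The trilinear collision form and the gain term *)

Section CollisionIntegral.
Context (R : realType).
Local Notation V3 := (R * R * R)%type.

Definition cpre (c y : V3) : V3 := vadd c (vscale 2^-1 y).
Definition cpre' (c y : V3) : V3 := vadd c (vscale (- 2^-1) y).
Definition cpost (c y n : V3) : V3 := vadd c (vscale (vnorm y / 2) n).

Section Form.
Variables (m : nat) (p q r : V3 -> R).
Hypotheses (mp : measurable_fun setT p) (mq : measurable_fun setT q) (mr : measurable_fun setT r).
Hypotheses (p0 : forall v, 0 <= p v) (q0 : forall v, 0 <= q v) (r0 : forall v, 0 <= r v).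

(** [half_sin2] measures the deviation from [cpre c y], the velocity at which [p] is taken. The
    bound below uses the L^1 norm of [p] and the L^2 norms of [q] and [r]. *)
Definition collision_form : \bar R :=
  (\int[leb3]_c \int[leb3]_y \int[leb2]_tau (omega tau * (half_sin2 y (sph tau) ^+ m *
    (p (cpre c y) * (q (cpre' c y) * r (cpost c y (sph tau))))))%:E)%E.

(** The reflection [y -> - y] exchanges the two incoming velocities and leaves the outgoing one in
    place. *)
Lemma collision_form_opp :
  (\int[leb3]_c \int[leb3]_y \int[leb2]_tau
    (omega tau * (half_sin2 (vscale (-1) y) (sph tau) ^+ m *
    (p (cpre' c y) * (q (cpre c y) * r (cpost c y (sph tau))))))%:E = collision_form)%E.
Proof.
apply: eq_integral => c _.
rewrite -[RHS](@ge0_integral3_affine _ (-1) (mk3 0 0 0) (fun y => \int[leb2]_tau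
   (omega tau * (half_sin2 y (sph tau) ^+ m *
    (p (cpre c y) * (q (cpre' c y) * r (cpost c y (sph tau))))))%:E)%E);
  [|by rewrite normrN1|by rewrite /half_sin2 /cpre /cpre' /cpost; mfun
   |by rewrite /half_sin2; nneg].
apply: eq_integral => y _; apply: eq_integral => tau _; congr (_ * _)%:E.
have -> : vadd (vscale (-1) y) (mk3 0 0 0) = vscale (-1) y.
  by apply: V3_ext; rewrite /vadd /vscale /mk3 /vx /vy /vz/=; ring.
congr (_ * (p _ * (q _ * r _))).
- by apply: V3_ext; rewrite /cpre /cpre' /vadd /vscale /mk3 /vx /vy /vz/=; ring.
- by apply: V3_ext; rewrite /cpre /cpre' /vadd /vscale /mk3 /vx /vy /vz/=; ring.
- by rewrite /cpost vnorm_scale normrN1 mul1r.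
Qed.

(** Recentring at [w = c + y / 2] makes [p w] a factor independent of [y] and of the direction; the
    bound at fixed [w] is uniform in [w] and is integrated against [p]. *)
Lemma collision_form_le (P Q N : R) : (0 < m)%N -> 0 <= P -> 0 <= Q -> 0 <= N ->
  (\int[leb3]_v (p v)%:E = P%:E)%E ->
  (\int[leb3]_v (q v ^+ 2)%:E = (Q ^+ 2)%:E)%E ->
  (\int[leb3]_v (r v ^+ 2)%:E = (N ^+ 2)%:E)%E ->
  (collision_form <= (8 * pi / Num.sqrt m.+1%:R * (P * (Q * N)))%:E)%E.
Proof.
move=> m0 P0 Q0 N0 pP qQ rN; rewrite /collision_form.
rewrite ge0_integral_swap; [|by rewrite /half_sin2 /cpre /cpre' /cpost; mfun
  |by rewrite /half_sin2; nneg].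
have -> : (\int[leb3]_y \int[leb3]_c \int[leb2]_tau (omega tau * (half_sin2 y (sph tau) ^+ m *
    (p (cpre c y) * (q (cpre' c y) * r (cpost c y (sph tau))))))%:E =
  \int[leb3]_y \int[leb3]_w \int[leb2]_tau (p w * (omega tau * (half_sin2 y (sph tau) ^+ m *
    (q (vadd w (vscale (-1) y)) * r (vadd w (post y (sph tau)))))))%:E)%E.
  apply: eq_integral => y _.
  rewrite -[LHS](@ge0_integral3_affine _ 1 (vscale (- 2^-1) y) (fun c => \int[leb2]_tau
   (omega tau * (half_sin2 y (sph tau) ^+ m *
    (p (cpre c y) * (q (cpre' c y) * r (cpost c y (sph tau))))))%:E)%E);
   [|by rewrite normr1|by rewrite /half_sin2 /cpre /cpre' /cpost; mfun
   |by rewrite /half_sin2; nneg].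
  apply: eq_integral => w _; apply: eq_integral => tau _; congr _%:E.
  rewrite [RHS]mulrCA; congr (_ * _); rewrite [RHS]mulrCA; congr (_ * (p _ * (q _ * r _))).
  - by apply: V3_ext; rewrite /cpre /vadd /vscale /mk3 /vx /vy /vz/=; ring.
  - by apply: V3_ext; rewrite /cpre' /vadd /vscale /mk3 /vx /vy /vz/=; field.
  - by apply: V3_ext; rewrite /cpost /post /vsub /vadd /vscale /mk3 /vx /vy /vz/=; field.
rewrite ge0_integral_swap; [|by rewrite /half_sin2 /post; mfun|by rewrite /half_sin2; nneg].
set M : R := 8 * pi / Num.sqrt m.+1%:R * (Q * N).
have M0 : 0 <= M.
  by rewrite /M !mulr_ge0 ?pi_ge0 ?invr_ge0 ?sqrtr_ge0.
have -> : 8 * pi / Num.sqrt m.+1%:R * (P * (Q * N)) = M * P by rewrite /M; ring.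
rewrite EFinM -pP -ge0_integral_scale//.
apply: ge0_le_integralT => w; first by rewrite /half_sin2; nneg.
have -> : (\int[leb3]_y \int[leb2]_tau (p w * (omega tau * (half_sin2 y (sph tau) ^+ m *
    (q (vadd w (vscale (-1) y)) * r (vadd w (post y (sph tau)))))))%:E =
  (p w)%:E * \int[leb3]_y \int[leb2]_tau (omega tau * (half_sin2 y (sph tau) ^+ m *
    (q (vadd w (vscale (-1) y)) * r (vadd w (post y (sph tau))))))%:E)%E.
  rewrite -ge0_integralZl ?lee_fin//; [|by rewrite /half_sin2 /post; mfun
    |by rewrite /half_sin2; nneg].
  apply: eq_integral => y _.
  by rewrite ge0_integral_scale//; [rewrite /half_sin2 /post; mfun|rewrite /half_sin2; nneg].
rewrite mulrC EFinM; apply: lee_wpmul2l; first by rewrite lee_fin.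
exact: collision_form_fixed_le.
Qed.

End Form.

(* The substitution (v, vs) -> (c, y), c = (v + vs) / 2 and y = v - vs, turns the
   pre-post collisional change of variables into the swap of y and |y| sigma. *)
Lemma gain_integral (gam : R) (f g q : V3 -> R) :
  measurable_fun setT f -> measurable_fun setT g -> measurable_fun setT q ->
  (forall v, 0 <= f v) -> (forall v, 0 <= g v) -> (forall v, 0 <= q v) ->
  (\int[leb3]_v \int[leb3]_vs \int[leb2]_tau
    (omega tau * (powR (vnorm (vsub v vs)) gam *
      (f (vspost v vs (sph tau)) * g (vpost v vs (sph tau))) * q v))%:E =
   \int[leb3]_c \int[leb3]_y \int[leb2]_tau
    (omega tau * (powR (vnorm y) gam *
      (f (cpre' c y) * g (cpre c y)) * q (cpost c y (sph tau))))%:E)%E.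
Proof.
move=> mf mg mq f0 g0 q0.
transitivity (\int[leb3]_v \int[leb3]_y \int[leb2]_tau
    (omega tau * (powR (vnorm y) gam *
      (f (vspost v (vsub v y) (sph tau)) * g (vpost v (vsub v y) (sph tau))) * q v))%:E)%E.
  apply: eq_integral => v _.
  rewrite -[LHS](@ge0_integral3_affine _ (-1) v (fun vs => \int[leb2]_tau
    (omega tau * (powR (vnorm (vsub v vs)) gam *
      (f (vspost v vs (sph tau)) * g (vpost v vs (sph tau))) * q v))%:E)%E);
    [|by rewrite normrN1|by rewrite /vspost /vpost; mfun|by nneg].
  apply: eq_integral => y _; apply: eq_integral => tau _.
  have -> : vadd (vscale (-1) y) v = vsub v y.
    by apply: V3_ext; rewrite /vsub /vadd /vscale /mk3 /vx /vy /vz/=; ring.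
  have -> : vsub v (vsub v y) = y.
    by apply: V3_ext; rewrite /vsub /vadd /vscale /mk3 /vx /vy /vz/=; ring.
  by [].
rewrite ge0_integral_swap; [|by rewrite /vspost /vpost; mfun|by nneg].
transitivity (\int[leb3]_y \int[leb3]_c \int[leb2]_tau
    (omega tau * (powR (vnorm y) gam *
      (f (cpre' c (vscale (vnorm y) (sph tau))) * g (cpre c (vscale (vnorm y) (sph tau)))) *
        q (cpre c y)))%:E)%E.
  apply: eq_integral => y _.
  rewrite -[LHS](@ge0_integral3_affine _ 1 (vscale 2^-1 y) (fun v => \int[leb2]_tau
    (omega tau * (powR (vnorm y) gam *
      (f (vspost v (vsub v y) (sph tau)) * g (vpost v (vsub v y) (sph tau))) * q v))%:E)%E);
    [|by rewrite normr1|by rewrite /vspost /vpost; mfun|by nneg].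
  apply: eq_integral => c _; apply: eq_integral => tau _.
  set v := vadd (vscale 1 c) _.
  have vE : v = cpre c y.
    by apply: V3_ext; rewrite /v /cpre /vadd /vscale /mk3 /vx /vy /vz/=; ring.
  have vyE : vsub v (vsub v y) = y.
    by apply: V3_ext; rewrite /vsub /vadd /vscale /mk3 /vx /vy /vz/=; ring.
  have -> : vspost v (vsub v y) (sph tau) = cpre' c (vscale (vnorm y) (sph tau)).
    by rewrite /vspost vyE vE; apply: V3_ext;
      rewrite /cpre /cpre' /vsub /vadd /vscale /mk3 /vx /vy /vz/=; field.
  have -> : vpost v (vsub v y) (sph tau) = cpre c (vscale (vnorm y) (sph tau)).
    by rewrite /vpost vyE vE; apply: V3_ext;
      rewrite /cpre /cpre' /vsub /vadd /vscale /mk3 /vx /vy /vz/=; field.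
  by rewrite vE.
rewrite ge0_integral_swap; [|by rewrite /cpre /cpre'; mfun|by nneg].
apply: eq_integral => c _.
rewrite (@ge0_integral_direction_swap _ (fun a y => powR (vnorm y) gam *
      (f (cpre' c a) * g (cpre c a)) * q (cpre c y)));
  [|by rewrite /cpre /cpre'; mfun|by nneg].
apply: eq_integral => y _; apply: eq_integral => tau _.
rewrite vnorm_scale_sph ?vnorm_ge0//; congr (_ * (_ * q _))%:E.
by apply: V3_ext; rewrite /cpre /cpost /vadd /vscale /mk3 /vx /vy /vz/=; ring.
Qed.

End CollisionIntegral.

(** * Weighted L^1 and L^2 integrals *)

Section WeightedNorms.
Context (R : realType).
Local Notation mu := (@lebesgue_measure R).
Local Notation V3 := (R * R * R)%type.

Definition weighted (f : V3 -> R) (l : R) (v : V3) : R := f v * powR (jb v) l.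

Lemma weighted_ge0 f l : (forall v, 0 <= f v) -> forall v, 0 <= weighted f l v.
Proof. by move=> f0 v; rewrite mulr_ge0// powR_ge0. Qed.

Lemma measurable_weighted f l : measurable_fun setT f -> measurable_fun setT (weighted f l).
Proof. by move=> mf; rewrite /weighted; mfun. Qed.

Let expr3_mul (x : R) : x ^+ 3 = x * (x * x).
Proof. by rewrite !exprS expr0 mulr1. Qed.

(** The integrand is at most [<v>^-6] because [2 - k <= -3], and [<v>^2] dominates each of
    [1 + x^2], [1 + y^2], [1 + z^2]: three Cauchy integrals, each equal to [pi]. *)
Lemma integral_jb_le (k : R) : 5 <= k ->
  (\int[leb3]_v (powR (jb v) (2 - k) ^+ 2)%:E <= (pi ^+ 3)%:E)%E.
Proof.
move=> k5.
pose c (x : R) : R := (1 + x ^+ 2)^-1.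
have c0 x : 0 <= c x by rewrite invr_ge0 addr_ge0// sqr_ge0.
have mc : measurable_fun setT c by rewrite /c; mfun.
have cE : (\int[mu]_x (c x)%:E = pi%:E)%E by exact: integral_cauchy.
have pi0 : 0 <= pi :> R := pi_ge0 R.
apply: (@le_trans _ _ (\int[leb3]_v (c (vz v) * (c (vy v) * c (vx v)))%:E)%E).
  apply: ge0_le_integralT => v; rewrite lee_fin ?sqr_ge0//.
  have J1 := jb_ge1 v.
  have h : powR (jb v) (2 - k) <= (jb v ^+ 3)^-1.
    rewrite -powR_invn ?jb_ge0//; apply: ler_powR => //; lra.
  apply: (@le_trans _ _ (((jb v ^+ 3)^-1) ^+ 2)).
    by rewrite ler_pXn2r ?nnegrE ?powR_ge0 ?invr_ge0 ?exprn_ge0 ?jb_ge0.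
  rewrite exprVn -exprM mulnC exprM sqr_jb /c -!invfM lef_pV2; last 2 first.
  - by rewrite posrE exprn_gt0// ltr_pwDl// dot_ge0.
  - by rewrite posrE !mulr_gt0// ltr_pwDl// sqr_ge0.
  have sq x : 0 <= x ^+ 2 :> R by exact: sqr_ge0.
  have -> : dot v v = vx v ^+ 2 + vy v ^+ 2 + vz v ^+ 2 by rewrite /dot !expr2.
  rewrite expr3_mul.
  have sx := sq (vx v); have sy := sq (vy v); have sz := sq (vz v).
  have p x : 0 <= 1 + x ^+ 2 :> R by rewrite addr_ge0.
  by apply: ler_pM; rewrite ?mulr_ge0//; [lra|apply: ler_pM => //; lra].
rewrite ge0_integral3; [|by mfun|by nneg].
have -> : (\int[mu]_z \int[mu]_y \int[mu]_x (c (vz (mk3 x y z)) *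
    (c (vy (mk3 x y z)) * c (vx (mk3 x y z))))%:E =
  \int[mu]_z (c z * (pi * pi))%:E)%E.
  apply: eq_integral => z _.
  have -> : (\int[mu]_y \int[mu]_x (c (vz (mk3 x y z)) *
      (c (vy (mk3 x y z)) * c (vx (mk3 x y z))))%:E = \int[mu]_y ((c z * pi) * c y)%:E)%E.
    apply: eq_integral => y _.
    have -> : ((c z * pi) * c y)%:E = ((c z * c y)%:E * \int[mu]_x (c x)%:E)%E.
      by rewrite cE -EFinM; congr _%:E; ring.
    rewrite -ge0_integral_scale//; last by rewrite mulr_ge0.
    by apply: eq_integral => x _; rewrite /mk3 /vx /vy /vz/= mulrA.
  by rewrite ge0_integral_scale// ?mulr_ge0// cE -EFinM mulrA.
have -> : (\int[mu]_z (c z * (pi * pi))%:E = \int[mu]_z ((pi * pi) * c z)%:E)%E.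
  by apply: eq_integral => z _; rewrite mulrC.
by rewrite ge0_integral_scale// ?mulr_ge0// cE -EFinM lee_fin expr3_mul mulrA.
Qed.

(** Cauchy-Schwarz for the product of [g <v>^k] and [<v>^(2 - k)]. *)
Lemma integral_jb2_le (k N : R) (g : V3 -> R) : 5 <= k -> 0 <= N ->
  measurable_fun setT g -> (forall v, 0 <= g v) ->
  (\int[leb3]_v (weighted g k v ^+ 2)%:E = (N ^+ 2)%:E)%E ->
  (\int[leb3]_v (g v * jb v ^+ 2)%:E <= (Num.sqrt (pi ^+ 3) * N)%:E)%E.
Proof.
move=> k5 N0 mg g0 gN.
have mw := measurable_weighted k mg; have w0 := weighted_ge0 k g0.
have p0 : 0 <= pi ^+ 3 :> R by rewrite exprn_ge0// pi_ge0.
(* Each factor gets [1 / sqrt 2], whose square is the half in Young's inequality. *)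
have -> : Num.sqrt (pi ^+ 3) * N =
    2 * ((N / Num.sqrt 2) * (Num.sqrt (pi ^+ 3) / Num.sqrt 2)) :> R.
  have s2 : Num.sqrt 2 != 0 :> R by rewrite gt_eqF// sqrtr_gt0.
  rewrite -{1}[2](@sqr_sqrtr R)//; move: (Num.sqrt 2) s2 => s s2; by field.
apply: le_optimal; rewrite ?divr_ge0 ?sqrtr_ge0// => l l0.
have l2 : 0 <= l / 2 by rewrite divr_ge0// ltW.
have l2' : 0 <= (2 * l)^-1 by rewrite invr_ge0 mulr_ge0// ltW.
apply: (@le_trans _ _ (\int[leb3]_v ((l / 2 * weighted g k v ^+ 2)%:E +
    ((2 * l)^-1 * powR (jb v) (2 - k) ^+ 2)%:E))%E).
  apply: ge0_le_integralT => v; first by nneg.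
  rewrite -EFinD lee_fin.
  have -> : g v * jb v ^+ 2 = weighted g k v * powR (jb v) (2 - k).
    rewrite /weighted -mulrA -powRD; last first.
      by apply/implyP => _; rewrite gt_eqF// (lt_le_trans _ (jb_ge1 v)).
    by rewrite addrC subrK powR_mulrn// jb_ge0.
  move: (weighted g k v) (powR _ _) => x z; rewrite -subr_ge0.
  have -> : l / 2 * x ^+ 2 + (2 * l)^-1 * z ^+ 2 - x * z = (l * x - z) ^+ 2 / (2 * l).
    by field; rewrite gt_eqF.
  by rewrite divr_ge0 ?sqr_ge0// mulr_ge0// ltW.
rewrite ge0_integralD//; [|by nneg|by mfun|by nneg|by mfun].
rewrite !ge0_integral_scale//; [|by mfun|by nneg|by mfun|by nneg].
rewrite gN; apply: (@le_trans _ _ ((l / 2)%:E * (N ^+ 2)%:E + ((2 * l)^-1)%:E * (pi ^+ 3)%:E)%E).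
  by rewrite leeD2l// lee_wpmul2l ?lee_fin// integral_jb_le.
rewrite -!EFinM -EFinD lee_fin !expr_div_n !sqr_sqrtr//.
by rewrite le_eqVlt; apply/orP; left; apply/eqP; field; rewrite gt_eqF.
Qed.

Lemma integral_mul_le (q r : V3 -> R) (Q N : R) :
  measurable_fun setT q -> measurable_fun setT r ->
  (forall v, 0 <= q v) -> (forall v, 0 <= r v) -> 0 <= Q -> 0 <= N ->
  (\int[leb3]_v (q v ^+ 2)%:E = (Q ^+ 2)%:E)%E ->
  (\int[leb3]_v (r v ^+ 2)%:E = (N ^+ 2)%:E)%E ->
  (\int[leb3]_v (q v * r v)%:E <= (Q * N)%:E)%E.
Proof.
move=> mq mr q0 r0 Q0 N0 qQ rN.
have -> : Q * N = 2 * ((Q / Num.sqrt 2) * (N / Num.sqrt 2)).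
  have s2 : Num.sqrt 2 != 0 :> R by rewrite gt_eqF// sqrtr_gt0.
  rewrite -{1}[2](@sqr_sqrtr R)//; move: (Num.sqrt 2) s2 => s s2; by field.
apply: le_optimal; rewrite ?divr_ge0 ?sqrtr_ge0// => l l0.
have l2 : 0 <= l / 2 by rewrite divr_ge0// ltW.
have l2' : 0 <= (2 * l)^-1 by rewrite invr_ge0 mulr_ge0// ltW.
apply: (@le_trans _ _ (\int[leb3]_v ((l / 2 * q v ^+ 2)%:E + ((2 * l)^-1 * r v ^+ 2)%:E))%E).
  apply: ge0_le_integralT => v; first by nneg.
  rewrite -EFinD lee_fin.
  move: (q v) (r v) => x z; rewrite -subr_ge0.
  have -> : l / 2 * x ^+ 2 + (2 * l)^-1 * z ^+ 2 - x * z = (l * x - z) ^+ 2 / (2 * l).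
    by field; rewrite gt_eqF.
  by rewrite divr_ge0 ?sqr_ge0// mulr_ge0// ltW.
rewrite ge0_integralD//; [|by nneg|by mfun|by nneg|by mfun].
rewrite !ge0_integral_scale//; [|by mfun|by nneg|by mfun|by nneg].
rewrite qQ rN -!EFinM -EFinD lee_fin !expr_div_n !sqr_sqrtr//.
by rewrite le_eqVlt; apply/orP; left; apply/eqP; field; rewrite gt_eqF.
Qed.

End WeightedNorms.

(** * Linearity and measurability of triple integrals *)

Section CollisionBound.
Context (R : realType).
Local Notation V3 := (R * R * R)%type.

Section Triple.
Variables F1 F2 : V3 -> V3 -> R * R -> R.
Hypothesis mF1 : measurable_fun setT (fun z : V3 * V3 * (R * R) => F1 z.1.1 z.1.2 z.2).
Hypothesis mF2 : measurable_fun setT (fun z : V3 * V3 * (R * R) => F2 z.1.1 z.1.2 z.2).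
Hypothesis F10 : forall x y t, 0 <= F1 x y t.
Hypothesis F20 : forall x y t, 0 <= F2 x y t.

Let m1 d (T : measurableType d) (a b : T -> V3) (t : T -> R * R) :
  measurable_fun setT a -> measurable_fun setT b -> measurable_fun setT t ->
  measurable_fun setT (fun z => F1 (a z) (b z) (t z)).
Proof.
move=> ma mb mt; apply: (measurableT_comp mF1 (g := fun z => (a z, b z, t z))).
by apply: measurable_fun_Pair => //; exact: measurable_fun_Pair.
Qed.

Let m2 d (T : measurableType d) (a b : T -> V3) (t : T -> R * R) :
  measurable_fun setT a -> measurable_fun setT b -> measurable_fun setT t ->
  measurable_fun setT (fun z => F2 (a z) (b z) (t z)).
Proof.
move=> ma mb mt; apply: (measurableT_comp mF2 (g := fun z => (a z, b z, t z))).
by apply: measurable_fun_Pair => //; exact: measurable_fun_Pair.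
Qed.

Lemma integral_triple_add :
  (\int[leb3]_x \int[leb3]_y \int[leb2]_t (F1 x y t + F2 x y t)%:E =
   \int[leb3]_x \int[leb3]_y \int[leb2]_t (F1 x y t)%:E +
   \int[leb3]_x \int[leb3]_y \int[leb2]_t (F2 x y t)%:E)%E.
Proof.
rewrite -ge0_integralD//; [|by nneg|by mfun; apply: m1; mfun|by nneg|by mfun; apply: m2; mfun].
apply: eq_integral => x _.
rewrite -ge0_integralD//; [|by nneg|by mfun; apply: m1; mfun|by nneg|by mfun; apply: m2; mfun].
apply: eq_integral => y _.
rewrite -ge0_integralD//.
- by nneg.
- by apply: measurable_fun_EFin; apply: (m1 (a := fun=> x) (b := fun=> y) (t := id)); mfun.
- by nneg.
- by apply: measurable_fun_EFin; apply: (m2 (a := fun=> x) (b := fun=> y) (t := id)); mfun.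
Qed.

Lemma integral_triple_scale (c : R) : 0 <= c ->
  (\int[leb3]_x \int[leb3]_y \int[leb2]_t (c * F1 x y t)%:E =
   c%:E * \int[leb3]_x \int[leb3]_y \int[leb2]_t (F1 x y t)%:E)%E.
Proof.
move=> c0; rewrite -ge0_integralZl ?lee_fin//; [|by mfun; apply: m1; mfun|by nneg].
apply: eq_integral => x _.
rewrite -ge0_integralZl ?lee_fin//; [|by mfun; apply: m1; mfun|by nneg].
apply: eq_integral => y _.
by rewrite ge0_integral_scale//; apply: (m1 (a := fun=> x) (b := fun=> y) (t := id)); mfun.
Qed.

Lemma integral_triple_le : (forall x y t, F1 x y t <= F2 x y t) ->
  (\int[leb3]_x \int[leb3]_y \int[leb2]_t (F1 x y t)%:E <=
   \int[leb3]_x \int[leb3]_y \int[leb2]_t (F2 x y t)%:E)%E.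
Proof.
move=> F12; do 2 (apply: ge0_le_integralT => ?; first by nneg).
by apply: ge0_le_integralT => ?; rewrite lee_fin.
Qed.

End Triple.

Lemma integral_triple_lincomb (a b : R) (F1 F2 F3 F4 : V3 -> V3 -> R * R -> R) :
  0 <= a -> 0 <= b ->
  measurable_fun setT (fun z : V3 * V3 * (R * R) => F1 z.1.1 z.1.2 z.2) ->
  measurable_fun setT (fun z : V3 * V3 * (R * R) => F2 z.1.1 z.1.2 z.2) ->
  measurable_fun setT (fun z : V3 * V3 * (R * R) => F3 z.1.1 z.1.2 z.2) ->
  measurable_fun setT (fun z : V3 * V3 * (R * R) => F4 z.1.1 z.1.2 z.2) ->
  (forall x y t, 0 <= F1 x y t) -> (forall x y t, 0 <= F2 x y t) ->
  (forall x y t, 0 <= F3 x y t) -> (forall x y t, 0 <= F4 x y t) ->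
  (\int[leb3]_x \int[leb3]_y \int[leb2]_t
     ((a * F1 x y t + a * F2 x y t) + (b * F3 x y t + b * F4 x y t))%:E =
   (a%:E * \int[leb3]_x \int[leb3]_y \int[leb2]_t (F1 x y t)%:E +
    a%:E * \int[leb3]_x \int[leb3]_y \int[leb2]_t (F2 x y t)%:E) +
   (b%:E * \int[leb3]_x \int[leb3]_y \int[leb2]_t (F3 x y t)%:E +
    b%:E * \int[leb3]_x \int[leb3]_y \int[leb2]_t (F4 x y t)%:E))%E.
Proof.
move=> a0 b0 mF1 mF2 mF3 mF4 F10 F20 F30 F40.
have mM c (F : V3 -> V3 -> R * R -> R) :
  measurable_fun setT (fun z : V3 * V3 * (R * R) => F z.1.1 z.1.2 z.2) ->
  measurable_fun setT (fun z : V3 * V3 * (R * R) => c * F z.1.1 z.1.2 z.2 : R).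
  by move=> mF; apply: measurable_fun_Mul mF; exact: measurable_fun_Cst.
have g0 c (F : V3 -> V3 -> R * R -> R) : 0 <= c -> (forall x y t, 0 <= F x y t) ->
  forall x y t, 0 <= c * F x y t by move=> c0 F0 x y t; rewrite mulr_ge0.
have m12 c F F' (mF : measurable_fun setT (fun z : V3 * V3 * (R * R) => F z.1.1 z.1.2 z.2 : R))
    (mF' : measurable_fun setT (fun z : V3 * V3 * (R * R) => F' z.1.1 z.1.2 z.2 : R)) :
    measurable_fun setT (fun z : V3 * V3 * (R * R) =>
      c * F z.1.1 z.1.2 z.2 + c * F' z.1.1 z.1.2 z.2 : R).
  by apply: measurable_fun_Add; exact: mM.
have g12 c (F F' : V3 -> V3 -> R * R -> R) : 0 <= c -> (forall x y t, 0 <= F x y t) ->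
    (forall x y t, 0 <= F' x y t) -> forall x y t, 0 <= c * F x y t + c * F' x y t.
  by move=> c0 F0 F'0 x y t; rewrite addr_ge0// mulr_ge0.
have E12 := integral_triple_add (F1 := fun x y t => a * F1 x y t)
  (F2 := fun x y t => a * F2 x y t) (mM a _ mF1) (mM a _ mF2) (g0 a _ a0 F10) (g0 a _ a0 F20).
have E34 := integral_triple_add (F1 := fun x y t => b * F3 x y t)
  (F2 := fun x y t => b * F4 x y t) (mM b _ mF3) (mM b _ mF4) (g0 b _ b0 F30) (g0 b _ b0 F40).
have E := integral_triple_add (F1 := fun x y t => a * F1 x y t + a * F2 x y t)
  (F2 := fun x y t => b * F3 x y t + b * F4 x y t)
  (m12 a _ _ mF1 mF2) (m12 b _ _ mF3 mF4) (g12 a _ _ a0 F10 F20) (g12 b _ _ b0 F30 F40).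
apply: (eq_trans E); congr (_ + _)%E.
- apply: (eq_trans E12); congr (_ + _)%E.
    exact: (integral_triple_scale mF1 F10 a0).
  exact: (integral_triple_scale mF2 F20 a0).
- apply: (eq_trans E34); congr (_ + _)%E.
    exact: (integral_triple_scale mF3 F30 b0).
  exact: (integral_triple_scale mF4 F40 b0).
Qed.

Lemma measurable_collision (m : nat) (p q r : V3 -> R) :
  measurable_fun setT p -> measurable_fun setT q -> measurable_fun setT r ->
  measurable_fun setT (fun z : V3 * V3 * (R * R) =>
    omega z.2 * (half_sin2 z.1.2 (sph z.2) ^+ m * (p (cpre z.1.1 z.1.2) *
      (q (cpre' z.1.1 z.1.2) * r (cpost z.1.1 z.1.2 (sph z.2)))))).
Proof. by move=> mp mq mr; rewrite /half_sin2 /cpre /cpre' /cpost; mfun. Qed.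

Lemma measurable_collision_opp (m : nat) (p q r : V3 -> R) :
  measurable_fun setT p -> measurable_fun setT q -> measurable_fun setT r ->
  measurable_fun setT (fun z : V3 * V3 * (R * R) =>
    omega z.2 * (half_sin2 (vscale (-1) z.1.2) (sph z.2) ^+ m * (p (cpre' z.1.1 z.1.2) *
      (q (cpre z.1.1 z.1.2) * r (cpost z.1.1 z.1.2 (sph z.2)))))).
Proof. by move=> mp mq mr; rewrite /half_sin2 /cpre /cpre' /cpost; mfun. Qed.

Lemma measurable_gain (gam : R) (f g q : V3 -> R) :
  measurable_fun setT f -> measurable_fun setT g -> measurable_fun setT q ->
  measurable_fun setT (fun z : V3 * V3 * (R * R) =>
    omega z.2 * (powR (vnorm (vsub z.1.1 z.1.2)) gam *
      (f (vspost z.1.1 z.1.2 (sph z.2)) * g (vpost z.1.1 z.1.2 (sph z.2))) * q z.1.1)).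
Proof. by move=> mf mg mq; rewrite /vspost /vpost; mfun. Qed.

Lemma measurable_loss (gam : R) (f g q : V3 -> R) :
  measurable_fun setT f -> measurable_fun setT g -> measurable_fun setT q ->
  measurable_fun setT (fun z : V3 * V3 * (R * R) =>
    omega z.2 * (powR (vnorm (vsub z.1.1 z.1.2)) gam * (f z.1.2 * g z.1.1) * q z.1.1)).
Proof. by move=> mf mg mq; mfun. Qed.

Lemma collision_ge0 (m : nat) (a b c y y' : V3) (t : R * R) (p q r : V3 -> R) :
  (forall v, 0 <= p v) -> (forall v, 0 <= q v) -> (forall v, 0 <= r v) ->
  0 <= omega t * (half_sin2 y y' ^+ m * (p a * (q b * r c))).
Proof.
by move=> p0 q0 r0; rewrite /half_sin2; nneg.
Qed.

End CollisionBound.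

(** * The gain and loss terms *)

Section CollisionBound.
Context (R : realType).
Local Notation V3 := (R * R * R)%type.

(** For velocities of comparable size: the power [m = 1], just enough for the Jacobian, and the L^1
    norm of [u <v>^2] replaced by a multiple of the L^2_k norm [U]. *)
Lemma collision_form1_le (k U V N : R) (u v h : V3 -> R) : 5 <= k ->
  measurable_fun setT u -> measurable_fun setT v -> measurable_fun setT h ->
  (forall x, 0 <= u x) -> (forall x, 0 <= v x) -> (forall x, 0 <= h x) ->
  0 <= U -> 0 <= V -> 0 <= N ->
  (\int[leb3]_x (weighted u k x ^+ 2)%:E = (U ^+ 2)%:E)%E ->
  (\int[leb3]_x (weighted v k x ^+ 2)%:E = (V ^+ 2)%:E)%E ->
  (\int[leb3]_x (weighted h k x ^+ 2)%:E = (N ^+ 2)%:E)%E ->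
  (collision_form 1 (fun x => u x * jb x ^+ 2)%R (weighted v k) (weighted h k) <=
    (8 * pi * Num.sqrt (pi ^+ 3) * (V * (U * N)))%:E)%E.
Proof.
move=> k5 mu' mv mh u0 v0 h0 U0 V0 N0 uU vV hN.
have ple := integral_jb2_le k5 U0 mu' u0 uU.
set I := (\int[leb3]_x _)%E in ple.
have I0 : (0 <= I)%E by apply: integral_ge0 => x _; rewrite lee_fin mulr_ge0// sqr_ge0.
have If : I \is a fin_num by rewrite ge0_fin_numE// (le_lt_trans ple)// ltry.
have mp : measurable_fun setT (fun x => u x * jb x ^+ 2) by mfun.
have p0 x : 0 <= u x * jb x ^+ 2 by rewrite mulr_ge0// sqr_ge0.
have IU : fine I <= Num.sqrt (pi ^+ 3) * U by rewrite -lee_fin fineK.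
apply: le_trans (collision_form_le mp (measurable_weighted k mv) (measurable_weighted k mh) p0
  (weighted_ge0 k v0) (weighted_ge0 k h0) (isT : (0 < 1)%N)
  (fine_ge0 I0) V0 N0 (esym (fineK If)) vV hN) _.
have pi0 : 0 <= 8 * pi :> R by rewrite mulr_ge0// pi_ge0.
have s2 : 8 * pi / Num.sqrt 2%:R <= 8 * pi :> R.
  have s2 : 1 <= Num.sqrt 2%:R :> R by rewrite -[leLHS]sqrtr1 ler_wsqrtr// ler1n.
  by rewrite ler_pdivrMr ?(lt_le_trans _ s2)// ler_peMr.
have VN : 0 <= V * N by rewrite mulr_ge0.
rewrite lee_fin; apply: (@le_trans _ _ (8 * pi * (fine I * (V * N)))).
  by apply: ler_wpM2r s2; rewrite mulr_ge0// fine_ge0.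
have -> : 8 * pi * Num.sqrt (pi ^+ 3) * (V * (U * N)) =
  8 * pi * ((Num.sqrt (pi ^+ 3) * U) * (V * N)) by ring.
by rewrite ler_wpM2l// ler_wpM2r.
Qed.

Section Bound.
(** [b] is the share of the kernel's growth that [h] carries; [gam - b] goes to whichever of [f],
    [g] is measured in L^2. The norms are kept as real numbers, so that no product of infinities
    occurs. *)
Variables (k gam b : R) (f g h : V3 -> R) (F1 G1 F2 G2 H2 Fk Gk Hk : R).
Hypotheses (k8 : 8 <= k) (bg : 0 <= b <= gam) (g1 : gam <= 1).
Hypotheses (mf : measurable_fun setT f) (mg : measurable_fun setT g)
  (mh : measurable_fun setT h).
Hypotheses (f0 : forall v, 0 <= f v) (g0 : forall v, 0 <= g v) (h0 : forall v, 0 <= h v).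
Hypotheses (F10 : 0 <= F1) (G10 : 0 <= G1) (F20 : 0 <= F2) (G20 : 0 <= G2) (H20 : 0 <= H2)
  (Fk0 : 0 <= Fk) (Gk0 : 0 <= Gk) (Hk0 : 0 <= Hk).
Hypothesis fF1 : (\int[leb3]_v (weighted f gam v)%:E = F1%:E)%E.
Hypothesis gG1 : (\int[leb3]_v (weighted g gam v)%:E = G1%:E)%E.
Hypothesis fF2 : (\int[leb3]_v (weighted f (k + gam - b) v ^+ 2)%:E = (F2 ^+ 2)%:E)%E.
Hypothesis gG2 : (\int[leb3]_v (weighted g (k + gam - b) v ^+ 2)%:E = (G2 ^+ 2)%:E)%E.
Hypothesis hH2 : (\int[leb3]_v (weighted h (k + b) v ^+ 2)%:E = (H2 ^+ 2)%:E)%E.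
Hypothesis fFk : (\int[leb3]_v (weighted f k v ^+ 2)%:E = (Fk ^+ 2)%:E)%E.
Hypothesis gGk : (\int[leb3]_v (weighted g k v ^+ 2)%:E = (Gk ^+ 2)%:E)%E.
Hypothesis hHk : (\int[leb3]_v (weighted h k v ^+ 2)%:E = (Hk ^+ 2)%:E)%E.

Let q (v : V3) : R := h v * powR (jb v) (2 * k).
Let q0 v : 0 <= q v. Proof. by rewrite mulr_ge0// powR_ge0. Qed.
Let mq : measurable_fun setT q. Proof. by rewrite /q; mfun. Qed.
Let W0 := @weighted_ge0 R.
Let mW := @measurable_weighted R.
Let k0 : 0 < k. Proof. by apply: lt_le_trans k8. Qed.
Let b0 : 0 <= b. Proof. by case/andP: bg. Qed.
Let gam0 : 0 <= gam. Proof. by case/andP: bg => ?; apply: le_trans. Qed.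

(** From [|v - vs|^gam <= 2 <v>^gam <vs>^gam], [f] takes its L^1_gam norm, and
    [2 k + gam = (k + gam - b) + (k + b)] divides the weight at v between [g] and [h]. The constant
    is twice the area [4 pi]. *)
Let loss : (\int[leb3]_v \int[leb3]_vs \int[leb2]_tau
    (omega tau * (powR (vnorm (vsub v vs)) gam * (f vs * g v) * q v))%:E <=
  (8 * pi * F1 * (G2 * H2))%:E)%E.
Proof.
have mwf := mW gam mf; have mwg := mW (k + gam - b) mg; have mwh := mW (k + b) mh.
have wf0 := W0 gam f0; have wg0 := W0 (k + gam - b) g0; have wh0 := W0 (k + b) h0.
have pi0 : 0 <= pi :> R := pi_ge0 R.
apply: (@le_trans _ _ (\int[leb3]_v ((8 * pi * F1) *
    (weighted g (k + gam - b) v * weighted h (k + b) v))%:E)%E); last first.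
  rewrite ge0_integral_scale; [|by nneg|by mfun|by nneg].
  rewrite [X in (_ <= X)%E]EFinM; apply: lee_wpmul2l; first by rewrite lee_fin; nneg.
  exact: integral_mul_le.
apply: ge0_le_integralT => v; first by nneg.
apply: (@le_trans _ _ (\int[leb3]_vs ((8 * pi *
    (weighted g (k + gam - b) v * weighted h (k + b) v)) * weighted f gam vs)%:E)%E); last first.
  rewrite ge0_integral_scale; [|by nneg|by mfun|by nneg].
  by rewrite fF1 -EFinM lee_fin le_eqVlt; apply/orP; left; apply/eqP; ring.
apply: ge0_le_integralT => vs; first by nneg.
apply: (@le_trans _ _ (\int[leb2]_tau ((2 *
    (weighted g (k + gam - b) v * weighted h (k + b) v) * weighted f gam vs) * omega tau)%:E)%E);
  last first.
  rewrite ge0_integral_scale; [|by nneg|by mfun|by nneg].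
  rewrite integral_omega -EFinM lee_fin; move: (weighted g _ v * _) (weighted f _ _) => x z.
  by rewrite le_eqVlt; apply/orP; left; apply/eqP; ring.
apply: ge0_le_integralT => tau; first by nneg.
rewrite lee_fin [leRHS]mulrC; apply: ler_wpM2l; first exact: omega_ge0.
have h1 : powR (vnorm (vsub v vs)) gam <= 2 * (powR (jb v) gam * powR (jb vs) gam).
  apply: (le_trans (powR_le2 gam0 (vnorm_ge0 _) (vnorm_sub_le_jb v vs))).
  rewrite powRM ?mulr_ge0 ?jb_ge0// powRM ?jb_ge0// ler_wpM2r ?mulr_ge0 ?powR_ge0//.
  by apply: powR_2_le2; rewrite gam0.
have Jn : jb v != 0 by rewrite gt_eqF// (lt_le_trans _ (jb_ge1 v)).
have pE : powR (jb v) (k + gam - b) * powR (jb v) (k + b) =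
    powR (jb v) gam * powR (jb v) (2 * k).
  by rewrite -!powRD ?Jn ?implybT//; congr powR; ring.
have -> : 2 * (weighted g (k + gam - b) v * weighted h (k + b) v) * weighted f gam vs =
  (2 * (powR (jb v) gam * powR (jb vs) gam)) * (f vs * g v * q v).
  rewrite /weighted /q; move: (powR (jb v) (k + gam - b)) (powR (jb v) (k + b)) pE => x z.
  move: (powR (jb v) gam) (powR (jb v) (2 * k)) (powR (jb vs) gam) => x' z' t xz.
  transitivity (2 * (g v * h v * (x * z)) * (f vs * t)); first by ring.
  by rewrite xz; ring.
rewrite -mulrA; apply: ler_wpM2r; last exact: h1.
by apply: mulr_ge0 (q0 v); exact: mulr_ge0 (f0 vs) (g0 v).
Qed.

(** The pointwise weight inequality leaves four trilinear forms. [T1] has [g] in L^1 and keeps the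
    decay [1 / sqrt k]; [T2] has [f] in L^1, and its decay is discarded because its norms are those
    of the loss term. [T3] and [T4] come from velocities of comparable size and lead to the same
    product of L^2_k norms. *)
Let gain : (\int[leb3]_v \int[leb3]_vs \int[leb2]_tau
    (omega tau * (powR (vnorm (vsub v vs)) gam *
      (f (vspost v vs (sph tau)) * g (vpost v vs (sph tau))) * q v))%:E <=
  (32 * expR 1 * pi / Num.sqrt k * (G1 * (F2 * H2)) +
   32 * expR 1 * pi * (F1 * (G2 * H2)) +
   4 * powR (2 + 2 * k) k * (16 * pi * Num.sqrt (pi ^+ 3)) * (Fk * (Gk * Hk)))%:E)%E.
Proof.
have pi0 : 0 <= pi :> R := pi_ge0 R.
have e0 : 0 <= expR 1 :> R := expR_ge0 1.
have k8' : 8 <= k := k8.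
have k5 : 5 <= k by lra.
have g1' : gam <= 1 := g1.
(* 2 m <= k - b, since b <= 1, and k <= 4 (m + 1), which turns 1 / sqrt (m + 1) into
   2 / sqrt k. *)
pose m := Num.truncn ((k - 1) / 2).
have km0 : 0 <= (k - 1) / 2 by lra.
have /andP[m_le m_gt] := truncn_itv km0.
have m_gt0 : (0 < m)%N by rewrite truncn_gt_nat; lra.
have mk : m.*2%:R <= k - b.
  by move: m_le; rewrite -/m -muln2 natrM => m_le; case/andP: bg => ? ?; lra.
have sq : 8 * pi / Num.sqrt m.+1%:R <= 16 * pi / Num.sqrt k :> R.
  have sk0 : 0 < Num.sqrt k by rewrite sqrtr_gt0.
  have sm0 : 0 < Num.sqrt m.+1%:R :> R by rewrite sqrtr_gt0.
  rewrite ler_pdivlMr// mulrAC ler_pdivrMr//.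
  have -> : 16 * pi * Num.sqrt m.+1%:R = (8 * pi) * (2 * Num.sqrt m.+1%:R) :> R by ring.
  rewrite ler_wpM2l ?mulr_ge0//.
  have -> : 2 * Num.sqrt m.+1%:R = Num.sqrt (4 * m.+1%:R) :> R.
    rewrite sqrtrM//; congr (_ * _).
    have -> : 4 = 2 ^+ 2 :> R by ring.
    by rewrite sqrtr_sqr ger0_norm.
  by rewrite ler_wsqrtr//; move: m_gt; rewrite -/m => m_gt; lra.
have sq1 : 16 * pi / Num.sqrt k <= 16 * pi :> R.
  have sk1 : 1 <= Num.sqrt k by rewrite -[leLHS]sqrtr1 ler_wsqrtr//; lra.
  by rewrite ler_pdivrMr ?(lt_le_trans _ sk1)// ler_peMr// mulr_ge0.
pose T1 c y tau := omega tau * (half_sin2 y (sph tau) ^+ m * (weighted g gam (cpre c y) *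
  (weighted f (k + gam - b) (cpre' c y) * weighted h (k + b) (cpost c y (sph tau))))).
pose T2 c y tau := omega tau * (half_sin2 (vscale (-1) y) (sph tau) ^+ m *
  (weighted f gam (cpre' c y) *
  (weighted g (k + gam - b) (cpre c y) * weighted h (k + b) (cpost c y (sph tau))))).
pose p3 v := g v * jb v ^+ 2.
pose p4 v := f v * jb v ^+ 2.
pose T3 c y tau := omega tau * (half_sin2 y (sph tau) ^+ 1 * (p3 (cpre c y) *
  (weighted f k (cpre' c y) * weighted h k (cpost c y (sph tau))))).
pose T4 c y tau := omega tau * (half_sin2 (vscale (-1) y) (sph tau) ^+ 1 *
  (p4 (cpre' c y) * (weighted g k (cpre c y) * weighted h k (cpost c y (sph tau))))).
pose A : R := 2 * expR 1.
pose B := 4 * powR (2 + 2 * k) k.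
have A0 : 0 <= A by rewrite /A mulr_ge0.
have B0 : 0 <= B by rewrite /B mulr_ge0// powR_ge0.
have mp3 : measurable_fun setT p3 by rewrite /p3; mfun.
have mp4 : measurable_fun setT p4 by rewrite /p4; mfun.
have mT1 : measurable_fun setT (fun z : V3 * V3 * (R * R) => T1 z.1.1 z.1.2 z.2).
  exact: measurable_collision (mW gam mg) (mW (k + gam - b) mf) (mW (k + b) mh).
have mT2 : measurable_fun setT (fun z : V3 * V3 * (R * R) => T2 z.1.1 z.1.2 z.2).
  exact: measurable_collision_opp (mW gam mf) (mW (k + gam - b) mg) (mW (k + b) mh).
have mT3 : measurable_fun setT (fun z : V3 * V3 * (R * R) => T3 z.1.1 z.1.2 z.2).
  exact: measurable_collision mp3 (mW k mf) (mW k mh).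
have mT4 : measurable_fun setT (fun z : V3 * V3 * (R * R) => T4 z.1.1 z.1.2 z.2).
  exact: measurable_collision_opp mp4 (mW k mg) (mW k mh).
have p30 v : 0 <= p3 v by rewrite /p3 mulr_ge0// sqr_ge0.
have p40 v : 0 <= p4 v by rewrite /p4 mulr_ge0// sqr_ge0.
have T10 c y t : 0 <= T1 c y t.
  by exact: collision_ge0 (W0 gam g0) (W0 (k + gam - b) f0) (W0 (k + b) h0).
have T20 c y t : 0 <= T2 c y t.
  by exact: collision_ge0 (W0 gam f0) (W0 (k + gam - b) g0) (W0 (k + b) h0).
have T30 c y t : 0 <= T3 c y t by exact: collision_ge0 p30 (W0 k f0) (W0 k h0).
have T40 c y t : 0 <= T4 c y t by exact: collision_ge0 p40 (W0 k g0) (W0 k h0).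
rewrite gain_integral//.
apply: (@le_trans _ _ (\int[leb3]_c \int[leb3]_y \int[leb2]_t
   ((A * T1 c y t + A * T2 c y t) + (B * T3 c y t + B * T4 c y t))%:E)%E).
  apply: integral_triple_le; first by nneg.
  move=> c y t.
  have := @collision_weight R k gam b m c y (sph t) (dot_sph t) bg g1 _ mk.
  rewrite -/(cpre c y) -/(cpre' c y) -/(cpost c y (sph t)) => /(_ (le_trans _ k8)).
  move=> /(_ (ler1n _ _)).
  rewrite /T1 /T2 /T3 /T4 /p3 /p4 /q /weighted !expr1.
  set w := cpre c y; set w' := cpre' c y; set v := cpost c y (sph t).
  set S := half_sin2 y _; set C := half_sin2 _ _; rewrite -/A -/B => hw.
  have -> : powR (jb v) (2 * k) = powR (jb v) k * powR (jb v) k.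
    by rewrite -ge0_powRD ?(ltW k0)//; congr powR; ring.
  have -> : powR (jb v) (k + b) = powR (jb v) k * powR (jb v) b.
    by rewrite ge0_powRD ?(ltW k0).
  (* The weight inequality is multiplied by this factor: of the two powers [<v>^k] in [q], one is
     consumed by the inequality and the other stays with [h]. *)
  have X0 : 0 <= omega t * (f w' * g w * (h v * powR (jb v) k)).
    by rewrite mulr_ge0 ?omega_ge0// !mulr_ge0// powR_ge0.
  move: hw X0; clearbody S C A B; clear.
  move: (powR (jb v) k) (powR (jb v) b) (powR (jb w) gam) (powR (jb w') gam) => a1 a2 a3 a4.
  move: (powR (jb w) k) (powR (jb w') k) (powR (jb w) (k + gam - b)) => a5 a6 a7.
  move: (powR (jb w') (k + gam - b)) (jb w ^+ 2) (jb w' ^+ 2) (powR (vnorm y) gam) => a8 a9 b1 b2.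
  move: (omega t) (f w) (f w') (g w) (g w') (h v) (S ^+ m) (C ^+ m) => c1 c2 c3 c4 c5 c6 c7 c8.
  move=> hw X0; have := ler_wpM2l X0 hw.
  by congr (_ <= _); ring.
rewrite (integral_triple_lincomb A0 B0 mT1 mT2 mT3 mT4 T10 T20 T30 T40).
have H1 : (\int[leb3]_c \int[leb3]_y \int[leb2]_t (T1 c y t)%:E <=
    (16 * pi / Num.sqrt k * (G1 * (F2 * H2)))%:E)%E.
  apply: (@le_trans _ _ (8 * pi / Num.sqrt m.+1%:R * (G1 * (F2 * H2)))%:E).
    exact: (collision_form_le (mW gam mg) (mW (k + gam - b) mf) (mW (k + b) mh)
      (W0 gam g0) (W0 (k + gam - b) f0) (W0 (k + b) h0) m_gt0 G10 F20 H20 gG1 fF2 hH2).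
  by rewrite lee_fin; apply: ler_wpM2r sq; exact: mulr_ge0 G10 (mulr_ge0 F20 H20).
have H2' : (\int[leb3]_c \int[leb3]_y \int[leb2]_t (T2 c y t)%:E <=
    (16 * pi * (F1 * (G2 * H2)))%:E)%E.
  rewrite /T2 collision_form_opp; [|exact: mW|exact: mW|exact: mW|exact: W0|exact: W0|exact: W0].
  apply: (@le_trans _ _ (8 * pi / Num.sqrt m.+1%:R * (F1 * (G2 * H2)))%:E).
    exact: (collision_form_le (mW gam mf) (mW (k + gam - b) mg) (mW (k + b) mh)
      (W0 gam f0) (W0 (k + gam - b) g0) (W0 (k + b) h0) m_gt0 F10 G20 H20 fF1 gG2 hH2).
  by rewrite lee_fin; apply: ler_wpM2r (le_trans sq sq1); exact: mulr_ge0 F10 (mulr_ge0 G20 H20).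
have H3 : (\int[leb3]_c \int[leb3]_y \int[leb2]_t (T3 c y t)%:E <=
    (8 * pi * Num.sqrt (pi ^+ 3) * (Fk * (Gk * Hk)))%:E)%E.
  exact: (collision_form1_le k5 mg mf mh g0 f0 h0 Gk0 Fk0 Hk0 gGk fFk hHk).
have H4 : (\int[leb3]_c \int[leb3]_y \int[leb2]_t (T4 c y t)%:E <=
    (8 * pi * Num.sqrt (pi ^+ 3) * (Gk * (Fk * Hk)))%:E)%E.
  rewrite /T4 (collision_form_opp 1 mp4 (mW k mg) (mW k mh) p40 (W0 k g0) (W0 k h0)).
  exact: (collision_form1_le k5 mf mg mh f0 g0 h0 Fk0 Gk0 Hk0 fFk gGk hHk).
apply: (@le_trans _ _ ((A%:E * (16 * pi / Num.sqrt k * (G1 * (F2 * H2)))%:E +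
     A%:E * (16 * pi * (F1 * (G2 * H2)))%:E) +
    (B%:E * (8 * pi * Num.sqrt (pi ^+ 3) * (Fk * (Gk * Hk)))%:E +
     B%:E * (8 * pi * Num.sqrt (pi ^+ 3) * (Gk * (Fk * Hk)))%:E))%E).
  by apply: leeD; apply: leeD; apply: lee_wpmul2l; rewrite ?lee_fin.
rewrite -!EFinM -!EFinD lee_fin /A /B le_eqVlt; apply/orP; left; apply/eqP.
by ring.
Qed.

Lemma collision_bound : (\int[leb3]_v \int[leb3]_vs \int[leb2]_tau
    (omega tau * (powR (vnorm (vsub v vs)) gam *
      (f (vspost v vs (sph tau)) * g (vpost v vs (sph tau)) + f vs * g v) * q v))%:E <=
  (32 * expR 1 * pi / Num.sqrt k * (G1 * (F2 * H2)) +
   (32 * expR 1 * pi + 8 * pi) * (F1 * (G2 * H2)) +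
   4 * powR (2 + 2 * k) k * (16 * pi * Num.sqrt (pi ^+ 3)) * (Fk * (Gk * Hk)))%:E)%E.
Proof.
pose D1 v vs tau := omega tau * (powR (vnorm (vsub v vs)) gam *
      (f (vspost v vs (sph tau)) * g (vpost v vs (sph tau))) * q v).
pose D2 v vs tau := omega tau * (powR (vnorm (vsub v vs)) gam * (f vs * g v) * q v).
have mD1 : measurable_fun setT (fun z : V3 * V3 * (R * R) => D1 z.1.1 z.1.2 z.2).
  exact: measurable_gain.
have mD2 : measurable_fun setT (fun z : V3 * V3 * (R * R) => D2 z.1.1 z.1.2 z.2).
  exact: measurable_loss.
have D10 v vs tau : 0 <= D1 v vs tau by rewrite /D1; nneg.
have D20 v vs tau : 0 <= D2 v vs tau by rewrite /D2; nneg.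
apply: (@le_trans _ _ (\int[leb3]_v \int[leb3]_vs \int[leb2]_tau
    (D1 v vs tau + D2 v vs tau)%:E)%E).
  do 3 (apply: ge0_le_integralT => ?; first by nneg).
  by rewrite lee_fin le_eqVlt; apply/orP; left; apply/eqP; rewrite /D1 /D2; ring.
rewrite integral_triple_add//; apply: le_trans (leeD gain loss) _.
rewrite -EFinD lee_fin le_eqVlt; apply/orP; left; apply/eqP; ring.
Qed.

End Bound.
End CollisionBound.

(** * Values of [fine] integrals and finite weighted norms *)

Section Frozen.
Context (R : realType).
Local Notation V3 := (R * R * R)%type.

(* No measurability is needed: both halves of the signed integral are suprema. *)
Lemma abs_fine_integral_le d (T : measurableType d) (nu : {measure set T -> \bar R})
    (D : set T) (F : T -> \bar R) :
  (`|fine (\int[nu]_(x in D) F x)|%:E <= \int[nu]_x `|(F \_ D) x|)%E.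
Proof.
rewrite integral_mkcond; move: (F \_ D) => {F}F; rewrite integralE.
have ge0_part (G : T -> \bar R) : (forall x, 0 <= G x)%E -> (forall x, G x <= `|F x|)%E ->
    (0 <= \int[nu]_x G x <= \int[nu]_x `|F x|)%E.
  by move=> G0 GF; rewrite integral_ge0//= ge0_le_integralT.
have /andP[a0 ale] : (0 <= \int[nu]_x F^\+ x <= \int[nu]_x `|F x|)%E.
  by apply: ge0_part => x; rewrite ?funepos_ge0// funeposE ge_max lee_abs abse_ge0.
have /andP[c0 cle] : (0 <= \int[nu]_x F^\- x <= \int[nu]_x `|F x|)%E.
  by apply: ge0_part => x; rewrite ?funeneg_ge0// funenegE ge_max -abseN lee_abs abse_ge0.
move: a0 ale c0 cle; move: (\int[nu]_x F^\+ x)%E (\int[nu]_x F^\- x)%E => a c.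
case: (\int[nu]_x `|F x|)%E => [I| |]; rewrite ?leey//; last first.
  by case: a => [a| |]//.
case: a => [a| |]//; case: c => [c| |]//=; rewrite !lee_fin => a0 aI c0 cI.
by rewrite ler_norml; apply/andP; split; lra.
Qed.

Lemma wnorm1E (l : R) (f : V3 -> R) :
  wnorm 1 l f = (\int[leb3]_v (weighted (fun x => `|f x|) l v)%:E)%E.
Proof.
rewrite /wnorm invr1 poweRe1; last first.
  by apply: integral_ge0 => v _; rewrite lee_fin mulr_ge0// powR_ge0.
by apply: eq_integral => v _; rewrite /weighted powRr1// mulr1.
Qed.

Lemma wnorm2E (l : R) (f : V3 -> R) :
  wnorm 2 l f = poweR (\int[leb3]_v (weighted (fun x => `|f x|) l v ^+ 2)%:E)%E 2^-1.
Proof.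
rewrite /wnorm; congr poweR; apply: eq_integral => v _; congr _%:E.
by rewrite /weighted exprMn powRrM !powR_mulrn ?powR_ge0.
Qed.

Lemma wnorm1_lty (l : R) (f : V3 -> R) : (wnorm 1 l f < +oo)%E ->
  exists2 N : R, 0 <= N & (wnorm 1 l f = N%:E)%E.
Proof.
have : (0 <= wnorm 1 l f)%E.
  by rewrite wnorm1E integral_ge0// => v _; rewrite lee_fin weighted_ge0.
by case: (wnorm 1 l f) => [N| |]// N0 _; exists N.
Qed.

Lemma wnorm2_lty (l : R) (f : V3 -> R) : (wnorm 2 l f < +oo)%E ->
  exists N : R, [/\ 0 <= N, wnorm 2 l f = N%:E &
    (\int[leb3]_v (weighted (fun x => `|f x|) l v ^+ 2)%:E = (N ^+ 2)%:E)%E].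
Proof.
rewrite wnorm2E; set I := (\int[leb3]_v _)%E.
have : (0 <= I)%E by apply: integral_ge0 => v _; rewrite lee_fin sqr_ge0.
case: I => [x| |]//; last by rewrite poweRyr// ltxx.
rewrite lee_fin => x0 _; exists (Num.sqrt x).
by rewrite sqrtr_ge0 poweR_EFin powR12_sqrt// sqr_sqrtr.
Qed.

Lemma wnorm2_le (l M : R) (f : V3 -> R) : 0 <= M ->
  (\int[leb3]_v (weighted (fun x => `|f x|) l v ^+ 2)%:E <= (M ^+ 2)%:E)%E ->
  (wnorm 2 l f <= M%:E)%E.
Proof.
rewrite wnorm2E; set I := (\int[leb3]_v _)%E => M0.
have : (0 <= I)%E by apply: integral_ge0 => v _; rewrite lee_fin sqr_ge0.
case: I => [x| |]//; rewrite !lee_fin => x0 xM.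
by rewrite powR12_sqrt// -(ger0_norm M0) -sqrtr_sqr ler_wsqrtr.
Qed.

Lemma wnorm2_mono (l l' : R) (f : V3 -> R) : l <= l' ->
  (wnorm 2 l f <= wnorm 2 l' f)%E.
Proof.
move=> ll'; rewrite !wnorm2E; apply: gt0_ler_poweR.
- by rewrite invr_ge0.
- by rewrite in_itv/= leey andbT integral_ge0// => v _; rewrite lee_fin sqr_ge0.
- by rewrite in_itv/= leey andbT integral_ge0// => v _; rewrite lee_fin sqr_ge0.
apply: ge0_le_integralT => v; rewrite lee_fin ?sqr_ge0//.
rewrite ler_pXn2r ?nnegrE ?weighted_ge0//.
by rewrite /weighted ler_wpM2l// ler_powR// jb_ge1.
Qed.

End Frozen.

(** * A nonnegative majorant of the collision operator *)

Section CollisionOperator.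
Context (R : realType).
Local Notation V3 := (R * R * R)%type.
Implicit Types (f g h : V3 -> R) (v : V3).

(** Gain and loss are added instead of subtracted and the value may be infinite, so that Tonelli's
    theorem applies without any convergence. *)
Definition absQ (gam : R) f g v : \bar R :=
  (\int[leb3]_vs \int[leb2]_tau (omega tau * (powR (vnorm (vsub v vs)) gam *
    (f (vspost v vs (sph tau)) * g (vpost v vs (sph tau)) + f vs * g v)))%:E)%E.

Section AbsQ.
Variables (gam : R) (f g : V3 -> R).
Hypotheses (mf : measurable_fun setT f) (mg : measurable_fun setT g).
Hypotheses (f0 : forall v, 0 <= f v) (g0 : forall v, 0 <= g v).

Lemma absQ_ge0 v : (0 <= absQ gam f g v)%E.
Proof. by rewrite /absQ; nneg. Qed.

Lemma measurable_absQ : measurable_fun setT (absQ gam f g).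
Proof. by rewrite /absQ /vspost /vpost; mfun. Qed.

Lemma absQ_scale (c : R) v : 0 <= c ->
  (\int[leb3]_vs \int[leb2]_tau (omega tau * (powR (vnorm (vsub v vs)) gam *
    (f (vspost v vs (sph tau)) * g (vpost v vs (sph tau)) + f vs * g v) * c))%:E =
  absQ gam f g v * c%:E)%E.
Proof.
move=> c0; rewrite [RHS]muleC /absQ.
rewrite -ge0_integralZl ?lee_fin//; [|by rewrite /vspost /vpost; mfun|by nneg].
apply: eq_integral => vs _.
rewrite -ge0_integral_scale//; [|by rewrite /vspost /vpost; mfun|by nneg].
by apply: eq_integral => tau _; congr _%:E; rewrite mulrA mulrC.
Qed.

End AbsQ.

(** Where the integral behind [Qop] is infinite its real value is 0, which [abs_fine_integral_le]
    covers. The angular domain of [Qop] is the indicator contained in [omega], and Tonelli's theorem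
    regroups the product measure into the iterated form of [absQ]. *)
Lemma Qop_le (gam : R) f g v : measurable_fun setT f -> measurable_fun setT g ->
  (`|Qop gam f g v|%:E <= absQ gam (fun x => `|f x|)%R (fun x => `|g x|)%R v)%E.
Proof.
move=> mf mg; rewrite /Qop /Rintegral.
apply: le_trans (abs_fine_integral_le _ _ _) _.
pose G (vs : V3) (tau : R * R) : \bar R := (omega tau * (powR (vnorm (vsub v vs)) gam *
    (`|f (vspost v vs (sph tau))| * `|g (vpost v vs (sph tau))| + `|f vs| * `|g v|)))%:E.
have mG d (T : measurableType d) (a : T -> V3) (t : T -> R * R) :
    measurable_fun setT a -> measurable_fun setT t ->
    measurable_fun setT (fun z => G (a z) (t z)).
  by move=> ma mt; rewrite /G /vspost /vpost; mfun.
have G0 vs tau : (0 <= G vs tau)%E by rewrite /G; nneg.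
apply: (@le_trans _ _ (\int[sigma_prod (sigma_prod leb3 leb) leb]_w G w.1.1 (w.1.2, w.2))%E).
  apply: ge0_le_integralT => w; first exact: abse_ge0.
  rewrite /patch; case: ifPn => wD; last by rewrite abse0.
  move: wD; rewrite inE/= => -[wt wp]; rewrite /G lee_fin /omega/= wt wp !mul1r.
  have s0 : 0 <= sin w.1.2 by apply: sin_ge0_pi.
  rewrite !normrM (ger0_norm s0) (ger0_norm (powR_ge0 _ _)) mulrC ler_wpM2l//.
  rewrite ler_wpM2l ?powR_ge0// (le_trans (ler_normB _ _))// !normrM//.
rewrite (@ge0_integral_prod _ _ _ _ _ (sigma_prod leb3 leb) leb (fun a p => G a.1 (a.2, p)));
  [|by apply: mG; mfun|by move=> *; exact: G0].
rewrite (@ge0_integral_prod _ _ _ _ _ leb3 leb (fun vs t => \int[leb]_p G vs (t, p))%E);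
  [|by mfun; apply: mG; mfun|by nneg].
apply: ge0_le_integralT => vs; first by nneg.
rewrite -(@ge0_integral_prod _ _ _ _ _ leb leb (fun t p => G vs (t, p)));
  [|by apply: mG; mfun|by move=> *; exact: G0].
by apply: ge0_le_integralT => -[t p].
Qed.

End CollisionOperator.

(** * L^2 bounds by duality *)

Section Duality.
Context (R : realType).
Local Notation V3 := (R * R * R)%type.

(* Testing against min(Z, n <v>^-3), which is square integrable, avoids assuming
   that Z is finite or square integrable. *)
Lemma integral_sqr_dual (Z : V3 -> \bar R) (Y : V3 -> R) (M : R) :
  measurable_fun setT Z -> (forall v, (0 <= Z v)%E) -> 0 <= M ->
  (forall (H : V3 -> R) (x : R), measurable_fun setT H -> (forall v, 0 <= H v) -> 0 <= x ->
    (\int[leb3]_v (H v ^+ 2)%:E = (x ^+ 2)%:E)%E ->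
    (\int[leb3]_v (Z v * (H v)%:E) <= (M * x)%:E)%E) ->
  (forall v, 0 <= Y v) -> (forall v, ((Y v)%:E <= Z v)%E) ->
  (\int[leb3]_v (Y v ^+ 2)%:E <= (M ^+ 2)%:E)%E.
Proof.
move=> mZ Z0 M0 test Y0 YZ.
(* [integral_jb_le] at [k = 5]: [<v>^-3] is positive everywhere and square integrable. *)
pose w (v : V3) : R := powR (jb v) (2 - 5).
have w0 v : 0 < w v by rewrite powR_gt0// (lt_le_trans _ (jb_ge1 v)).
have mw : measurable_fun setT w by rewrite /w; mfun.
have wle : (\int[leb3]_v (w v ^+ 2)%:E <= (pi ^+ 3)%:E)%E by exact: integral_jb_le.
pose H n v : R := fine (mine (Z v) (n%:R * w v)%:E).
have HE n v : ((H n v)%:E = mine (Z v) (n%:R * w v)%:E)%E.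
  rewrite fineK// ge0_fin_numE; first by rewrite gt_min ltry orbT.
  by rewrite le_min Z0 lee_fin mulr_ge0// ltW.
have H0 n v : 0 <= H n v.
  by rewrite fine_ge0// le_min Z0 lee_fin mulr_ge0// ltW.
have Hw n v : H n v <= n%:R * w v by rewrite -lee_fin HE ge_min lexx orbT.
have HZ n v : ((H n v)%:E <= Z v)%E by rewrite HE ge_min lexx.
have mH n : measurable_fun setT (H n).
  apply/measurable_EFinP; rewrite (_ : _ \o _ = fun v => mine (Z v) (n%:R * w v)%:E)%E;
    last by apply/funext => v; exact: HE.
  by apply: measurable_mine => //; mfun.
have Hle n : (\int[leb3]_v (H n v ^+ 2)%:E <= (M ^+ 2)%:E)%E.
  set I := (\int[leb3]_v _)%E.
  have I0 : (0 <= I)%E by apply: integral_ge0 => v _; rewrite lee_fin sqr_ge0.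
  have Ile : (I <= (n%:R ^+ 2 * pi ^+ 3)%:E)%E.
    apply: (@le_trans _ _ (\int[leb3]_v (n%:R ^+ 2 * w v ^+ 2)%:E)%E).
      apply: ge0_le_integralT => v; rewrite lee_fin ?sqr_ge0// -exprMn.
      by rewrite ler_pXn2r ?nnegrE// mulr_ge0// ltW.
    rewrite ge0_integral_scale; [|by rewrite sqr_ge0|by mfun|by move=> v; rewrite sqr_ge0].
    by rewrite [X in (_ <= X)%E]EFinM lee_wpmul2l// lee_fin sqr_ge0.
  have If : I \is a fin_num by rewrite ge0_fin_numE// (le_lt_trans Ile)// ltry.
  pose x := Num.sqrt (fine I).
  have x0 : 0 <= x by exact: sqrtr_ge0.
  have xE : (I = (x ^+ 2)%:E)%E by rewrite sqr_sqrtr ?fine_ge0// fineK.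
  (* [H n] is tested against itself: with [H n <= Z] this gives [x^2 <= M x], and x is finite thanks
     to the truncation, so [x <= M]. *)
  have : (I <= (M * x)%:E)%E.
    apply: le_trans (test _ x (mH n) (H0 n) x0 xE).
    apply: ge0_le_integralT => v; rewrite ?lee_fin ?sqr_ge0//.
    by rewrite expr2 EFinM lee_wpmul2r// lee_fin.
  rewrite xE !lee_fin expr2 => h.
  have [xz|xn] := eqVneq x 0; first by rewrite xz mul0r sqr_ge0.
  have xp : 0 < x by rewrite lt_neqAle eq_sym xn.
  by rewrite -expr2 ler_pXn2r// -(ler_pM2r xp).
have Hnd v : nondecreasing_seq (fun n => (H n v ^+ 2)%:E).
  move=> m n mn; rewrite lee_fin ler_pXn2r ?nnegrE// -lee_fin !HE.
  rewrite le_min ge_min lexx/= ge_min; apply/orP; right.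
  by rewrite lee_fin ler_wpM2r ?ler_nat// ltW.
(* The limit dominates [Y^2]: as [Y v] is real and [w v] positive, [Y v <= n w v], hence
   [Y v <= H n v], for all large n. *)
apply: (@le_trans _ _ (\int[leb3]_v limn (fun n => (H n v ^+ 2)%:E))%E).
  apply: ge0_le_integralT => v; first by rewrite lee_fin sqr_ge0.
  apply: lime_ge; first exact: ereal_nondecreasing_is_cvgn.
  near=> n; rewrite lee_fin ler_pXn2r ?nnegrE// -lee_fin HE le_min YZ lee_fin/=.
  rewrite -ler_pdivrMr//; near: n; exact: nbhs_infty_ger.
rewrite monotone_convergence//; [|by move=> n; have := mH n => ?; mfun
  |by move=> n v _; rewrite lee_fin sqr_ge0].
apply: lime_le; last by apply: nearW => n; exact: Hle.
apply: ereal_nondecreasing_is_cvgn => m n mn.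
apply: ge0_le_integralT => v; first by rewrite lee_fin sqr_ge0.
exact: Hnd.
Unshelve. all: by end_near.
Qed.

End Duality.

(** * The pairing and the norm of Q *)

Section AbsQBound.
Context (R : realType).
Local Notation V3 := (R * R * R)%type.
Local Notation abs f := (fun x => `|f x|)%R.

(** [C1] is [2 e], from a dominant velocity, times [16 pi] from the trilinear form; [C2] adds the
    [8 pi] of the loss term. In [Ck], [4 (2 + 2 k)^k] is the price of comparable velocities, [16 pi]
    counts two forms bounded by [8 pi], and [sqrt (pi^3)] is the cost of passing from L^1 with
    weight 2 to L^2_k. *)
Let C1 : R := 32 * expR 1 * pi.
Let C2 : R := 32 * expR 1 * pi + 8 * pi.
Let Ck (k : R) : R := 4 * powR (2 + 2 * k) k * (16 * pi * Num.sqrt (pi ^+ 3)).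

Lemma absQ_pair_le (k gam b : R) (f g h : V3 -> R) (F1 G1 F2 G2 H2 Fk Gk Hk : R) :
  8 <= k -> 0 <= b <= gam -> gam <= 1 ->
  measurable_fun setT f -> measurable_fun setT g -> measurable_fun setT h ->
  (wnorm 1 gam f = F1%:E)%E -> (wnorm 1 gam g = G1%:E)%E ->
  0 <= F1 -> 0 <= G1 -> 0 <= F2 -> 0 <= G2 -> 0 <= H2 -> 0 <= Fk -> 0 <= Gk -> 0 <= Hk ->
  (\int[leb3]_v (weighted (abs f) (k + gam - b) v ^+ 2)%:E = (F2 ^+ 2)%:E)%E ->
  (\int[leb3]_v (weighted (abs g) (k + gam - b) v ^+ 2)%:E = (G2 ^+ 2)%:E)%E ->
  (\int[leb3]_v (weighted (abs h) (k + b) v ^+ 2)%:E = (H2 ^+ 2)%:E)%E ->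
  (\int[leb3]_v (weighted (abs f) k v ^+ 2)%:E = (Fk ^+ 2)%:E)%E ->
  (\int[leb3]_v (weighted (abs g) k v ^+ 2)%:E = (Gk ^+ 2)%:E)%E ->
  (\int[leb3]_v (weighted (abs h) k v ^+ 2)%:E = (Hk ^+ 2)%:E)%E ->
  (\int[leb3]_v (absQ gam (abs f) (abs g) v * (`|h v| * powR (jb v) (2 * k))%:E) <=
    (C1 / Num.sqrt k * (G1 * (F2 * H2)) + C2 * (F1 * (G2 * H2)) +
     Ck k * (Fk * (Gk * Hk)))%:E)%E.
Proof.
move=> k8 bg g1 mf mg mh; rewrite !wnorm1E => fF1 gG1 F10 G10 F20 G20 H20 Fk0 Gk0 Hk0.
move=> fF2 gG2 hH2 fFk gGk hHk.
have mN (u : V3 -> R) : measurable_fun setT u -> measurable_fun setT (abs u).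
  by move=> mu'; mfun.
have N0 (u : V3 -> R) v : 0 <= `|u v| by exact: normr_ge0.
apply: le_trans (collision_bound k8 bg g1 (mN f mf) (mN g mg) (mN h mh) (N0 f) (N0 g) (N0 h)
  F10 G10 F20 G20 H20 Fk0 Gk0 Hk0 fF1 gG1 fF2 gG2 hH2 fFk gGk hHk).
apply: ge0_le_integralT => v.
  apply: mule_ge0; first exact: absQ_ge0 (N0 f) (N0 g) v.
  by rewrite lee_fin mulr_ge0// powR_ge0.
have c0 : 0 <= `|h v| * powR (jb v) (2 * k) by rewrite mulr_ge0// powR_ge0.
by rewrite -(absQ_scale gam (mN f mf) (mN g mg) (N0 f) (N0 g) v c0).
Qed.

Lemma pair_Qop_le (k gam : R) (f g h : V3 -> R) : 8 <= k -> 0 <= gam <= 1 ->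
  measurable_fun setT f -> measurable_fun setT g -> measurable_fun setT h ->
  (wnorm 1 gam f < +oo)%E -> (wnorm 1 gam g < +oo)%E ->
  (wnorm 2 (k + gam / 2) f < +oo)%E -> (wnorm 2 (k + gam / 2) g < +oo)%E ->
  (wnorm 2 (k + gam / 2) h < +oo)%E ->
  ((pair (Qop gam f g) (fun v => (h v * powR (jb v) (2 * k))%R))%:E <=
        (C1 / Num.sqrt k)%:E * wnorm 1 gam g * wnorm 2 (k + gam / 2) f
          * wnorm 2 (k + gam / 2) h
      + C2%:E * wnorm 1 gam f * wnorm 2 (k + gam / 2) g * wnorm 2 (k + gam / 2) h
      + (Ck k)%:E * wnorm 2 k f * wnorm 2 k g * wnorm 2 k h)%E.
Proof.
move=> k8 /andP[gam0 gam1] mf mg mh fF1 gG1 fF2 gG2 hH2.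
have low u : (wnorm 2 (k + gam / 2) u < +oo -> wnorm 2 k u < +oo)%E.
  by apply: le_lt_trans; apply: wnorm2_mono; rewrite lerDl divr_ge0.
have [F1 F10 eF1] := wnorm1_lty fF1; have [G1 G10 eG1] := wnorm1_lty gG1.
have [F2 [F20 eF2 iF2]] := wnorm2_lty fF2; have [G2 [G20 eG2 iG2]] := wnorm2_lty gG2.
have [H2 [H20 eH2 iH2]] := wnorm2_lty hH2.
have [Fk [Fk0 eFk iFk]] := wnorm2_lty (low f fF2).
have [Gk [Gk0 eGk iGk]] := wnorm2_lty (low g gG2).
have [Hk [Hk0 eHk iHk]] := wnorm2_lty (low h hH2).
rewrite eF1 eG1 eF2 eG2 eH2 eFk eGk eHk.
apply: (@le_trans _ _ (C1 / Num.sqrt k * (G1 * (F2 * H2)) + C2 * (F1 * (G2 * H2)) +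
     Ck k * (Fk * (Gk * Hk)))%:E); last first.
  by rewrite -!EFinM -!EFinD lee_fin !mulrA.
(* With [b = gam / 2] the exponents [k + gam - b] and [k + b] coincide. *)
have eg : k + gam - gam / 2 = k + gam / 2 by field.
have bg : 0 <= gam / 2 <= gam by apply/andP; split; lra.
rewrite -eg in iF2 iG2.
apply: le_trans (absQ_pair_le k8 bg gam1 mf mg mh eF1 eG1 F10 G10 F20 G20 H20 Fk0 Gk0 Hk0
  iF2 iG2 iH2 iFk iGk iHk).
rewrite /pair /Rintegral; apply: le_trans (_ : (_ <= `|fine _|%:E)%E) _.
  by rewrite lee_fin; exact: ler_norm.
apply: le_trans (abs_fine_integral_le _ _ _) _.
apply: ge0_le_integralT => v; first exact: abse_ge0.
rewrite patch_setT /= !normrM (ger0_norm (powR_ge0 _ _)) EFinM.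
by apply: lee_wpmul2r; [rewrite lee_fin mulr_ge0// powR_ge0|exact: Qop_le].
Qed.

Lemma wnorm_Qop_le (k gam : R) (f g : V3 -> R) : 8 <= k -> 0 <= gam <= 1 ->
  measurable_fun setT f -> measurable_fun setT g ->
  (wnorm 1 gam f < +oo)%E -> (wnorm 1 gam g < +oo)%E ->
  (wnorm 2 (k + gam) f < +oo)%E -> (wnorm 2 (k + gam) g < +oo)%E ->
  (wnorm 2 k (Qop gam f g) <=
        (C1 / Num.sqrt k)%:E * wnorm 1 gam g * wnorm 2 (k + gam) f
      + C2%:E * wnorm 1 gam f * wnorm 2 (k + gam) g
      + (Ck k)%:E * wnorm 2 k f * wnorm 2 k g)%E.
Proof.
move=> k8 /andP[gam0 gam1] mf mg fF1 gG1 fF2 gG2.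
have low u : (wnorm 2 (k + gam) u < +oo -> wnorm 2 k u < +oo)%E.
  by apply: le_lt_trans; apply: wnorm2_mono; rewrite lerDl.
have [F1 F10 eF1] := wnorm1_lty fF1; have [G1 G10 eG1] := wnorm1_lty gG1.
have [F2 [F20 eF2 iF2]] := wnorm2_lty fF2; have [G2 [G20 eG2 iG2]] := wnorm2_lty gG2.
have [Fk [Fk0 eFk iFk]] := wnorm2_lty (low f fF2).
have [Gk [Gk0 eGk iGk]] := wnorm2_lty (low g gG2).
rewrite eF1 eG1 eF2 eG2 eFk eGk -!EFinM -!EFinD.
have pi0 : 0 <= pi :> R := pi_ge0 R.
have e0 : 0 <= expR 1 :> R := expR_ge0 1.
have C10 : 0 <= C1 by rewrite /C1 !mulr_ge0.
have C20 : 0 <= C2 by rewrite /C2 addr_ge0// !mulr_ge0.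
have Ck0 : 0 <= Ck k by rewrite /Ck !mulr_ge0 ?powR_ge0 ?sqrtr_ge0.
set M := (X in (_ <= X%:E)%E).
have M0 : 0 <= M.
  have s0 : 0 <= (Num.sqrt k)^-1 by rewrite invr_ge0 sqrtr_ge0.
  rewrite /M; move: C1 C2 (Ck k) C10 C20 Ck0 => c1 c2 ck c10 c20 ck0.
  by rewrite !addr_ge0// !mulr_ge0.
have aN (u : V3 -> R) v : 0 <= `|u v| by exact: normr_ge0.
have mN (u : V3 -> R) : measurable_fun setT u -> measurable_fun setT (abs u).
  by move=> mu'; mfun.
have Q0 v : (0 <= absQ gam (abs f) (abs g) v)%E by exact: absQ_ge0 (aN f) (aN g) v.
have mQ := measurable_absQ gam (mN f mf) (mN g mg) (aN f) (aN g).
(* Duality is applied to the majorant, which is measurable by Tonelli's theorem, and the bound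
   passes to [Qop] pointwise. *)
pose Z v := (absQ gam (abs f) (abs g) v * (powR (jb v) k)%:E)%E.
apply: wnorm2_le => //; apply: (@integral_sqr_dual _ Z) => //.
- apply: emeasurable_funM => //; mfun.
- by move=> v; apply: mule_ge0 => //; rewrite lee_fin powR_ge0.
- move=> H x mH H0 x0 Hx.
  (* This makes [h <v>^(2 k)] equal to [H <v>^k], the weight in [Z], and the L^2_k norm of [h] equal
     to [x]. The choice [b = 0] asks for no other norm of [h]. *)
  pose h v := H v * (powR (jb v) k)^-1.
  have J0 v : powR (jb v) k != 0.
    by rewrite gt_eqF// powR_gt0// (lt_le_trans _ (jb_ge1 v)).
  have mh : measurable_fun setT h by rewrite /h; mfun.
  have hE v : `|h v| = h v by rewrite ger0_norm// mulr_ge0// invr_ge0 powR_ge0.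
  have ih : (\int[leb3]_v (weighted (abs h) k v ^+ 2)%:E = (x ^+ 2)%:E)%E.
    by rewrite -Hx; apply: eq_integral => v _; rewrite /weighted hE mulfVK.
  have bg : (0 : R) <= (0 : R) <= gam by rewrite lexx.
  rewrite -[k + gam]subr0 in iF2 iG2.
  have ih0 := ih; rewrite -[k]addr0 in ih0.
  have := absQ_pair_le k8 bg gam1 mf mg mh eF1 eG1 F10 G10 F20 G20 x0 Fk0 Gk0 x0
    iF2 iG2 ih0 iFk iGk ih.
  congr (_ <= _)%E; last by congr _%:E; rewrite /M; ring.
  apply: eq_integral => v _; rewrite /Z -muleA; congr (_ * _)%E.
  rewrite -EFinM hE; congr _%:E; rewrite /h mulr_natl mulr2n powRD.
    by field.
  by rewrite (gt_eqF (lt_le_trans ltr01 (jb_ge1 v))) implybT.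
- by move=> v; exact: weighted_ge0.
- by move=> v; rewrite /weighted /Z EFinM lee_wpmul2r ?lee_fin ?powR_ge0// Qop_le.
Qed.

End AbsQBound.

Theorem theorem2p1 (R : realType) :
  exists C1 C2 : R, 0 < C1 /\ 0 < C2 /\
  forall k : R, 8 <= k ->
  exists Ck : R, 0 < Ck /\
  forall gam : R, 0 <= gam <= 1 ->
  (forall f g h : (R * R * R)%type -> R,
     measurable_fun setT f -> measurable_fun setT g -> measurable_fun setT h ->
     (wnorm 1 gam f < +oo)%E -> (wnorm 1 gam g < +oo)%E ->
     (wnorm 2 (k + gam / 2) f < +oo)%E -> (wnorm 2 (k + gam / 2) g < +oo)%E ->
     (wnorm 2 (k + gam / 2) h < +oo)%E ->
     ((pair (Qop gam f g) (fun v => h v * powR (jb v) (2 * k)))%:E <=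
        (C1 / Num.sqrt k)%:E * wnorm 1 gam g * wnorm 2 (k + gam / 2) f
          * wnorm 2 (k + gam / 2) h
      + C2%:E * wnorm 1 gam f * wnorm 2 (k + gam / 2) g * wnorm 2 (k + gam / 2) h
      + Ck%:E * wnorm 2 k f * wnorm 2 k g * wnorm 2 k h)%E)
  /\
  (forall f g : (R * R * R)%type -> R,
     measurable_fun setT f -> measurable_fun setT g ->
     (wnorm 1 gam f < +oo)%E -> (wnorm 1 gam g < +oo)%E ->
     (wnorm 2 (k + gam) f < +oo)%E -> (wnorm 2 (k + gam) g < +oo)%E ->
     (wnorm 2 k (Qop gam f g) <=
        (C1 / Num.sqrt k)%:E * wnorm 1 gam g * wnorm 2 (k + gam) f
      + C2%:E * wnorm 1 gam f * wnorm 2 (k + gam) g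
      + Ck%:E * wnorm 2 k f * wnorm 2 k g)%E).
Proof.
have pi0 : 0 < pi :> R := pi_gt0 R; have e0 : 0 < expR 1 :> R := expR_gt0 1.
exists (32 * expR 1 * pi), (32 * expR 1 * pi + 8 * pi).
split; first by rewrite !mulr_gt0.
split; first by rewrite addr_gt0// !mulr_gt0.
move=> k k8; exists (4 * powR (2 + 2 * k) k * (16 * pi * Num.sqrt (pi ^+ 3))).
split; first by rewrite !mulr_gt0 ?powR_gt0 ?sqrtr_gt0 ?exprn_gt0//; lra.
move=> gam gam01; split=> [f g h|f g]; [exact: pair_Qop_le|exact: wnorm_Qop_le].
Qed.
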